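(* Let $\mathcal P$ be an exponentially clustering spin model on $\mathbb Z^d$, and let $\xi=\xi_{NN}$ be the nearest neighbour distance score function. Set $H_n=\sum_{x\in\mathcal P_n}\xi_{NN}(x,\mathcal P_n)$. If for some $\nu>0$ it holds that $\operatorname{Var}(H_n)=\Omega(w_n^\nu)$, then as $n\to\infty$, $$\operatorname{Var}(H_n)^{-1/2}\bigl(H_n-\mathbb E(H_n)\bigr)\stackrel{d}{\Rightarrow}N(0,1).$$
   Context: $\mathbb Z^d$ is the Cayley graph with edges between points at $\ell_1$-distance $1$; $|x|$ is the $\ell_1$-norm, $W_r(x)=\{y\in\mathbb Z^d:|x-y|\le r\}$, $W_r=W_r(O)$ with $O$ the origin, $w_n=|W_n|$. $a_n=\Omega(b_n)$ means there is $c>0$ with $a_n\ge c\,b_n$ for all large $n$. For $\mu\subset\mathbb Z^d$ and $x,y\in\mu$, $(x,y)$ is a nearest neighbour edge (NNE) of $\mu$ if $\mu\cap W_r(x)=\{x\}$ for all $r<|x-y|$. For $x\in\mu$, $\xi_{NN}(x,\mu)=\sum_{y\in\mathbb Z^d}|x-y|\,\mathbf 1[(x,y)\text{ is an NNE of }\mu]$; $\xi_{NN}(x,\mu)=0$ if $x\notin\mu$. A spin model is a random element $\mathcal P$ of $\{0,1\}^{\mathbb Z^d}$, identified with a random subset of $\mathbb Z^d$; $\mathcal P_n=\mathcal P\cap W_n$. It is stationary if $\mathcal P+y\stackrel d=\mathcal P$ for all $y\in\mathbb Z^d$, non-degenerate if $\mathbb P(O\in\mathcal P)\in(0,1)$.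 A function $\phi:[0,\infty)\to[0,\infty)$ is fast decreasing if $\phi\le1$, $\phi$ is decreasing and $\lim_{s\to\infty}s^m\phi(s)=0$ for all $m\ge1$. A stationary non-degenerate $\mathcal P$ is an exponentially clustering spin model if there are constants $C_k,c_k\in(0,\infty)$ ($C_k$ non-decreasing, $c_k$ non-increasing in $k$) and a fast decreasing $\phi$ such that for all $p,q\ge1$ and distinct $x_1,\dots,x_{p+q}\in\mathbb Z^d$, $$|\mathbb P(\{x_1,\dots,x_{p+q}\}\subset\mathcal P)-\mathbb P(\{x_1,\dots,x_p\}\subset\mathcal P)\mathbb P(\{x_{p+1},\dots,x_{p+q}\}\subset\mathcal P)|\le C_{p+q}\phi(c_{p+q}s),$$ where $s=\min_{1\le i\le p,\,1\le j\le q}|x_i-x_{p+j}|$, and moreover $c_k\ge c>0$ for all $k$, $C_k=O(k^{ak})$ for some $a\in[0,1)$, and $\limsup_{t\to\infty}\log\phi(t)/t^b<0$ for some $b\in(0,\infty)$. *)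

(* Defs.v *)
From HB Require Import structures.
From mathcomp Require Import all_boot all_order all_algebra finmap.
From mathcomp Require Import all_classical all_reals all_analysis.

Set Implicit Arguments.
Unset Strict Implicit.
Unset Printing Implicit Defensive.

Import Order.TTheory GRing.Theory Num.Theory.
Import numFieldNormedType.Exports.

Local Open Scope classical_set_scope.
Local Open Scope ring_scope.

(* Points of Z^d are integer row vectors. *)
Definition l1norm (d : nat) (x : 'rV[int]_d) : nat :=
  (\sum_(i < d) `|x ord0 i|)%N.

(* The l1-norm is integer-valued, so it is enough to consider balls of natural
   radius: a ball of real radius r >= 0 is the ball of radius floor r. *)
Definition l1ball (d : nat) (x : 'rV[int]_d) (r : nat) : set 'rV[int]_d :=
  [set y | (l1norm (x - y) <= r)%N].

Definition window (d n : nat) : set 'rV[int]_d := l1ball 0 n.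

Arguments window d n : clear implicits.

Definition window_card (d n : nat) : nat := #|` fset_set (window d n)|.

Definition is_NNE (d : nat) (mu : set 'rV[int]_d) (x y : 'rV[int]_d) : Prop :=
  [/\ mu x, mu y &
      forall r : nat, (r < l1norm (x - y))%N -> mu `&` l1ball x r = [set x]].

(* If x is not in mu, no (x, y) is an NNE and the sum is 0. Otherwise all the
   nearest neighbours of x are at the same distance, so that the sum has finite
   support and the finitely supported big operator is the true sum. *)
Definition xi_NN (R : realType) (d : nat) (x : 'rV[int]_d)
    (mu : set 'rV[int]_d) : R :=
  \sum_(y \in [set y | is_NNE mu x y]) ((l1norm (x - y))%:R : R).

(* {0,1}^(Z^d), seen as the subsets of Z^d, with the product sigma-algebra,
   i.e. the one generated by the coordinate events. *)
Definition coordinate_events (d : nat) : set (set (set 'rV[int]_d)) :=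
  [set A | exists x : 'rV[int]_d, A = [set mu | mu x]].

Notation configuration d := (g_sigma_algebraType (@coordinate_events d)).

Section spin_models.
Context (R : realType) (disp : measure_display) (T : measurableType disp).
Context (Pr : probability T R) (d : nat).
Implicit Types X : {RV Pr >-> configuration d}.

Definition translate (y : 'rV[int]_d) (mu : configuration d) :
  configuration d := [set x + y | x in (mu : set 'rV[int]_d)].

Definition stationary X : Prop :=
  forall (y : 'rV[int]_d) (A : set (configuration d)), measurable A ->
    pushforward Pr (translate y \o X) A = pushforward Pr X A.

Definition non_degenerate X : Prop :=
  (0 < Pr [set w | X w 0%R] < 1)%E.

Definition fast_decreasing (phi : R -> R) : Prop :=
  [/\ forall s : R, 0 <= s -> 0 <= phi s <= 1,
      forall s t : R, 0 <= s -> s <= t -> phi t <= phi s &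
      forall m : nat, (1 <= m)%N -> s ^+ m * phi s @[s --> +oo] --> (0 : R)].

Definition contains_event X (k : nat) (x : 'I_k -> 'rV[int]_d) : set T :=
  [set w | forall i, X w (x i)].

(* The infimum of a finite set, nonempty if p, q >= 1, hence a minimum. *)
Definition separation (p q : nat) (x : 'I_(p + q) -> 'rV[int]_d) : R :=
  inf [set r : R | exists (i : 'I_p) (j : 'I_q),
         r = (l1norm (x (lshift q i) - x (rshift p j)))%:R].

Definition clustering_bound X (C c : nat -> R) (phi : R -> R) : Prop :=
  forall (p q : nat) (x : 'I_(p + q) -> 'rV[int]_d),
    (1 <= p)%N -> (1 <= q)%N -> injective x ->
    (`| Pr (contains_event X x)
        - Pr (contains_event X (fun i : 'I_p => x (lshift q i)))
          * Pr (contains_event X (fun j : 'I_q => x (rshift p j))) |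
     <= (C (p + q)%N * phi (c (p + q)%N * separation x))%:E)%E.

(* The extended logarithm lne is used because phi may vanish:
   lne 0 = -oo, whereas ln 0 = 0. *)
Definition exponentially_clustering X : Prop :=
  stationary X /\ non_degenerate X /\
  exists (C c : nat -> R) (phi : R -> R),
    [/\ (forall k, 0 < C k) /\ {homo C : k l / (k <= l)%N >-> k <= l},
        (forall k, 0 < c k) /\ {homo c : k l / (k <= l)%N >-> l <= k},
        fast_decreasing phi &
        clustering_bound X C c phi] /\
    [/\ (exists2 c0 : R, 0 < c0 & forall k, c0 <= c k),
        (exists2 a : R, 0 <= a < 1 &
           C =O_\oo (fun k : nat => k%:R `^ (a * k%:R))) &
        (exists2 b : R, 0 < b &
           (limf_esup (fun t : R => lne (phi t)%:E / (t `^ b)%:E)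
                      (+oo%R : set_system R) < 0)%E)].

Definition H_NN X (n : nat) (w : T) : R :=
  let Pn : set 'rV[int]_d := (X w : set 'rV[int]_d) `&` window d n in
  \sum_(x \in Pn) xi_NN R x Pn.

End spin_models.

(* Convergence of the distribution functions at every continuity point of the
   limit distribution function, i.e. at every x which is not an atom of mu. *)
Definition cvg_in_distribution (R : realType) (disp : measure_display)
    (T : measurableType disp) (Pr : probability T R) (Y : nat -> T -> R)
    (mu : set R -> \bar R) : Prop :=
  forall x : R, mu [set x] = 0%E ->
    Pr [set w | Y n w <= x] @[n --> \oo] --> mu `]-oo, x]%classic.

(* Main.v *)
(** The proof is by cumulants. Since H_n depends on the spins in a finite window
    only, everything takes place on the finite probability space of the subsets
    of W_n.

    Growth of cumulants. The cumulant of order k of the sum of the scores over a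
    set C of sites is a polynomial of degree k in the indicators of the sites, so
    by Moebius inversion it is a sum over subsets B of C of size at most k. If B
    is spread out, an annulus free of B splits it into two distant parts, and
    clustering makes its term negligible; the number of remaining subsets is
    linear in the volume, up to powers of the local scale. The scores are
    truncated at a small power of n: a point without neighbours at that distance
    leaves many well-separated sites empty, which by clustering has a probability
    decreasing faster than any power of n. Hence every cumulant of H_n is
    O(n^(d+1)). As the variance is at least c n^nu, all the cumulants of large
    order of the standardized sum tend to 0.

    From cumulants to normality. Mean 0, variance 1 and vanishing high cumulants
    bound all moments, so along any ultrafilter the moments converge to a moment
    sequence with finitely many nonzero cumulants, which is Gaussian by
    Marcinkiewicz's theorem. Convergence of moments then gives convergence of the
    distribution functions, by sandwiching the indicator of a half-line between
    trigonometric polynomials of nearly equal Gaussian mean. *)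

Require Import Defs.
From mathcomp Require Import all_boot all_order all_algebra finmap.
From mathcomp Require Import all_classical all_reals all_analysis.
From mathcomp Require Import measurable_realfun ring lra zify.

Set Implicit Arguments.
Unset Strict Implicit.
Unset Printing Implicit Defensive.

Import Order.TTheory GRing.Theory Num.Theory.
Import numFieldNormedType.Exports.

Local Open Scope classical_set_scope.
Local Open Scope ring_scope.

(** The exponent nu may be arbitrarily small, so the bound n^(d+1) controls only the cumulants of
    order larger than about 2(d+1)/nu after standardization; those from 3 up to this threshold are
    out of reach of a direct estimate. This is why Marcinkiewicz's theorem is applied to the limits
    of the moments. Cumulants are handled formally, as coefficients of M'/M where M is the series of
    the moments divided by factorials. The recursion M' = (M'/M) M passes between moments and
    cumulants in both directions, with bounds uniform in the probability space. The complex argument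
    behind Marcinkiewicz's theorem is carried out with real cosine series, a phase parameter
    replacing complex values. On the spin side, the factor 4^v from expanding functions of v sites
    and the clustering constant, at most of order exp(v^2), must be beaten by a decay of
    correlations which is stretched exponential with a possibly tiny exponent b. So the truncation
    scale is fixed first, as a power of an auxiliary integer u, then the separation, as a power of u
    chosen in terms of b; n is comparable to a still higher power of u. *)

Lemma cvg_sumr (R : realType) T (F : set_system T) {FF : Filter F} I (r : seq I)
    (P : pred I) (f : I -> T -> R) (l : I -> R) :
  (forall i, P i -> f i @ F --> l i) ->
  (fun x => \sum_(i <- r | P i) f i x) @ F --> \sum_(i <- r | P i) l i.
Proof.
move=> H; elim: r => [|i r IH].
  by rewrite big_nil; under eq_cvg do rewrite big_nil; apply: cvg_cst.
rewrite big_cons; under eq_cvg do rewrite big_cons; case: ifP => Pi //.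
by apply: cvgD => //; exact: H.
Qed.

(** * Cumulants *)

Section cumulants.
Variable R : realType.
Implicit Types (a b c p q : nat -> R).

Definition conv a b (k : nat) : R := \sum_(j < k.+1) a j * b (k - j)%N.

Definition dser p (k : nat) : R := k.+1%:R * p k.+1.

(* The coefficients of M'/M for the power series M with coefficients p,
   computed by the recursion M' = (M'/M) M. *)
Fixpoint logd_upto p (k : nat) : nat -> R :=
  if k is k'.+1 then
    let b := logd_upto p k' in
    fun j => if j == k' then dser p k' - \sum_(i < k') b i * p (k' - i)%N
             else b j
  else fun=> 0.

(** When p is the sequence of moments divided by factorials, this is the cumulant of order k + 1
    divided by k!: the index is one less than the order. *)
Definition logd p (k : nat) : R := logd_upto p k.+1 k.

Lemma logd_uptoE p k j : (j < k)%N -> logd_upto p k j = logd p j.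
Proof.
elim: k => // k IH; rewrite ltnS leq_eqVlt => /orP[/eqP ->//|jk].
by rewrite /= ltn_eqF// IH.
Qed.

Lemma logd_rec p k :
  logd p k = dser p k - \sum_(i < k) logd p i * p (k - i)%N.
Proof.
rewrite {1}/logd /= eqxx; congr (_ - _).
by apply: eq_bigr => i _; rewrite logd_uptoE.
Qed.

Lemma dser_logd p k : p 0 = 1 -> dser p k = conv (logd p) p k.
Proof.
by move=> p0; rewrite /conv big_ord_recr/= subnn p0 mulr1 logd_rec addrC subrK.
Qed.

Lemma logd_unique p b K : p 0 = 1 ->
  (forall k, (k < K)%N -> dser p k = conv b p k) ->
  forall k, (k < K)%N -> logd p k = b k.
Proof.
move=> p0 H; elim/ltn_ind => k IH kK; rewrite logd_rec H// /conv.
rewrite big_ord_recr/= subnn p0 mulr1 addrAC.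
rewrite (eq_bigr (fun i : 'I_k => logd p i * p (k - i)%N)) ?subrr ?add0r//.
by move=> i _; rewrite IH// (ltn_trans _ kK).
Qed.

(** A coefficient of a product only involves truncations of the factors, so polynomial arithmetic
    yields commutativity, associativity and the Leibniz rule for [conv]. *)
Let pl (N : nat) a := \poly_(i < N) a i.

Let conv_poly a b k N : (k < N)%N -> conv a b k = (pl N a * pl N b)`_k.
Proof.
move=> kN; rewrite coefM; apply: eq_bigr => i _.
have ik : (i <= k)%N by rewrite -ltnS.
by rewrite !coef_poly (leq_ltn_trans ik kN) (leq_ltn_trans (leq_subr _ _) kN).
Qed.

Lemma convC a b k : conv a b k = conv b a k.
Proof. by rewrite !(@conv_poly _ _ _ k.+1)// mulrC. Qed.

Lemma convA a b c k : conv (conv a b) c k = conv a (conv b c) k.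
Proof.
rewrite !(@conv_poly _ _ _ k.+1)//.
transitivity ((pl k.+1 a * pl k.+1 b * pl k.+1 c)`_k).
  rewrite !coefM; apply: eq_bigr => i _; congr (_ * _).
  by rewrite /pl coef_poly ltn_ord (@conv_poly _ _ _ k.+1).
rewrite -mulrA [in LHS]coefM [in RHS]coefM; apply: eq_bigr => i _; congr (_ * _).
rewrite [in RHS]/pl coef_poly (leq_ltn_trans (leq_subr _ _) (ltnSn k)).
by rewrite (@conv_poly _ _ _ k.+1)// (leq_ltn_trans (leq_subr _ _)).
Qed.

Lemma convDl a b c k : conv (fun i => a i + b i) c k = conv a c k + conv b c k.
Proof. by rewrite /conv -big_split/=; apply: eq_bigr => i _; rewrite mulrDl. Qed.

Lemma eq_conv a a' b b' k :
  (forall j, (j <= k)%N -> a j = a' j) -> (forall j, (j <= k)%N -> b j = b' j) ->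
  conv a b k = conv a' b' k.
Proof.
move=> ha hb; apply: eq_bigr => i _; rewrite ha ?hb ?leq_subr//.
by rewrite -ltnS.
Qed.

Lemma dser_conv p q k :
  dser (conv p q) k = conv (dser p) q k + conv p (dser q) k.
Proof.
rewrite {1}/dser (@conv_poly _ _ _ k.+2)// mulr_natl -coef_deriv derivM coefD.
congr (_ + _); rewrite coefM; apply: eq_bigr => i _.
  have ik : (i <= k)%N by rewrite -ltnS.
  rewrite coef_deriv !coef_poly /dser mulr_natl.
  by rewrite ltnS ltn_ord (leq_ltn_trans (leq_subr _ _))// leqW.
have ik : (i <= k)%N by rewrite -ltnS.
rewrite coef_deriv !coef_poly /dser mulr_natl.
by rewrite !ltnS leq_subr leqW.
Qed.

(** Logarithmic derivatives turn products into sums; by uniqueness of the solution of the recursion,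
    this is the Leibniz rule. *)
Lemma logd_conv p q k : p 0 = 1 -> q 0 = 1 ->
  logd (conv p q) k = logd p k + logd q k.
Proof.
move=> p0 q0; have pq0 : conv p q 0 = 1.
  by rewrite /conv big_ord1 p0 q0 mul1r.
apply: (@logd_unique _ (fun i => logd p i + logd q i) k.+1) => // j _.
rewrite dser_conv convDl -convA; congr (_ + _).
  by apply: eq_conv => // i _; rewrite dser_logd.
rewrite (convC (logd q)) convA; apply: eq_conv => // i _.
by rewrite dser_logd// convC.
Qed.

Lemma logd_scale p (t : R) k :
  logd (fun j => t ^+ j * p j) k = t ^+ k.+1 * logd p k.
Proof.
elim/ltn_ind: k => k IH; rewrite !logd_rec /dser mulrBr; congr (_ - _).
  by rewrite mulrCA.
rewrite mulr_sumr; apply: eq_bigr => i _; rewrite IH//.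
have -> : k.+1 = (i.+1 + (k - i))%N by rewrite addSn subnKC// ltnW.
by rewrite exprD mulrACA.
Qed.

(* The moments of a constant: M = e^(tz), so that M'/M is the constant t. *)
Lemma logd_exp (t : R) k :
  logd (fun j => t ^+ j / j`!%:R) k = if k == 0%N then t else 0.
Proof.
apply: (@logd_unique _ (fun k => if k == 0%N then t else 0) k.+1) => //.
  by rewrite expr0 fact0 divr1.
move=> j _; rewrite /conv big_ord_recl/= big1 ?addr0; last first.
  by move=> i _; rewrite mul0r.
rewrite subn0 /dser factS natrM exprS.
have f0 : j`!%:R != 0 :> R by rewrite pnatr_eq0 -lt0n fact_gt0.
have j0 : j.+1%:R != 0 :> R by rewrite pnatr_eq0.
move: f0 j0; move: (j`!%:R : R) (j.+1%:R : R) (t ^+ j) => x y z x0 y0.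
by field; rewrite x0 y0.
Qed.

(** [logd p k] is a sum of products of coefficients of total index k + 1, so bounds geometric in the
    index survive the recursion, and an error eps is multiplied by a constant depending on k only.
    With p' = p and eps = 0 this serves as a plain bound on a cumulant. *)
Lemma logd_lipschitz k : exists2 c : R, 0 <= c & forall B eps p p',
  0 <= B -> 0 <= eps ->
  (forall j, (j <= k.+1)%N -> `|p j| <= B ^+ j) ->
  (forall j, (j <= k.+1)%N -> `|p' j| <= B ^+ j) ->
  (forall j, (j <= k.+1)%N -> `|p j - p' j| <= eps * B ^+ j) ->
  `|logd p k| <= c * B ^+ k.+1 /\
  `|logd p k - logd p' k| <= c * eps * B ^+ k.+1.
Proof.
elim/ltn_ind: k => k IH.
have /choice[C HC] : forall i : 'I_k, exists c : R, 0 <= c /\ forall B eps p p',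
  0 <= B -> 0 <= eps ->
  (forall j, (j <= i.+1)%N -> `|p j| <= B ^+ j) ->
  (forall j, (j <= i.+1)%N -> `|p' j| <= B ^+ j) ->
  (forall j, (j <= i.+1)%N -> `|p j - p' j| <= eps * B ^+ j) ->
  `|logd p i| <= c * B ^+ i.+1 /\
  `|logd p i - logd p' i| <= c * eps * B ^+ i.+1.
  by move=> i; have [c c0 H] := IH i (ltn_ord i); exists c.
have S0 : 0 <= \sum_(i < k) C i by apply: sumr_ge0 => i _; have [] := HC i.
exists (k.+1%:R + 2 * \sum_(i < k) C i).
  by rewrite addr_ge0// mulr_ge0.
move=> B eps p p' B0 e0 Hp Hp' He.
have Hi : forall i : 'I_k, `|logd p i| <= C i * B ^+ i.+1 /\
    `|logd p i - logd p' i| <= C i * eps * B ^+ i.+1.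
  move=> i; have [_ H] := HC i.
  have ik j : (j <= i.+1)%N -> (j <= k.+1)%N.
    by move=> ji; apply: leq_trans ji _; rewrite ltnS ltnW.
  by apply: H => // j /ik ?; auto.
have kE (i : 'I_k) : B ^+ k.+1 = B ^+ i.+1 * B ^+ (k - i).
  by rewrite -exprD addSn subnKC// ltnW.
split.
  rewrite logd_rec mulrDl; apply: le_trans (ler_normB _ _) _; apply: lerD.
    by rewrite /dser normrM normr_nat ler_wpM2l// Hp.
  apply: le_trans (ler_norm_sum _ _ _) _.
  rewrite -mulrA [_ * B ^+ _]mulr_suml mulr_sumr; apply: ler_sum => i _.
  have [h1 _] := Hi i; have [C0 _] := HC i.
  rewrite normrM (kE i) mulrA (@le_trans _ _ (C i * B ^+ i.+1 * B ^+ (k - i)))//.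
    by apply: ler_pM => //; apply: Hp; rewrite (leq_trans (leq_subr _ _)).
  rewrite -!mulrA ler_peMl ?ler1n// !mulr_ge0// exprn_ge0//.
rewrite !logd_rec opprD addrACA -opprD -mulrA mulrDl.
apply: le_trans (ler_normB _ _) _; apply: lerD.
  by rewrite /dser -mulrBr normrM normr_nat ler_wpM2l// He.
rewrite -sumrB; apply: le_trans (ler_norm_sum _ _ _) _.
rewrite -mulrA mulr_suml mulr_sumr; apply: ler_sum => i _.
have [h1 h2] := Hi i; have [C0 _] := HC i.
have -> : logd p i * p (k - i)%N - logd p' i * p' (k - i)%N =
  (logd p i - logd p' i) * p' (k - i)%N + logd p i * (p (k - i)%N - p' (k - i)%N).
  by ring.
have ki : (k - i <= k.+1)%N by rewrite (leq_trans (leq_subr _ _)).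
apply: le_trans (ler_normD _ _) _; rewrite !normrM.
apply: (@le_trans _ _ (C i * eps * B ^+ i.+1 * B ^+ (k - i) +
   C i * B ^+ i.+1 * (eps * B ^+ (k - i)))).
  by apply: lerD; apply: ler_pM => //; auto.
by rewrite le_eqVlt (kE i); apply/orP; left; apply/eqP; ring.
Qed.

(** The recursion is solved for its left side: each coefficient of M is a combination of earlier
    ones with the coefficients of M'/M as weights. *)
Lemma cumulants_bound_moments k (b : R) : 0 <= b ->
  exists2 c : R, 0 <= c & forall p, p 0 = 1 ->
  (forall j, (j < k)%N -> `|logd p j| <= b) ->
  `|p k| <= c.
Proof.
move=> b0; elim/ltn_ind: k => -[|k] IH.
  by exists 1 => // p -> _; rewrite normr1.
have /choice[C HC] : forall i : 'I_k.+1, exists c : R, 0 <= c /\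
  forall p, p 0 = 1 -> (forall j, (j < i)%N -> `|logd p j| <= b) -> `|p i| <= c.
  by move=> i; have [c c0 H] := IH i (ltn_ord i); exists c.
exists (\sum_(i < k.+1) b * C i).
  by apply: sumr_ge0 => i _; rewrite mulr_ge0//; have [] := HC i.
move=> p p0 Hp.
have : `|dser p k| <= \sum_(i < k.+1) b * C i.
  rewrite dser_logd// convC; apply: le_trans (ler_norm_sum _ _ _) _.
  apply: ler_sum => i _; rewrite normrM mulrC; apply: ler_pM => //.
    by apply: Hp; rewrite ltnS leq_subr.
  have [_ H] := HC i; apply: H => // j ji; apply: Hp.
  by rewrite (ltn_trans ji).
apply: le_trans; rewrite /dser normrM normr_nat ler_peMl// ler1n//.
Qed.

Lemma cvg_logd T (F : set_system T) {FF : Filter F} (p : T -> nat -> R) q k :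
  (forall j, (j <= k.+1)%N -> p ^~ j @ F --> q j) ->
  (fun x => logd (p x) k) @ F --> logd q k.
Proof.
elim/ltn_ind: k => k IH H.
under eq_cvg do rewrite logd_rec; rewrite logd_rec.
apply: cvgB; first by apply: cvgMr; exact: H.
apply: cvg_sumr => i _; apply: cvgM.
  by apply: IH => // j ji; apply: H; apply: leq_trans ji _; rewrite ltnS ltnW.
by apply: H; rewrite (leq_trans (leq_subr _ _)).
Qed.

Lemma cvg_of_logd T (F : set_system T) {FF : Filter F} (p : T -> nat -> R) q k :
  (forall x, p x 0 = 1) -> q 0 = 1 ->
  (forall j, (j < k)%N -> (fun x => logd (p x) j) @ F --> logd q j) ->
  p ^~ k @ F --> q k.
Proof.
move=> p0 q0; elim/ltn_ind: k => -[|k] IH H.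
  by under eq_cvg do rewrite p0; rewrite q0; apply: cvg_cst.
have pE r : r 0 = 1 -> r k.+1 = k.+1%:R^-1 * conv (logd r) r k.
  by move=> r0; rewrite -dser_logd// mulKf// pnatr_eq0.
under eq_cvg do rewrite pE//; rewrite pE//.
apply: cvgMr; apply: cvg_sumr => i _.
apply: cvgM; first exact: H.
apply: IH; first by rewrite ltnS leq_subr.
by move=> j ji; apply: H; apply: leq_trans ji _; rewrite (leq_trans (leq_subr _ _)).
Qed.

End cumulants.

(** * Marcinkiewicz's theorem for moment sequences *)

Section antidiagonals.
Variable R : realType.

Lemma sum_antidiag (g : nat -> nat -> R) K :
  \sum_(n < K) \sum_(i < n.+1) g i (n - i)%N =
  \sum_(i < K) \sum_(j < K - i) g i j.
Proof.
elim: K => [|K IH]; first by rewrite !big_ord0.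
rewrite big_ord_recr/= IH [RHS]big_ord_recr/= subSnn big_ord1.
rewrite [X in _ + X]big_ord_recr/= subnn addrA; congr (_ + _).
rewrite -big_split/=; apply: eq_bigr => i _.
by rewrite subSn 1?ltnW// big_ord_recr.
Qed.

Lemma sum_zero_tail (f : nat -> R) m n : (m <= n)%N ->
  (forall i, (m <= i < n)%N -> f i = 0) -> \sum_(i < n) f i = \sum_(i < m) f i.
Proof.
move=> mn f0; rewrite -!(big_mkord xpredT f) (big_cat_nat (n := m))//=.
rewrite [X in _ + X]big_nat_cond [X in _ + X]big1 ?addr0// => i.
by rewrite andbT => /f0.
Qed.

(** A Hankel form is summed over a square, a product of power series along antidiagonals i + j = n.
    The two sums share all antidiagonals with n < N, and the square meets none with n >= N + N. *)
Lemma square_antidiag_bound (w : nat -> nat -> R) (W : nat -> R) N :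
  (forall n, \sum_(i < n.+1) `|w i (n - i)%N| <= W n) ->
  `|\sum_(i < N) \sum_(j < N) w i j - \sum_(n < N) \sum_(i < n.+1) w i (n - i)%N|
  <= \sum_(N <= n < N + N) W n.
Proof.
move=> HW; pose v i j := if (i < N)%N && (j < N)%N then w i j else 0.
have -> : \sum_(i < N) \sum_(j < N) w i j =
    \sum_(n < N + N) \sum_(i < n.+1) v i (n - i)%N.
  rewrite sum_antidiag (@sum_zero_tail (fun i => \sum_(j < N + N - i) v i j) N).
  - apply: eq_bigr => i _; rewrite (@sum_zero_tail _ N).
    + by apply: eq_bigr => j _; rewrite /v !ltn_ord.
    + by rewrite -addnBA ?leq_addr// ltnW.
    + by move=> j /andP[Nj _]; rewrite /v andbC ltnNge Nj.
  - exact: leq_addr.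
  - move=> i /andP[Ni _]; rewrite big1// => j _.
    by rewrite /v ltnNge Ni.
have -> : \sum_(n < N) \sum_(i < n.+1) w i (n - i)%N =
    \sum_(n < N) \sum_(i < n.+1) v i (n - i)%N.
  apply: eq_bigr => n _; apply: eq_bigr => i _; rewrite /v.
  rewrite (leq_trans (ltn_ord i))//=.
  by rewrite (leq_ltn_trans (leq_subr _ _)).
rewrite -(big_mkord xpredT (fun n => \sum_(i < n.+1) v i (n - i)%N)).
rewrite -(big_mkord xpredT (fun n => \sum_(i < n.+1) v i (n - i)%N)).
rewrite (big_cat_nat (n := N))//= ?leq_addr// addrAC subrr add0r.
apply: le_trans (ler_norm_sum _ _ _) _; apply: ler_sum => n _.
apply: le_trans (HW n); apply: le_trans (ler_norm_sum _ _ _) _.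
apply: ler_sum => i _; rewrite /v; case: ifP => // _; by rewrite normr0.
Qed.

(* [cos t = (e^(it) + e^(-it)) / 2] to the power n, multiplied by e^(iphi). *)
Lemma sum_bin_cos n (t phi : R) :
  \sum_(i < n.+1) 'C(n, i)%:R * cos (n%:R * t - (i%:R * t) *+ 2 + phi) =
  (2 * cos t) ^+ n * cos phi.
Proof.
elim: n phi => [|n IH] phi.
  by rewrite big_ord1 expr0 mulr0n !mul0r mul0rn subrr add0r.
rewrite exprS -mulrA mulrCA.
have -> : 2 * cos t * cos phi = cos (phi + t) + cos (phi - t).
  by rewrite cosD cosB; ring.
rewrite mulrDr -!IH big_ord_recl/= bin0.
under eq_bigr do rewrite /bump/= add1n binS natrD mulrDl.
rewrite big_split/= addrA; congr (_ + _).
  rewrite [RHS]big_ord_recl /= bin0 big_ord_recr/= bin_small//.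
  rewrite (mul0r (cos _)) addr0.
  congr (_ + _); first by congr (_ * cos _); ring.
  apply: eq_bigr => i _; rewrite /bump/= add1n; congr (_ * cos _); ring.
apply: eq_bigr => i _; congr (_ * cos _); ring.
Qed.

End antidiagonals.

(** * Power series with infinite radius of convergence *)

Section entire_series.
Variable R : realType.
Implicit Types (a b p : nat -> R) (r x t phi : R).

Definition entire a := forall r, 0 < r -> exists C, forall k, `|a k| * r ^+ k <= C.

Lemma entire_le a b : (forall k, `|b k| <= `|a k|) -> entire a -> entire b.
Proof.
move=> ab Ha r r0; have [C HC] := Ha r r0; exists C => k.
by apply: le_trans (HC k); rewrite ler_wpM2r// exprn_ge0// ltW.
Qed.

Lemma entire_norm_cvg a x : entire a -> cvgn (series (fun k => `|a k| * `|x| ^+ k)).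
Proof.
move=> Ha; pose r := 2 * (`|x| + 1).
have x1 : 0 < `|x| + 1 by rewrite ltr_pwDr.
have r0 : 0 < r by rewrite mulr_gt0.
have [C HC] := Ha r r0.
apply: (@series_le_cvg _ _ (geometric C 2^-1)).
- by move=> n; rewrite mulr_ge0.
- move=> n /=; apply: mulr_ge0; last by rewrite exprn_ge0.
  by apply: le_trans (HC 0%N); rewrite mulr_ge0// exprn_ge0 ?ltW.
- move=> n /=; have rn : 0 < r ^+ n by rewrite exprn_gt0.
  have -> : `|a n| * `|x| ^+ n = `|a n| * r ^+ n * (`|x| / r) ^+ n.
    by rewrite expr_div_n mulrACA divff ?mulr1// gt_eqF.
  apply: ler_pM => //.
  + by rewrite mulr_ge0 // exprn_ge0// ltW.
  + by rewrite exprn_ge0// divr_ge0// ltW.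
  + rewrite lerXn2r ?nnegrE ?divr_ge0// ?(ltW r0)//.
    by rewrite ler_pdivrMr// /r mulrA mulVf// mul1r lerDl.
- by apply: is_cvg_geometric_series; rewrite ger0_norm// invf_lt1// ltr1n.
Qed.

Lemma entire_cvg a x : entire a -> cvgn (pseries a x).
Proof.
move=> Ha; apply: normed_cvg.
rewrite [X in cvgn X](_ : _ = series (fun k => `|a k| * `|x| ^+ k)).
  exact: entire_norm_cvg.
by apply/funext => n; apply: eq_bigr => k _ /=; rewrite normrM normrX.
Qed.

Lemma entire_diffs a : entire a -> entire (pseries_diffs a).
Proof.
move=> Ha r r0; have r2 : 0 < 2 * r by rewrite mulr_gt0.
have [C HC] := Ha _ r2; exists (C / r) => k.
rewrite ler_pdivlMr// /pseries_diffs normrM normr_nat -!mulrA -exprSr.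
apply: le_trans (HC k.+1); rewrite mulrCA exprMn ler_wpM2l//.
rewrite ler_wpM2r//; first by rewrite exprn_ge0// ltW.
by rewrite -natrX ler_nat ltnW// ltn_expl.
Qed.

Lemma entire_is_derive a x : entire a ->
  is_derive x 1 (fun x => limn (pseries a x)) (limn (pseries (pseries_diffs a) x)).
Proof.
move=> Ha; apply: (@pseries_snd_diffs _ _ (`|x| + 1)).
- exact: entire_cvg.
- by apply: entire_cvg; exact: entire_diffs.
- by apply: entire_cvg; do 2 apply: entire_diffs.
- by rewrite [ltRHS]ger0_norm ?ltrDl// addr_ge0.
Qed.

Lemma pseries_shift_cvg a j x : entire a ->
  pseries (fun k => if (j <= k)%N then a (k - j)%N else 0) x @ \oo -->
  x ^+ j * limn (pseries a x).
Proof.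
move=> Ha; rewrite -(cvg_shiftn j).
rewrite [X in X @ _ --> _](_ : _ = (fun n => x ^+ j * pseries a x n)).
  by apply: cvgMr; exact: entire_cvg.
apply/funext => n; rewrite /pseries /series/= addnC (big_cat_nat (n := j)) ?leq_addr//=.
rewrite big_nat_cond big1 ?add0r; last first.
  by move=> i; rewrite andbT => /andP[_ ij]; rewrite leqNgt ij/= mul0r.
rewrite -[X in \sum_(X <= _ < _) _](add0n j) big_addn addKn mulr_sumr.
apply: eq_bigr => i _; rewrite leq_addl addnK exprD; ring.
Qed.

End entire_series.

(** * Moment series whose logarithm is a polynomial *)

Section marcinkiewicz.
Variable R : realType.
Variables (p : nat -> R) (D : nat).
Hypothesis p0 : p 0 = 1.
Hypothesis logd_tail : forall j, (D <= j)%N -> logd p j = 0.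

(** The recursion for p has at most D nonzero terms. Once k + 1 exceeds the sum S of all
    [|logd p j| * r ^+ j.+1], it expresses the next coefficient, weighted by its power of r, through
    earlier ones with total weight at most 1, so any bound C on the first terms persists. *)
Lemma entire_of_logd : entire p.
Proof.
move=> r r0; pose g j := `|logd p j| * r ^+ j.+1.
have g0 j : 0 <= g j by rewrite mulr_ge0// exprn_ge0// ltW.
pose S := \sum_(j < D) g j.
pose k0 := maxn D (Num.truncn S).+1.
pose C := \sum_(i < k0.+1) `|p i| * r ^+ i.
exists C => k.
have t0 i : 0 <= `|p i| * r ^+ i by rewrite mulr_ge0// exprn_ge0// ltW.
have C0 : 0 <= C by apply: sumr_ge0.
elim/ltn_ind: k => k IH; have [kk0|k0k] := leqP k k0.
  rewrite /C (bigD1 (Ordinal (kk0 : (k < k0.+1)%N)))//= lerDl.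
  exact: sumr_ge0.
case: k k0k IH => // k; rewrite ltnS => k0k IH.
have kS : S <= k.+1%:R.
  apply: ltW; apply: lt_le_trans (truncnS_gt S) _; rewrite ler_nat.
  by apply: leq_trans (leqW k0k); rewrite leq_maxr.
have k10 : 0 < k.+1%:R :> R by rewrite ltr0n.
rewrite -(ler_pM2l k10) mulrA.
rewrite -[X in X * `|_|]normr_nat -normrM -/(dser p k) dser_logd//.
apply: (@le_trans _ _ (\sum_(j < k.+1) g j * C)).
  rewrite /conv; apply: (@le_trans _ _ ((\sum_(j < k.+1) `|logd p j * p (k - j)%N|) * r ^+ k.+1)).
    by rewrite ler_wpM2r ?ler_norm_sum// exprn_ge0// ltW.
  rewrite mulr_suml; apply: ler_sum => j _.
  have -> : r ^+ k.+1 = r ^+ j.+1 * r ^+ (k - j).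
    by rewrite -exprD addSn subnKC// -ltnS.
  rewrite normrM mulrACA ler_wpM2l//.
    exact: g0.
  by apply: IH; rewrite ltnS leq_subr.
rewrite -mulr_suml ler_wpM2r//; apply: le_trans kS.
rewrite (@sum_zero_tail _ g D)//.
  by apply: leq_trans (leqW k0k); rewrite leq_maxl.
by move=> i /andP[Di _]; rewrite /g logd_tail// normr0 mul0r.
Qed.

(** The real part of e^(i phi) M(x e^(it)), where M is the power series with coefficients p. Adding
    pi / 2 to the phase gives access to the imaginary part. *)
Let wave (t phi x : R) : R := limn (pseries (fun k => p k * cos (k%:R * t + phi)) x).

Let entire_wave t phi : entire (fun k => p k * cos (k%:R * t + phi)).
Proof.
apply: entire_le entire_of_logd => k; rewrite normrM ler_piMr//.
exact: cos_max.
Qed.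

Let waveD t phi psi x : wave t (phi + psi) x =
  cos psi * wave t phi x + sin psi * wave t (phi + pi / 2) x.
Proof.
apply/cvg_lim => //.
rewrite [X in X @ _ --> _](_ : _ = fun n =>
  cos psi * pseries (fun k => p k * cos (k%:R * t + phi)) x n +
  sin psi * pseries (fun k => p k * cos (k%:R * t + (phi + pi / 2))) x n).
  by apply: cvgD; apply: cvgMr; apply: entire_cvg; exact: entire_wave.
apply/funext => n; rewrite !mulr_sumr -big_split/=; apply: eq_bigr => k _.
rewrite /= !addrA cosDpihalf (cosD (_ + _)); ring.
Qed.

(** The equation M' = P' M along a ray, with P = log M: the factor z^j of P' and the derivative
    e^(it) of z = x e^(it) together shift the phase by (j + 1) t. *)
Let is_derive_wave t phi (x : R) : is_derive x 1 (wave t phi)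
  (\sum_(j < D) logd p j * x ^+ j * wave t (phi + j.+1%:R * t) x).
Proof.
have := entire_is_derive x (entire_wave t phi).
set l := limn _; suff -> : l = \sum_(j < D) logd p j * x ^+ j * wave t (phi + j.+1%:R * t) x by [].
apply/cvg_lim => //.
pose a j := fun k => p k * cos (k%:R * t + (phi + j.+1%:R * t)).
pose s j := fun k => if (j <= k)%N then a j (k - j)%N else 0.
rewrite [X in X @ _ --> _](_ : _ = fun n =>
    \sum_(j < D) logd p j * pseries (s j) x n).
  apply: cvg_sumr => j _; rewrite -mulrA; apply: cvgMr.
  by apply: pseries_shift_cvg; exact: entire_wave.
apply/funext => n; under [RHS]eq_bigr do rewrite mulr_sumr.
rewrite exchange_big/=; apply: eq_bigr => k _.
under [RHS]eq_bigr do rewrite mulrA.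
rewrite -mulr_suml; congr (_ * _).
rewrite /pseries_diffs mulrA -/(dser p k) dser_logd// mulr_suml.
transitivity (\sum_(j < k.+1) logd p j * s j k).
  apply: eq_bigr => j _; have jk : (j <= k)%N by rewrite -ltnS.
  rewrite /s jk /a -mulrA; congr (_ * (_ * cos _)).
  rewrite natrB// !mulrSr; ring.
transitivity (\sum_(j < k.+1 + D) logd p j * s j k).
  apply/esym/(@sum_zero_tail _ (fun j => logd p j * s j k)); first exact: leq_addr.
  by move=> j /andP[kj _]; rewrite /s leqNgt kj mulr0.
apply: (@sum_zero_tail _ (fun j => logd p j * s j k)); first exact: leq_addl.
by move=> j /andP[Dj _]; rewrite logd_tail// mul0r.
Qed.

(** [prim cos] and [prim sin] are the real and imaginary parts of P(x e^(it)), where P = log M, and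
    [slope] is their derivative in x. *)
Let slope (f : R -> R) (t x : R) : R := \sum_(j < D) logd p j * x ^+ j * f (j.+1%:R * t).
Let prim (f : R -> R) (t x : R) : R :=
  \sum_(j < D) logd p j / j.+1%:R * f (j.+1%:R * t) * x ^+ j.+1.

Let is_derive_prim f t (x : R) : is_derive x 1 (prim f t) (slope f t x).
Proof.
have -> : prim f t = \sum_(j < D) (logd p j / j.+1%:R * f (j.+1%:R * t)) *: (id : R -> R) ^+ j.+1.
  apply/funext => y; rewrite /prim fct_sumE; apply: eq_bigr => j _.
  by rewrite /= exprfctE.
apply: is_derive_eq; apply: eq_bigr => j _.
rewrite /= /GRing.scale/= mulr1; field.
by rewrite nat1r pnatr_eq0.
Qed.

(** The left side is the real part of e^(-P) M at x e^(it); its derivative in x vanishes because M'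
    = P' M. *)
Let wave_const (t x : R) :
  expR (- prim cos t x) * (cos (prim sin t x) * wave t 0 x -
    sin (prim sin t x) * wave t (pi / 2) x) = 1.
Proof.
set G := (X in X = 1).
pose g : R -> R := (expR \o (- prim cos t)) *
    ((cos \o prim sin t) * wave t 0 - (sin \o prim sin t) * wave t (pi / 2)).
have g' (y : R) : is_derive y 1 g 0.
  have d0 : is_derive y 1 (wave t 0)
      (slope cos t y * wave t 0 y + slope sin t y * wave t (pi / 2) y).
    apply: (is_derive_eq (is_derive_wave t 0 y)).
    rewrite /slope !mulr_suml -big_split/=.
    by apply: eq_bigr => j _; rewrite waveD add0r mulrDr !mulrA.
  have d1 : is_derive y 1 (wave t (pi / 2))
      (slope cos t y * wave t (pi / 2) y - slope sin t y * wave t 0 y).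
    apply: (is_derive_eq (is_derive_wave t (pi / 2) y)).
    rewrite /slope !mulr_suml -sumrB.
    apply: eq_bigr => j _; rewrite waveD mulrDr !mulrA; congr (_ + _).
    rewrite -splitr -[pi]add0r waveD cospi sinpi; ring.
  have dA := is_derive_prim cos t y.
  have dB := is_derive_prim sin t y.
  apply: is_derive_eq; rewrite /= /GRing.scale/= !fctE /=; ring.
have -> : G = g x by [].
rewrite (is_derive_0_is_cst x 0 g') /g /=.
have prim0 f : prim f t 0 = 0.
  by rewrite /prim big1// => j _; rewrite expr0n mulr0.
have S0 : forall phi, wave t phi 0 = cos phi.
  move=> phi; apply/cvg_lim => //; rewrite -cvg_shiftS.
  apply: cvg_near_cst; apply: nearW => n.
  rewrite /pseries /series /= big_nat_recl// big1 ?addr0.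
    by rewrite p0 mul0r add0r mul1r expr0 mulr1.
  by move=> i _; rewrite exprS mul0r mulr0.
by rewrite !fctE !prim0 oppr0 expR0 cos0 sin0 mul0r subr0 !mul1r S0 cos0.
Qed.

(** The phase pi - Im P rotates M = e^P onto the negative half-line, so the real part of the rotated
    value is - |M|. *)
Lemma pseries_cos_lim (t x : R) :
  pseries (fun k => p k * cos (k%:R * t + (pi - prim sin t x))) x @ \oo -->
  - expR (prim cos t x).
Proof.
have cv := @entire_cvg _ _ x (entire_wave t (pi - prim sin t x)).
suff <- : limn (pseries (fun k => p k * cos (k%:R * t + (pi - prim sin t x))) x)
  = - expR (prim cos t x) by [].
rewrite -/(wave _ _ _) -[pi - _]add0r waveD cosB sinB cospi sinpi add0r.
have := wave_const t x; rewrite expRN mulrC => /divr1_eq <-; ring.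
Qed.

Lemma pseries_lim (x : R) :
  pseries p x @ \oo --> expR (\sum_(j < D) logd p j / j.+1%:R * x ^+ j.+1).
Proof.
rewrite -[X in _ --> X]opprK -[pseries p x]opprK; apply: cvgN.
have := @pseries_cos_lim 0 x.
have -> : prim sin 0 x = 0.
  by rewrite /prim big1// => j _; rewrite mulr0 sin0 mulr0 mul0r.
have -> : prim cos 0 x = \sum_(j < D) logd p j / j.+1%:R * x ^+ j.+1.
  by apply: eq_bigr => j _; rewrite mulr0 cos0 mulr1.
apply: cvg_trans; apply: near_eq_cvg; apply: nearW => n.
rewrite fctE -sumrN; apply: eq_bigr => k _.
by rewrite /= mulr0 add0r subr0 cospi mulrN1 mulNr.
Qed.

(** For the moments of Y, this form is the mean of the square of the polynomial in Y with
    coefficients a. *)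
Hypothesis hankel_ge0 : forall N (a : nat -> R),
  0 <= \sum_(i < N) \sum_(j < N) a i * a j * ((i + j)`!%:R * p (i + j)%N).

(* For a moment sequence this is |E e^(zY)| <= E e^(Re(z) Y) at z = r e^(it). *)
Lemma re_log_le (t r : R) :
  \sum_(j < D) logd p j / j.+1%:R * cos (j.+1%:R * t) * r ^+ j.+1 <=
  \sum_(j < D) logd p j / j.+1%:R * cos t ^+ j.+1 * r ^+ j.+1.
Proof.
pose phi := pi - prim sin t r.
(* Taylor coefficients in y of Re w, for w = e^(i phi / 2) e^(zy / 2) and z = r e^(it). Since 2 (Re
   w)^2 = Re (w^2) + |w|^2, the Hankel forms tend to half the sum of Re (e^(i phi) M(z)) = - |M(z)|
   and M(Re z). *)
pose a j := r ^+ j * cos (phi / 2 + j%:R * t) / (2 ^+ j * j`!%:R).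
pose w i j := a i * a j * ((i + j)`!%:R * p (i + j)%N).
have wE n i : (i <= n)%N -> w i (n - i)%N = p n * r ^+ n / 2 ^+ n *
   ('C(n, i)%:R * (cos (phi / 2 + i%:R * t) * cos (phi / 2 + (n - i)%:R * t))).
  move=> ni; rewrite /w /a subnKC//.
  have -> : n`!%:R = 'C(n, i)%:R * i`!%:R * (n - i)`!%:R :> R.
    by rewrite -!natrM -mulnA bin_fact.
  have -> : r ^+ n = r ^+ i * r ^+ (n - i) by rewrite -exprD subnKC.
  have -> : 2 ^+ n = 2 ^+ i * 2 ^+ (n - i) :> R by rewrite -exprD subnKC.
  have f0 k : k`!%:R != 0 :> R by rewrite pnatr_eq0 -lt0n fact_gt0.
  move: (f0 i) (f0 (n - i)%N); move: (i`!%:R : R) ((n - i)`!%:R : R) => x y x0 y0.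
  field.
  by rewrite x0 y0 !expf_eq0 pnatr_eq0 !andbF.
pose T N := \sum_(n < N) \sum_(i < n.+1) w i (n - i)%N.
have TE N : T N = 2^-1 * (pseries (fun k => p k * cos (k%:R * t + phi)) r N +
    pseries p (r * cos t) N).
  rewrite /pseries /series/= !big_mkord -big_split/= mulr_sumr.
  apply: eq_bigr => n _.
  transitivity (\sum_(i < n.+1) p n * r ^+ n / 2 ^+ n * (2^-1 *
     ('C(n, i)%:R * cos (n%:R * t + phi) +
      'C(n, i)%:R * cos (n%:R * t - (i%:R * t) *+ 2 + 0)))).
    apply: eq_bigr => i _; have ni : (i <= n)%N by rewrite -ltnS.
    rewrite wE//; congr (_ * _); rewrite -mulrDr [RHS]mulrCA; congr (_ * _).
    have -> : n%:R * t + phi = (phi / 2 + (n - i)%:R * t) + (phi / 2 + i%:R * t).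
      by rewrite natrB//; field.
    have -> : n%:R * t - i%:R * t *+ 2 + 0 =
      (phi / 2 + (n - i)%:R * t) - (phi / 2 + i%:R * t).
      by rewrite natrB//; field.
    by rewrite (cosB (_ + _)) (cosD (_ + _) (_ + _)); field.
  rewrite -!mulr_sumr big_split/= sum_bin_cos cos0 mulr1 -mulr_suml -natr_sum.
  have -> : \sum_(i < n.+1) 'C(n, i) = (2 ^ n)%N.
    rewrite -[2%N]/(1 + 1)%N expnDn; apply: eq_bigr => i _.
    by rewrite !exp1n !muln1.
  rewrite natrX exprMn exprMn; field.
  by rewrite expf_eq0 pnatr_eq0 andbF.
pose W n := `|p n| * `|r| ^+ n.
have Wb n : \sum_(i < n.+1) `|w i (n - i)%N| <= W n.
  apply: (@le_trans _ _ (\sum_(i < n.+1) W n / 2 ^+ n * 'C(n, i)%:R)).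
    apply: ler_sum => i _; have ni : (i <= n)%N by rewrite -ltnS.
    rewrite wE// !normrM normfV !normrX normr_nat ler_wpM2l//.
    by rewrite normr_nat ler_piMr// mulr_ile1// cos_max.
  rewrite -mulr_sumr -natr_sum.
  have -> : \sum_(i < n.+1) 'C(n, i) = (2 ^ n)%N.
    rewrite -[2%N]/(1 + 1)%N expnDn; apply: eq_bigr => i _.
    by rewrite !exp1n !muln1.
  by rewrite natrX divfK// expf_eq0 pnatr_eq0 andbF.
have cW := entire_norm_cvg (x := r) entire_of_logd; rewrite -/W in cW.
have Tcv : T @ \oo --> 2^-1 * (- expR (prim cos t r) +
    expR (\sum_(j < D) logd p j / j.+1%:R * (r * cos t) ^+ j.+1)).
  under eq_cvg do rewrite TE; apply: cvgMr; apply: cvgD.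
    exact: pseries_cos_lim.
  exact: pseries_lim.
(* The distance between square and antidiagonal sums is at most a Cauchy remainder of the convergent
   series of W. *)
have tail : (fun N => series W (N + N)%N - series W N) @ \oo --> (0 : R).
  rewrite -[X in _ --> X](subrr (limn (series W))); apply: cvgB => //.
  apply: cvg_comp cW.
  by move=> A [m _ mA]; exists m => // k /= mk; apply: mA; rewrite /= (leq_trans mk)// leq_addr.
have : 0 <= 2^-1 * (- expR (prim cos t r) +
    expR (\sum_(j < D) logd p j / j.+1%:R * (r * cos t) ^+ j.+1)) + 0.
  rewrite -(cvg_lim _ (cvgD Tcv tail))//; apply: limr_ge.
    by apply: cvgP; exact: cvgD Tcv tail.
  apply: nearW => N; rewrite fctE.
  have h1 := square_antidiag_bound N Wb.
  have h0 : 0 <= \sum_(i < N) \sum_(j < N) w i j := hankel_ge0 N a.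
  have -> : series W (N + N) = series W N + \sum_(N <= n < N + N) W n.
    by rewrite /series/= (big_cat_nat (n := N))//= leq_addr.
  move: h1; rewrite ler_norml -/(T N) => /andP[_]; lra.
rewrite addr0 pmulr_rge0 ?invr_gt0// addrC subr_ge0 ler_expR => h.
apply: le_trans h _; rewrite le_eqVlt; apply/orP; left.
by apply/eqP; apply: eq_bigr => j _; rewrite exprMn mulrA mulrAC.
Qed.

End marcinkiewicz.

Lemma lead_coef_ge0 (R : realType) (q : nat -> R) n :
  (forall r, 0 < r -> 0 <= \sum_(j < n.+1) q j * r ^+ j.+1) -> 0 <= q n.
Proof.
move=> H; rewrite leNgt; apply/negP => qn.
pose S := \sum_(j < n) `|q j|; have S0 : 0 <= S by apply: sumr_ge0.
(* Solves S + q n * r = q n < 0, so the top term outweighs all the others. *)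
pose r := 1 + S / - q n.
have r1 : 1 <= r by rewrite lerDl divr_ge0// oppr_ge0 ltW.
have r0 : 0 < r by rewrite (lt_le_trans _ r1).
have := H r r0; rewrite big_ord_recr/= leNgt => /negP; apply.
have : \sum_(j < n) q j * r ^+ j.+1 <= S * r ^+ n.
  rewrite mulr_suml; apply: ler_sum => j _.
  apply: le_trans (ler_norm _) _; rewrite normrM ler_wpM2l//.
  by rewrite ger0_norm ?exprn_ge0 ?(ltW r0)// ler_weXn2l.
move=> h; apply: (@le_lt_trans _ _ (S * r ^+ n + q n * r ^+ n.+1)).
  by rewrite lerD2r.
have -> : S * r ^+ n + q n * r ^+ n.+1 = r ^+ n * q n.
  rewrite exprS [in X in _ + X]/r; field.
  by rewrite lt_eqF.
by rewrite pmulr_rlt0// exprn_gt0.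
Qed.

(* If the top degree D of log M is at least 3, the rays of angles 2pi/D and
   pi/D force its leading coefficient to be both nonpositive and nonnegative. *)
Theorem marcinkiewicz (R : realType) (p : nat -> R) (D : nat) :
  p 0 = 1 -> (forall j, (D <= j)%N -> logd p j = 0) ->
  (forall N (a : nat -> R),
    0 <= \sum_(i < N) \sum_(j < N) a i * a j * ((i + j)`!%:R * p (i + j)%N)) ->
  forall j, (2 <= j)%N -> logd p j = 0.
Proof.
move=> p0 pD pos j j2; apply/eqP/negPn/negP => pj.
have ex : exists i, (2 <= i)%N && (logd p i != 0) by exists j; rewrite j2.
have ub i : (2 <= i)%N && (logd p i != 0) -> (i <= D)%N.
  move=> /andP[_]; apply: contraR; rewrite -ltnNge => /ltnW Di.
  by rewrite pD.
(* Index n of [logd] is degree n + 1 of log M, so the top degree is at least 3. *)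
case: (ex_maxnP ex ub) => n /andP[n2 pn] nmax.
have tl i : (n.+1 <= i)%N -> logd p i = 0.
  move=> ni; apply/eqP/negPn/negP => pi0.
  have /nmax : (2 <= i)%N && (logd p i != 0) by rewrite pi0 (leq_trans n2)// ltnW.
  by rewrite leqNgt ni.
have key t : 0 <= logd p n / n.+1%:R * (cos t ^+ n.+1 - cos (n.+1%:R * t)).
  apply: (@lead_coef_ge0 _ (fun j => logd p j / j.+1%:R * (cos t ^+ j.+1 - cos (j.+1%:R * t)))).
  move=> r _; have := re_log_le p0 tl pos t r; rewrite -subr_ge0 -sumrB.
  by congr (0 <= _); apply: eq_bigr => i _; ring.
have n0 : n.+1%:R != 0 :> R by rewrite pnatr_eq0.
have n3 : 3 <= n.+1%:R :> R by rewrite (ler_nat R 3).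
(* Degree at least 3 puts both angles strictly between 0 and pi, where |cos| < 1; in degree 2 the
   angle 2 pi / 2 would give |cos| = 1 and no contradiction. *)
have ang (s : R) : 0 < s -> s <= 2 * pi -> `|cos (s / n.+1%:R)| ^+ n.+1 < 1.
  move=> s0 s2; set t := s / _.
  have ts : 0 < t < pi.
    have pi0 := @pi_gt0 R; rewrite divr_gt0//=.
    rewrite ltr_pdivrMr ?ltr0n//; apply: le_lt_trans s2 _.
    by rewrite mulrC ltr_pM2l ?pi_gt0// (ltr_nat R 2).
  have sin0 := sin_gt0_pi ts; apply: exprn_ilt1 => //.
  by rewrite lt_neqAle cos_max andbT norm_cos_eq1 gt_eqF//.
have pi0 := @pi_gt0 R.
have {}key s : 0 <= logd p n / n.+1%:R * (cos (s / n.+1%:R) ^+ n.+1 - cos s).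
  by have := key (s / n.+1%:R); rewrite [n.+1%:R * _]mulrC divfK.
have e1 := key (pi *+ 2); have e2 := key pi.
have a1 := ang (pi *+ 2); have a2 := ang pi.
move: e1 e2 a1 a2; rewrite cos2pi cospi.
set c1 := cos (pi *+ 2 / _); set c2 := cos (pi / _); set L := logd p n / _.
move=> e1 e2 a1 a2.
have {a1} : c1 ^+ n.+1 - 1 < 0.
  rewrite subr_lt0; apply: le_lt_trans (ler_norm _) _; rewrite normrX a1//.
    by rewrite mulr2n addr_gt0.
  by rewrite mulr_natl.
have {a2} : 0 < c2 ^+ n.+1 - -1.
  have := a2 pi0; rewrite -normrX ltr_norml => /(_ _)/andP[|h _]; last lra.
  lra.
move=> h2 h1; have L0 : L = 0.
  apply/eqP; rewrite eq_le -(pmulr_lge0 _ h2) e2 andbT.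
  by rewrite -(nmulr_lge0 _ h1).
move: pn; rewrite -(mulfVK n0 (logd p n)) -/L L0 mul0r eqxx.
by [].
Qed.

(** * The method of moments *)

Section gaussian.
Variable R : realType.
Local Notation mu := (@lebesgue_measure R).
Local Notation g := (@normal_pdf R 0 1).

Lemma pow_le_expR (y : R) k : 0 <= y -> y ^+ k <= k`!%:R * expR y.
Proof.
move=> y0; case: k => [|k].
  by rewrite expr0 fact0 mul1r -[leLHS]addr0 (le_trans _ (expR_ge1Dx y))// lerD2l.
have := expR_ge1Dxn k y0 => h.
have f0 : 0 < k.+1`!%:R :> R by rewrite ltr0n fact_gt0.
by rewrite mulrC -ler_pdivrMr//; apply: le_trans h; rewrite lerDr.
Qed.

Lemma normal_pdf01E x : g x = normal_peak 1 * expR (- (x ^+ 2 / 2)).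
Proof.
rewrite normal_pdfE ?oner_eq0// /normal_fun subr0 expr1n; congr (_ * expR _).
by rewrite mulNr.
Qed.

(** Domination by a wider Gaussian density, whose integrability is known, handles all powers at
    once. *)
Lemma pow_normal_pdf_le k : exists2 C, 0 <= C &
  forall x, `|x| ^+ k * g x <= C * normal_pdf 0 2 x.
Proof.
have p1 : 0 < normal_peak (1 : R) by rewrite normal_peak_gt0// oner_eq0.
have p2 : 0 < normal_peak (2 : R) by rewrite normal_peak_gt0.
pose C := 1 + (8 / 3) ^+ k * k`!%:R : R.
have C0 : 0 <= C by rewrite addr_ge0// mulr_ge0// exprn_ge0.
exists (C * normal_peak 1 / normal_peak 2).
  by rewrite divr_ge0 ?mulr_ge0 ?(ltW p1) ?(ltW p2).
move=> x; rewrite normal_pdf01E normal_pdfE// /normal_fun subr0.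
(* 3/8 is 1/2 - 1/8, the gap between the exponents of the two densities. *)
pose y := 3 / 8 * x ^+ 2.
have y0 : 0 <= y by rewrite mulr_ge0// sqr_ge0.
have key : `|x| ^+ k <= C * expR y.
  rewrite mulrDl; have [x1|x1] := leP `|x| 1.
    rewrite -[leLHS]addr0; apply: lerD.
      rewrite mul1r; apply: (@le_trans _ _ 1); first by rewrite exprn_ile1.
      by rewrite -expR0 ler_expR.
    by rewrite !mulr_ge0// ?expR_ge0 ?exprn_ge0.
  rewrite -[leLHS]add0r; apply: lerD; first by rewrite mul1r expR_ge0.
  apply: (@le_trans _ _ ((8 / 3) ^+ k * y ^+ k)); last first.
    by rewrite -mulrA ler_wpM2l ?exprn_ge0//; exact: pow_le_expR.
  rewrite -exprMn /y mulrA (_ : 8 / 3 * (3 / 8) = 1 :> R); last by field.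
  rewrite mul1r -(real_normK (num_real x)) lerXn2r ?nnegrE ?sqr_ge0//.
  by rewrite expr2 ler_peMl// ltW.
rewrite [leRHS]mulrA divfK ?gt_eqF// mulrCA [leRHS]mulrAC [leRHS]mulrC ler_pM2l//.
have -> : - x ^+ 2 / (2 ^+ 2 *+ 2) = y + - (x ^+ 2 / 2).
  by rewrite /y mulr2n; field.
by rewrite expRD mulrA ler_pM2r// expR_gt0.
Qed.

Lemma measurable_normal_pdf01 : measurable_fun setT g.
Proof. exact: measurable_normal_pdf. Qed.

Definition gauss_integrable (f : R -> R) :=
  mu.-integrable setT (EFin \o (fun x => f x * g x)).

Definition gauss_mean (f : R -> R) : R := (\int[mu]_x (f x * g x))%R.

Lemma gauss_integrable_le (f h : R -> R) : measurable_fun setT f ->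
  (forall x, `|f x| <= h x) -> gauss_integrable h -> gauss_integrable f.
Proof.
move=> mf fh; apply: le_integrable => //.
  apply/measurable_EFinP; apply: measurable_funM => //.
  exact: measurable_normal_pdf01.
move=> x _ /=; rewrite lee_fin !normrM [X in _ * X <= _]ger0_norm ?normal_pdf_ge0//.
apply: ler_pM => //; first by rewrite normal_pdf_ge0.
  exact: le_trans (ler_norm _).
by rewrite ler_norm.
Qed.

Lemma gauss_integrableX k : gauss_integrable (fun x => x ^+ k).
Proof.
have [C C0 HC] := pow_normal_pdf_le k.
have IC := integrableZl measurableT C (@integrable_normal_pdf R 0 2).
apply: le_integrable IC => //.
- apply/measurable_EFinP; apply: measurable_funM.
    exact: measurable_funX.
  exact: measurable_normal_pdf01.
- move=> x _ /=; rewrite lee_fin normrM normrX.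
  rewrite [X in _ * X <= _]ger0_norm ?normal_pdf_ge0//.
  by apply: le_trans (HC x) _; rewrite ler_norm.
Qed.

Lemma gauss_integrableZ c f : gauss_integrable f ->
  gauss_integrable (fun x => c * f x).
Proof.
move=> If; rewrite /gauss_integrable.
rewrite (_ : _ \o _ = fun x => (c%:E * (f x * g x)%:E)%E); last first.
  by apply/funext => x /=; rewrite -EFinM mulrA.
exact: integrableZl.
Qed.

Lemma gauss_integrableD f h : gauss_integrable f -> gauss_integrable h ->
  gauss_integrable (fun x => f x + h x).
Proof.
move=> If Ih; rewrite /gauss_integrable.
rewrite (_ : _ \o _ = (EFin \o (fun x => f x * g x)%R) \+ (EFin \o (fun x => h x * g x)%R))%E.
  exact: integrableD.
by apply/funext => x /=; rewrite -EFinD mulrDl.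
Qed.

Lemma gauss_meanZ c f : gauss_integrable f ->
  gauss_mean (fun x => c * f x) = c * gauss_mean f.
Proof.
move=> If; rewrite /gauss_mean -RintegralZl//.
by apply: eq_Rintegral => x _; rewrite mulrA.
Qed.

Lemma gauss_meanD f h : gauss_integrable f -> gauss_integrable h ->
  gauss_mean (fun x => f x + h x) = gauss_mean f + gauss_mean h.
Proof.
move=> If Ih; rewrite /gauss_mean -RintegralD//.
by apply: eq_Rintegral => x _; rewrite mulrDl.
Qed.

Lemma gauss_mean_le f h : gauss_integrable f -> gauss_integrable h ->
  (forall x, f x <= h x) -> gauss_mean f <= gauss_mean h.
Proof.
move=> If Ih fh; apply: le_Rintegral => // x _.
by rewrite ler_wpM2r// normal_pdf_ge0.
Qed.

Lemma gauss_mean1 : gauss_mean (fun=> 1) = 1.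
Proof.
rewrite /gauss_mean /Rintegral; under eq_integral do rewrite mul1r.
by rewrite integral_normal_pdf.
Qed.

Lemma gauss_integrable_cst c : gauss_integrable (fun=> c).
Proof.
rewrite (_ : (fun=> c) = fun x => c * x ^+ 0).
  exact: gauss_integrableZ (gauss_integrableX 0).
by apply/funext => x; rewrite expr0 mulr1.
Qed.

Definition gauss_moment k := gauss_mean (fun x => x ^+ k).

Let G k (x : R) := - (x ^+ k * g x).

Let is_derive_G k (x : R) :
  is_derive x 1 (G k) (x ^+ k.+1 * g x - k%:R * x ^+ k.-1 * g x).
Proof.
have -> : G k = - ((id : R -> R) ^+ k * (normal_peak 1 *: (expR \o (- ((id : R -> R) ^+ 2 * cst (2^-1)))))).
  by apply/funext => y; rewrite /G normal_pdf01E !fctE.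
apply: is_derive_eq; rewrite /= /GRing.scale/= !fctE /GRing.scale/= normal_pdf01E.
by rewrite !(mulr1, mulr0, add0r, expr1) (exprS x k); field.
Qed.

Let G_cvg0 k : (fun n : nat => G k n.+1%:R - G k (- n.+1%:R)) @ \oo --> (0 : R).
Proof.
have [C C0 HC] := pow_normal_pdf_le k.+1.
have bnd (x : R) n : `|x| = n.+1%:R -> `|G k x| <= C * normal_peak 2 / n.+1%:R.
  move=> xn; rewrite /G normrN normrM normrX [X in _ * X]ger0_norm ?normal_pdf_ge0//.
  rewrite ler_pdivlMr ?ltr0n// -xn mulrAC -exprSr.
  by apply: le_trans (HC x) _; rewrite ler_wpM2l// normal_pdf_ub.
apply/norm_cvg0P.
apply: (@squeeze_cvgr _ _ _ _ (fun=> 0) (fun n => 2 * (C * normal_peak 2) * n.+1%:R^-1)).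
- apply: nearW => n; rewrite normr_ge0/=.
  apply: le_trans (ler_normB _ _) _; rewrite -mulrA mulr2n mulrDl mul1r.
  by apply: lerD; apply: bnd; rewrite ?normrN ger0_norm.
- exact: cvg_cst.
- rewrite -[X in _ --> X](mulr0 (2 * (C * normal_peak 2))).
  by apply: cvgMr; exact: cvg_harmonic.
Qed.

(** Integration by parts: x^(k+1) g - k x^(k-1) g is the derivative of - x^k g, integrated over
    [-n-1, n+1] before n tends to infinity. At k = 0 the default predecessor 0 is multiplied by
    0. *)
Lemma gauss_moment_rec k : gauss_moment k.+1 = k%:R * gauss_moment k.-1.
Proof.
pose f (x : R) := x ^+ k.+1 * g x - k%:R * x ^+ k.-1 * g x.
have If : mu.-integrable setT (EFin \o f).
  have h1 := gauss_integrableX k.+1.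
  have h2 := gauss_integrableZ (- k%:R) (gauss_integrableX k.-1).
  have := gauss_integrableD h1 h2; congr (mu.-integrable _ _).
  by apply/funext => x /=; rewrite /f mulrDl !mulNr.
have cf : continuous f.
  move=> x; apply: cvgB; apply: cvgM.
  - exact: exprn_continuous.
  - exact: continuous_normal_pdf.
  - by apply: cvgMr; exact: exprn_continuous.
  - exact: continuous_normal_pdf.
pose I (n : nat) : set R := `[- n.+1%:R, n.+1%:R]%classic.
have int n : (\int[mu]_(x in I n) (f x)%:E)%E =
    (G k n.+1%:R - G k (- n.+1%:R))%:E.
  have dG x : derivable (G k) x 1 by have [] := is_derive_G k x.
  have cG x : {for x, continuous (G k)}.
    by apply/differentiable_continuous/derivable1_diffP.
  rewrite (@continuous_FTC2 _ f (G k))//.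
  - by rewrite (@lt_trans _ _ 0)// oppr_lt0.
  - exact: continuous_subspaceT.
  - split => //; first exact/cvg_at_right_filter/cG.
    exact/cvg_at_left_filter/cG.
  by move=> x _; rewrite derive1E; have [_ ->] := is_derive_G k x.
have cv : (\int[mu]_x (((f \_ (I n)) x)%:E) @[n --> \oo] -->
    \int[mu]_x (f x)%:E)%E.
  apply: (@dominated_cvg _ _ _ mu setT measurableT
    (fun n x => ((f \_ (I n)) x)%:E) (fun x => (f x)%:E)
    (fun x => `|(f x)%:E|%E)) => //.
  - move=> n; apply/measurable_EFinP.
    apply/(measurable_restrictT f (measurable_itv _)).
    by apply: measurable_funTS; exact: continuous_measurable_fun.
  - move=> x _; apply: cvg_near_cst; exists (Num.truncn `|x|) => // n /= xn.
    rewrite patchE mem_set//= /I /= in_itv/= -ler_norml.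
    apply: ltW; apply: lt_le_trans (truncnS_gt _) _.
    by rewrite ler_nat ltnS.
  - by have := integrable_abse If.
  - move=> n x _; rewrite lee_fin patchE; case: ifP => // _.
    by rewrite normr0.
have {}cv : (0%:E = \int[mu]_x (f x)%:E)%E.
  apply: (cvg_unique _ _ cv) => //.
  rewrite [X in X @ _](_ : _ = fun n : nat => (G k n.+1%:R - G k (- n.+1%:R))%:E).
    by apply: cvg_EFin (G_cvg0 k); apply: nearW.
  apply/funext => n; rewrite -int [RHS]integral_mkcond.
  by apply: eq_integral => x _; rewrite !patchE; case: ifP.
have : \int[mu]_x (f x) = 0 by rewrite /Rintegral -cv.
have h1 := gauss_integrableX k.+1.
have h2 := gauss_integrableZ (k%:R) (gauss_integrableX k.-1).
rewrite /f RintegralB// -/(gauss_mean _) -/(gauss_mean _) => /eqP.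
by rewrite subr_eq0 (gauss_meanZ _ (gauss_integrableX _)) => /eqP.
Qed.

(** The moment recursion is the equation M' = z M. *)
Lemma logd_gauss k :
  logd (fun j => gauss_moment j / j`!%:R) k = (k == 1%N)%:R.
Proof.
have m0 : gauss_moment 0 = 1.
  rewrite -[RHS]gauss_mean1; apply: eq_Rintegral => x _.
  by rewrite expr0.
apply: (@logd_unique _ _ (fun k => (k == 1%N)%:R) k.+1) => //.
  by rewrite fact0 divr1.
move=> {k}k _; rewrite /dser gauss_moment_rec factS natrM.
have k0 : k.+1%:R != 0 :> R by rewrite pnatr_eq0.
have f0 : k`!%:R != 0 :> R by rewrite pnatr_eq0 -lt0n fact_gt0.
transitivity (k%:R * gauss_moment k.-1 / k`!%:R).
  by move: k0 f0; move: (k.+1%:R : R) (k`!%:R : R) => x y ? ?; field; apply/andP.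
case: k k0 f0 => [|k] k0 f0.
  by rewrite /conv big_ord1 /= !mul0r.
rewrite /conv !big_ord_recl/= mul0r add0r mul1r subn1/= big1 ?addr0; last first.
  by move=> i _; rewrite mul0r.
rewrite factS natrM invfM mulrACA divff ?mul1r//.
Qed.

End gaussian.

(** * Expectations on finite probability spaces *)

Section finite_expectation.
Variables (R : realType) (S : finType) (pr : S -> R).
Implicit Types f g : S -> R.

Definition fprob := (forall s, 0 <= pr s) /\ \sum_s pr s = 1.

Definition esp f : R := \sum_s pr s * f s.

Lemma espD f g : esp (fun s => f s + g s) = esp f + esp g.
Proof. by rewrite /esp -big_split; apply: eq_bigr => s _; rewrite mulrDr. Qed.

Lemma espZ c f : esp (fun s => c * f s) = c * esp f.
Proof. by rewrite /esp mulr_sumr; apply: eq_bigr => s _; rewrite mulrCA. Qed.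

Lemma espB f g : esp (fun s => f s - g s) = esp f - esp g.
Proof.
rewrite -[- esp g]mulN1r -espZ -espD; congr esp.
by apply/funext => s; rewrite mulN1r.
Qed.

Lemma esp_sum I (r : seq I) (P : pred I) (f : I -> S -> R) :
  esp (fun s => \sum_(i <- r | P i) f i s) = \sum_(i <- r | P i) esp (f i).
Proof. by rewrite /esp exchange_big/=; apply: eq_bigr => s _; rewrite mulr_sumr. Qed.

Hypothesis prP : fprob.

Lemma esp_cst c : esp (fun=> c) = c.
Proof. by rewrite /esp -mulr_suml prP.2 mul1r. Qed.

Lemma esp_le f g : (forall s, f s <= g s) -> esp f <= esp g.
Proof. by move=> fg; apply: ler_sum => s _; rewrite ler_wpM2l// prP.1. Qed.

Lemma esp_ge0 f : (forall s, 0 <= f s) -> 0 <= esp f.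
Proof. by move=> f0; apply: sumr_ge0 => s _; rewrite mulr_ge0// prP.1. Qed.

Lemma norm_esp f : `|esp f| <= esp (fun s => `|f s|).
Proof.
apply: le_trans (ler_norm_sum _ _ _) _; apply: ler_sum => s _.
by rewrite normrM ger0_norm// prP.1.
Qed.

Lemma norm_esp_le f B : (forall s, `|f s| <= B) -> `|esp f| <= B.
Proof.
move=> fB; apply: le_trans (norm_esp f) _; rewrite -[leRHS]esp_cst.
exact: esp_le.
Qed.

End finite_expectation.

(** * Trigonometric polynomials and their Gaussian means *)

Section trigonometric_polynomials.
Variable R : realType.
Implicit Types (f g : R -> R) (t phi x y : R).

Let cosT N phi y :=
  \sum_(k < N) cos (phi + k%:R * (pi / 2)) / k`!%:R * y ^+ k.

Let is_derive_cosT N phi (y : R) :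
  is_derive y 1 (cosT N.+1 phi) (cosT N (phi + pi / 2) y).
Proof.
have -> : cosT N.+1 phi = \sum_(k < N.+1)
    (cos (phi + k%:R * (pi / 2)) / k`!%:R) *: ((id : R -> R) ^+ k).
  by apply/funext => x; rewrite /cosT fct_sumE; apply: eq_bigr => k _; rewrite !fctE.
apply: is_derive_eq; rewrite big_ord_recl/= !mul0r scale0r scaler0 add0r.
apply: eq_bigr => k _; rewrite /GRing.scale/= mulr1 /bump/= add1n.
have k0 : k.+1%:R != 0 :> R by rewrite pnatr_eq0.
have f0 : k`!%:R != 0 :> R by rewrite pnatr_eq0 -lt0n fact_gt0.
rewrite factS natrM -addrA (_ : pi / 2 + k%:R * (pi / 2) = k.+1%:R * (pi / 2)).
  move: k0 f0; move: (k.+1%:R : R) (k`!%:R : R) => a b a0 b0.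
  by field; rewrite a0 b0.
by rewrite -[k.+1%:R]nat1r [RHS]mulrDl mul1r.
Qed.

(** The derivative of the remainder of order N + 1 at phase phi is the remainder of order N at phase
    phi + pi / 2, so the mean value theorem drives an induction on N. The signs s = 1 and s = -1 in
    [main] give the two sides of the absolute value. *)
Let taylor_cos_ge0 N phi y : 0 <= y ->
  `|cos (y + phi) - cosT N phi y| <= y ^+ N / N`!%:R.
Proof.
elim: N phi y => [|N IH] phi y y0.
  by rewrite /cosT big_ord0 subr0 expr0 fact0 divr1 cos_max.
move: y0; rewrite le_eqVlt => /predU1P[<-|y0].
  rewrite add0r /cosT big_ord_recl mul0r addr0 expr0 mulr1 fact0 divr1 big1.
    by rewrite addr0 subrr normr0 expr0n mul0r.
  by move=> i _; rewrite expr0n mulr0.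
have main (s : R) : `|s| = 1 ->
    s * (cos (y + phi) - cosT N.+1 phi y) <= y ^+ N.+1 / N.+1`!%:R.
  move=> s1; pose h : R -> R := (N.+1`!%:R^-1 : R) *: (id : R -> R) ^+ N.+1 -
     s *: ((cos \o ((id : R -> R) + cst phi)) - cosT N.+1 phi).
  have dh (x : R) : is_derive x 1 h (x ^+ N / N`!%:R -
      s * (cos (x + (phi + pi / 2)) - cosT N (phi + pi / 2) x)).
    have dT := is_derive_cosT N phi x.
    apply: is_derive_eq; rewrite /GRing.scale/= !mulr1 addr0 addrA cosDpihalf.
    congr (_ - _); last by rewrite fctE mulr1.
    have k0 : N.+1%:R != 0 :> R by rewrite pnatr_eq0.
    have f0 : N`!%:R != 0 :> R by rewrite pnatr_eq0 -lt0n fact_gt0.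
    rewrite factS natrM.
    move: k0 f0; move: (N.+1%:R : R) (N`!%:R : R) => a b a0 b0.
    by field; rewrite a0 b0.
  have [z zy hy] : exists2 z, z \in `]0, y[ & h y - h 0 = (z ^+ N / N`!%:R -
      s * (cos (z + (phi + pi / 2)) - cosT N (phi + pi / 2) z)) * (y - 0).
    apply: (MVT y0 (fun x _ => dh x)); apply: continuous_subspaceT => x.
    by apply/differentiable_continuous/derivable1_diffP; have [] := dh x.
  have h0 : h 0 = 0.
    rewrite /h !fctE /GRing.scale/= add0r /cosT big_ord_recl mul0r addr0 expr0.
    rewrite mulr1 fact0 divr1 big1 ?addr0 ?subrr ?mulr0 ?subr0 ?expr0n ?mulr0//.
    by move=> i _; rewrite expr0n mulr0.
  move: hy; rewrite h0 !subr0 => hy; rewrite -subr_ge0.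
  have -> : y ^+ N.+1 / N.+1`!%:R - s * (cos (y + phi) - cosT N.+1 phi y) = h y.
    by rewrite /h !fctE /GRing.scale/= mulrC.
  rewrite hy mulr_ge0 ?(ltW y0)// subr_ge0.
  move: zy; rewrite in_itv/= => /andP[/ltW z0 _].
  apply: le_trans (IH (phi + pi / 2) z z0); apply: le_trans (ler_norm _) _.
  by rewrite normrM s1 mul1r.
rewrite ler_norml lerNl -mulN1r -[X in _ && (X <= _)]mul1r.
by rewrite !main ?normrN ?normr1.
Qed.

Lemma taylor_cos N phi : exists c : nat -> R, forall y : R,
  `|cos (y + phi) - \sum_(k < N) c k * y ^+ k| <= `|y| ^+ N / N`!%:R.
Proof.
exists (fun k => cos (phi + k%:R * (pi / 2)) / k`!%:R) => y.
have [y0|y0] := leP 0 y; first by rewrite (ger0_norm y0); exact: taylor_cos_ge0.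
have y1 : 0 <= - y by rewrite oppr_ge0 ltW.
rewrite (ltr0_norm y0); apply: le_trans (taylor_cos_ge0 N (- phi) y1).
rewrite -opprD cosN le_eqVlt; apply/orP; left; apply/eqP; congr `|_ - _|.
apply: eq_bigr => k _; rewrite exprNn.
have -> : cos (phi + k%:R * (pi / 2)) = (-1) ^+ k * cos (- phi + k%:R * (pi / 2)).
  have -> : phi + k%:R * (pi / 2) = phi - k%:R * (pi / 2) + pi *+ k.
    by rewrite -mulr_natl; field.
  by rewrite (alternatingn (@cosDpi R)) -(cosN (phi - _)) opprB addrC.
by ring.
Qed.

(** Free frequencies and phases make the class closed under products, through the product formula
    for cosines. *)
Inductive trig : (R -> R) -> Prop :=
| trig_cos t phi : trig (fun y => cos (t * y + phi))
| trigD f g : trig f -> trig g -> trig (fun y => f y + g y)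
| trigZ c f : trig f -> trig (fun y => c * f y).

Lemma trig_ext f g : (forall y, f y = g y) -> trig f -> trig g.
Proof. by move=> /funext ->. Qed.

Lemma trig_cst c : trig (fun=> c).
Proof.
apply: trig_ext (trigZ c (trig_cos 0 0)) => y.
by rewrite mul0r addr0 cos0 mulr1.
Qed.

Lemma trigM f g : trig f -> trig g -> trig (fun y => f y * g y).
Proof.
move=> + Hg; elim=> {f} [t phi|f f' _ IHf _ IHf'|c f _ IHf].
- elim: Hg => {g} [t' phi'|g g' _ IHg _ IHg'|c g _ IHg].
  + have := trigZ (2^-1) (trigD (trig_cos (t + t') (phi + phi'))
                              (trig_cos (t - t') (phi - phi'))).
    apply: trig_ext => y.
    have -> : (t + t') * y + (phi + phi') = (t * y + phi) + (t' * y + phi') by ring.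
    have -> : (t - t') * y + (phi - phi') = (t * y + phi) - (t' * y + phi') by ring.
    rewrite (cosD (_ + _) (_ + _)) (cosB (_ + _) (_ + _)); by field.
  + by apply: trig_ext (trigD IHg IHg') => y; rewrite mulrDr.
  + by apply: trig_ext (trigZ c IHg) => y; rewrite mulrCA.
- by apply: trig_ext (trigD IHf IHf') => y; rewrite mulrDl.
- by apply: trig_ext (trigZ c IHf) => y; rewrite mulrA.
Qed.

Lemma trigX f n : trig f -> trig (fun y => f y ^+ n).
Proof.
move=> Hf; elim: n => [|n IH].
  by apply: trig_ext (trig_cst 1) => y; rewrite expr0.
by apply: trig_ext (trigM Hf IH) => y; rewrite exprS.
Qed.

Lemma trig_gauss_integrable f : trig f -> gauss_integrable f.
Proof.
elim=> {f} [t phi|f g _ If _ Ig|c f _ If].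
- apply: (@gauss_integrable_le _ _ (fun=> 1)); last exact: gauss_integrable_cst.
    apply: continuous_measurable_fun => y; apply: continuous_comp.
      by apply: cvgD; [apply: cvgMr; exact: cvg_id|exact: cvg_cst].
    exact: continuous_cos.
  by move=> x; exact: cos_max.
- exact: gauss_integrableD.
- exact: gauss_integrableZ.
Qed.

Lemma gauss_integrable_poly N (c : nat -> R) :
  gauss_integrable (fun x => \sum_(k < N) c k * x ^+ k).
Proof.
elim: N => [|N IH].
  rewrite (_ : (fun x : R => _) = fun=> 0); last first.
    by apply/funext => x; rewrite big_ord0.
  exact: gauss_integrable_cst.
rewrite (_ : (fun x : R => _) =
    fun x : R => \sum_(k < N) c k * x ^+ k + c N * x ^+ N); last first.
  by apply/funext => x; rewrite big_ord_recr.
by apply: gauss_integrableD => //; apply: gauss_integrableZ; exact: gauss_integrableX.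
Qed.

Lemma gauss_mean_poly N (c : nat -> R) :
  gauss_mean (fun x => \sum_(k < N) c k * x ^+ k) = \sum_(k < N) c k * gauss_moment R k.
Proof.
elim: N => [|N IH].
  rewrite big_ord0 (_ : (fun x : R => _) = fun=> 0 * 1); last first.
    by apply/funext => x; rewrite big_ord0 mul0r.
  by rewrite gauss_meanZ ?mul0r//; exact: gauss_integrable_cst.
rewrite (_ : (fun x : R => _) =
    fun x : R => \sum_(k < N) c k * x ^+ k + c N * x ^+ N); last first.
  by apply/funext => x; rewrite big_ord_recr.
rewrite gauss_meanD ?gauss_meanZ ?IH ?big_ord_recr//.
- exact: gauss_integrableX.
- exact: gauss_integrable_poly.
- by apply: gauss_integrableZ; exact: gauss_integrableX.
Qed.

(** Multiplied by t^(2m), this is a term of the series of exp(t^2 / 2), so Taylor remainders of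
    cosines have small Gaussian mean whatever the frequency t. *)
Lemma gauss_moment_even_fact m :
  gauss_moment R m.*2 / m.*2`!%:R = (2^-1) ^+ m / m`!%:R.
Proof.
elim: m => [|m IH].
  rewrite double0 fact0 /= !divr1 expr0 -[RHS]gauss_mean1.
  by apply: eq_Rintegral => x _; rewrite expr0.
rewrite doubleS gauss_moment_rec /= exprS !factS !natrM.
transitivity ((gauss_moment R m.*2 / m.*2`!%:R) / m.*2.+2%:R).
  have f0 : m.*2`!%:R != 0 :> R by rewrite pnatr_eq0 -lt0n fact_gt0.
  have a0 : m.*2.+1%:R != 0 :> R by rewrite pnatr_eq0.
  have b0 : m.*2.+2%:R != 0 :> R by rewrite pnatr_eq0.
  move: f0 a0 b0; move: (m.*2`!%:R : R) (m.*2.+1%:R : R) (m.*2.+2%:R : R).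
  by move=> x y z x0 y0 z0; field; rewrite x0 y0 z0.
rewrite IH; have f0 : m`!%:R != 0 :> R by rewrite pnatr_eq0 -lt0n fact_gt0.
have a0 : m.+1%:R != 0 :> R by rewrite pnatr_eq0.
rewrite -doubleS -muln2 natrM.
move: f0 a0; move: (m`!%:R : R) (m.+1%:R : R) => x y x0 y0.
by field; rewrite x0 y0.
Qed.

End trigonometric_polynomials.

(** * From moments to means of trigonometric polynomials *)

Section moment_method.
Variables (R : realType) (F : set_system nat).
Context {FF : ProperFilter F}.
Variables (S : nat -> finType) (pr : forall n, S n -> R) (Y : forall n, S n -> R).
Arguments pr : clear implicits.
Arguments Y : clear implicits.
Hypothesis prP : forall n, fprob (pr n).
Hypothesis momP : forall k,
  (fun n => esp (pr n) (fun s => Y n s ^+ k)) @ F --> gauss_moment R k.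

Lemma poly_cvg N (c : nat -> R) :
  (fun n => esp (pr n) (fun s => \sum_(k < N) c k * Y n s ^+ k)) @ F -->
  gauss_mean (fun x => \sum_(k < N) c k * x ^+ k).
Proof.
rewrite gauss_mean_poly.
under eq_cvg do rewrite esp_sum.
apply: cvg_sumr => k _; under eq_cvg do rewrite espZ.
by apply: cvgMr; exact: momP.
Qed.

(** A cosine differs from its Taylor polynomial of order 2m by at most a multiple of y^(2m). The
    even order makes this error a polynomial, whose mean also converges, to a quantity that is small
    for large m. *)
Lemma trig_cvg f : trig f ->
  (fun n => esp (pr n) (fun s => f (Y n s))) @ F --> gauss_mean f.
Proof.
elim=> {f} [t phi|f g Hf IHf Hg IHg|c f Hf IHf]; last 2 first.
- under eq_cvg do rewrite espD.
  by rewrite gauss_meanD; [exact: cvgD|exact: trig_gauss_integrable..].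
- under eq_cvg do rewrite espZ.
  by rewrite gauss_meanZ; [exact: cvgMr|exact: trig_gauss_integrable].
pose rho m : R := exp_coeff (t ^+ 2 / 2) m.
have rho0 : rho @ \oo --> (0 : R).
  exact/cvg_series_cvg_0/is_cvg_series_exp_coeff.
apply/cvgrPdist_lt => e e0.
have [m _ /(_ m (leqnn m)) rm] : \forall m \near \oo, rho m < e / 4.
  by apply: (cvgr_lt _ rho0); rewrite divr_gt0.
have [c Hc] := taylor_cos m.*2 phi.
have Hc' (y : R) : `|cos (t * y + phi) - \sum_(k < m.*2) (c k * t ^+ k) * y ^+ k|
    <= t ^+ m.*2 / m.*2`!%:R * y ^+ m.*2.
  have sq : 0 <= (t * y) ^+ m.*2 by rewrite -muln2 exprM sqr_ge0.
  have := Hc (t * y); rewrite -normrX (ger0_norm sq).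
  rewrite exprMn mulrAC; congr (`|_ - _| <= _); apply: eq_bigr => k _.
  by rewrite exprMn mulrA.
have rhoE : t ^+ m.*2 / m.*2`!%:R * gauss_moment R m.*2 = rho m.
  rewrite mulrAC -mulrA gauss_moment_even_fact /rho /exp_coeff /=.
  by rewrite expr_div_n exprVn -mul2n exprM mulrA.
have hT := @poly_cvg m.*2 (fun k => c k * t ^+ k).
have hM : (fun n => esp (pr n) (fun s => t ^+ m.*2 / m.*2`!%:R * Y n s ^+ m.*2)) @ F
   --> rho m.
  under eq_cvg do rewrite espZ.
  by rewrite -rhoE; apply: cvgMr; exact: momP.
have hM' : \forall n \near F, esp (pr n) (fun s => t ^+ m.*2 / m.*2`!%:R * Y n s ^+ m.*2) < e / 4.
  exact: (cvgr_lt _ hM).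
have hT' : \forall n \near F, `|gauss_mean (fun x => \sum_(k < m.*2) c k * t ^+ k * x ^+ k) -
   esp (pr n) (fun s => \sum_(k < m.*2) c k * t ^+ k * Y n s ^+ k)| < e / 4.
  by move/cvgrPdist_lt : hT; apply; rewrite divr_gt0.
have hG : `|gauss_mean (fun y => cos (t * y + phi)) -
     gauss_mean (fun x => \sum_(k < m.*2) c k * t ^+ k * x ^+ k)| <= rho m.
  have I1 : gauss_integrable (fun y => cos (t * y + phi)).
    exact/trig_gauss_integrable/trig_cos.
  have I2 := gauss_integrable_poly m.*2 (fun k => c k * t ^+ k).
  have I3 := gauss_integrableZ (t ^+ m.*2 / m.*2`!%:R) (@gauss_integrableX R m.*2).
  rewrite -rhoE -(gauss_meanZ _ (@gauss_integrableX R m.*2)).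
  set G1 := gauss_mean _; set G2 := gauss_mean _; set G3 := gauss_mean _.
  have i1 : G1 <= G2 + G3.
    rewrite -gauss_meanD//; apply: gauss_mean_le => //.
      exact: gauss_integrableD.
    by move=> x; have := Hc' x; rewrite ler_norml => /andP[]; lra.
  have i2 : G2 <= G1 + G3.
    rewrite -gauss_meanD//; apply: gauss_mean_le => //.
      exact: gauss_integrableD.
    by move=> x; have := Hc' x; rewrite ler_norml => /andP[]; lra.
  by rewrite ler_norml; apply/andP; split; lra.
near=> n.
have hE : `|esp (pr n) (fun s => cos (t * Y n s + phi)) -
     esp (pr n) (fun s => \sum_(k < m.*2) c k * t ^+ k * Y n s ^+ k)| < e / 4.
  apply: le_lt_trans (_ : _ <= esp (pr n) (fun s => t ^+ m.*2 / m.*2`!%:R * Y n s ^+ m.*2)) _.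
    rewrite -espB; apply: le_trans (norm_esp (prP n) _) _.
    by apply: esp_le => // s; exact: Hc'.
  by near: n.
have h2 : `|gauss_mean (fun x => \sum_(k < m.*2) c k * t ^+ k * x ^+ k) -
   esp (pr n) (fun s => \sum_(k < m.*2) c k * t ^+ k * Y n s ^+ k)| < e / 4.
  by near: n.
move: hE h2 hG; rewrite !ltr_norml ler_norml.
move=> /andP[a1 a2] /andP[b1 b2] /andP[c1 c2].
by apply/andP; split; lra.
Unshelve. all: by end_near. Qed.

End moment_method.

(** * From trigonometric polynomials to distribution functions *)

Section distribution_functions.
Variable R : realType.

Lemma bernoulli_ineq (x : R) n : -1 <= x -> 1 + n%:R * x <= (1 + x) ^+ n.
Proof.
move=> x1; elim: n => [|n IH]; first by rewrite mul0r addr0 expr0.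
have x0 : 0 <= 1 + x by lra.
rewrite exprS; apply: le_trans (ler_wpM2l x0 IH).
have : 0 <= n%:R * x ^+ 2 by rewrite mulr_ge0// sqr_ge0.
rewrite -nat1r; nra.
Qed.

(* [(1 - u^N)^(2^N)] tends to 1 for u < 1/2 and to 0 for u > 1/2; composed with
   u = (1 + sin ((y - b) / T)) / 2 it is a trigonometric step at b. *)
Lemma trig_step (b delta T eps : R) : 0 < delta -> delta <= T -> 0 < eps ->
  exists f : R -> R, [/\ trig f, forall y, 0 <= f y <= 1,
    forall y, y <= b - delta -> 1 <= f y + (eps + (y - b) ^+ 2 / T ^+ 2) &
    forall y, b + delta <= y -> f y <= eps + (y - b) ^+ 2 / T ^+ 2].
Proof.
move=> d0 dT e0; have T0 : 0 < T by exact: lt_le_trans dT.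
pose s := sin (delta / T).
have pi2 := @pihalf_ge1 R.
have dT0 : 0 < delta / T by rewrite divr_gt0.
have dT1 : delta / T <= 1 by rewrite ler_pdivrMr// mul1r.
have s0 : 0 < s by apply: sin_gt0_pi; rewrite dT0/=; have := @pi_ge2 R; lra.
have s1 : s <= 1 by exact: sin_le1.
have c1 : (fun N => (1 - s) ^+ N) @ \oo --> (0 : R).
  by apply: cvg_expr; rewrite ger0_norm; lra.
have c2 : (fun N => (1 + s)^-1 ^+ N) @ \oo --> (0 : R).
  apply: cvg_expr; rewrite ger0_norm ?invr_ge0; last lra.
  by rewrite invf_lt1; lra.
have [N _ /(_ N (leqnn N)) [N1 N2]] : \forall N \near \oo,
    (1 - s) ^+ N < eps /\ (1 + s)^-1 ^+ N < eps.
  by near=> N; split; near: N; [exact: (cvgr_lt _ c1)|exact: (cvgr_lt _ c2)].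
pose u y := (1 + sin ((y - b) / T)) / 2.
have u01 y : 0 <= u y <= 1.
  have := sin_le1 ((y - b) / T); have := sin_geN1 ((y - b) / T).
  by rewrite /u => h1 h2; apply/andP; split; lra.
have uN y : 0 <= u y ^+ N <= 1.
  by have /andP[? ?] := u01 y; rewrite exprn_ge0//= exprn_ile1.
pose f y := (1 - u y ^+ N) ^+ (2 ^ N).
have f01 y : 0 <= f y <= 1.
  have /andP[? ?] := uN y; rewrite /f exprn_ge0 ?exprn_ile1//; lra.
(* The step is periodic, hence wrong far from b; beyond distance T the quadratic term is at least 1
   and makes both inequalities trivial. *)
have far y : T < `|y - b| -> 1 <= (y - b) ^+ 2 / T ^+ 2.
  move=> Ty; rewrite ler_pdivlMr ?exprn_gt0// mul1r -(real_normK (num_real (y - b))).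
  by rewrite lerXn2r ?nnegrE// ltW.
have sq0 y : 0 <= (y - b) ^+ 2 / T ^+ 2 by rewrite divr_ge0// sqr_ge0.
have itv (x : R) : `|x| <= 1 -> x \in `[- (pi / 2), pi / 2].
  by rewrite ler_norml in_itv/= => /andP[? ?]; apply/andP; split; lra.
exists f; split=> [| |y yb|y yb]; last 2 first.
- have [/far fa|yT] := ltP T `|y - b|; first by have /andP[? _] := f01 y; lra.
  have us : u y <= (1 - s) / 2.
    rewrite /u /s ler_pM2r ?invr_gt0// lerD2l -sinN le_eqVlt; apply/orP.
    have : (y - b) / T <= - (delta / T).
      by rewrite -mulNr ler_pM2r ?invr_gt0//; lra.
    rewrite le_eqVlt => /predU1P[->|h]; [by left|right].
    rewrite ltr_sin//; apply: itv.
      by rewrite normrM normfV (gtr0_norm T0) ler_pdivrMr// mul1r.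
    by rewrite normrN ger0_norm// ltW.
  have : 1 - (1 - s) ^+ N <= f y.
    have /andP[un0 un1] := uN y; have /andP[u0 u1] := u01 y.
    apply: le_trans (@bernoulli_ineq (- u y ^+ N) (2 ^ N) _); last by lra.
    rewrite mulrN lerD2l lerN2 natrX -exprMn lerXn2r ?nnegrE; lra.
  by have := sq0 y; lra.
- have [/far fa|yT] := ltP T `|y - b|; first by have /andP[_ ?] := f01 y; lra.
  have us : (1 + s) / 2 <= u y.
    rewrite /u /s ler_pM2r ?invr_gt0// lerD2l le_eqVlt; apply/orP.
    have : delta / T <= (y - b) / T.
      by rewrite ler_pM2r ?invr_gt0//; lra.
    rewrite le_eqVlt => /predU1P[->|h]; [by left|right].
    rewrite ltr_sin//; apply: itv.
      by rewrite ger0_norm// ltW.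
    by rewrite normrM normfV (gtr0_norm T0) ler_pdivrMr// mul1r.
  have /andP[un0 un1] := uN y; have /andP[u0 u1] := u01 y.
  (* With x = u^N, (1 - x)(1 + x) <= 1 bounds [f y] by the inverse of (1 + x)^(2^N), which by
     Bernoulli is at least (2u)^N, hence at least (1 + s)^N. *)
  have h1 : (1 + s) ^+ N <= (1 + u y ^+ N) ^+ (2 ^ N).
    apply: le_trans (@bernoulli_ineq (u y ^+ N) (2 ^ N) _); last by lra.
    apply: (@le_trans _ _ ((2 ^ N)%:R * u y ^+ N)); last by lra.
    by rewrite natrX -exprMn lerXn2r ?nnegrE; lra.
  have h2 : f y * (1 + u y ^+ N) ^+ (2 ^ N) <= 1.
    by rewrite /f -exprMn exprn_ile1//; nra.
  have s1N : 0 < (1 + s) ^+ N by rewrite exprn_gt0//; lra.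
  have : f y <= (1 + s)^-1 ^+ N.
    rewrite exprVn -div1r ler_pdivlMr//; apply: le_trans h2.
    by rewrite ler_wpM2l//; have /andP[] := f01 y.
  by have := sq0 y; lra.
- have tu : trig u.
    have := trigZ (2^-1) (trigD (trig_cst 1) (trig_cos T^-1 (- (b / T) - pi / 2))).
    apply: trig_ext => y; rewrite /u addrA cosBpihalf mulrC; congr ((1 + sin _) / 2).
    by rewrite mulrBl mulrC.
  apply: trigX; apply: trig_ext (trigD (trig_cst 1) (trigZ (-1) (trigX N tu))) => y.
  by rewrite mulN1r.
- exact: f01.
Unshelve. all: by end_near. Qed.

End distribution_functions.

Section cdf_convergence.
Variables (R : realType) (F : set_system nat).
Context {FF : ProperFilter F}.
Variables (S : nat -> finType) (pr : forall n, S n -> R) (Y : forall n, S n -> R).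
Arguments pr : clear implicits.
Arguments Y : clear implicits.
Hypothesis prP : forall n, fprob (pr n).
Hypothesis momP : forall k,
  (fun n => esp (pr n) (fun s => Y n s ^+ k)) @ F --> gauss_moment R k.

Definition gauss_cdf (a : R) := gauss_mean (fun x : R => (x <= a)%R%:R).

Lemma gauss_integrable_le_indic (a : R) : gauss_integrable (fun x : R => (x <= a)%R%:R).
Proof.
apply: (@gauss_integrable_le _ _ (fun=> 1)); last exact: gauss_integrable_cst.
  rewrite (_ : (fun x => _) = \1_`]-oo, a]).
    exact: measurable_indic.
  apply/funext => x; rewrite indicE; congr (_%:R : R); congr nat_of_bool.
  by apply/idP/idP; rewrite inE/= in_itv.
by move=> x; case: (x <= a); rewrite ?normr1 ?normr0.
Qed.

Lemma gauss_cdf_lipschitz (a b : R) : a <= b ->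
  gauss_cdf b <= gauss_cdf a + normal_peak 1 * (b - a).
Proof.
move=> ab; rewrite -lerBlDl.
have Ia := gauss_integrable_le_indic a; have Ib := gauss_integrable_le_indic b.
have -> : gauss_cdf b - gauss_cdf a =
    (\int[lebesgue_measure]_(x in `]a, b]) normal_pdf 0 1 x)%R.
  rewrite /gauss_cdf /gauss_mean -RintegralB// [RHS]Rintegral_mkcond.
  apply: eq_Rintegral => x _; rewrite patchE -mulrBl.
  rewrite mem_setE in_itv/=; have [xb|bx] := leP x b; have [xa|ax] := leP x a => /=.
  - by rewrite subrr mul0r.
  - by rewrite subr0 mul1r.
  - by move: (lt_le_trans bx xa); rewrite ltNge ab.
  - by rewrite subr0 mul0r.
have mE : lebesgue_measure (`]a, b]%classic : set R) = (b - a)%:E.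
  rewrite lebesgue_measure_itv/= lte_fin -EFinB.
  by case: ltP => // ba; rewrite (@le_anti _ _ a b) ?ab// subrr.
have mab : (lebesgue_measure (`]a, b]%classic : set R) < +oo)%E by rewrite mE ltry.
apply: (@le_trans _ _ (\int[lebesgue_measure]_(x in `]a, b]) (normal_peak 1))%R).
  apply: le_Rintegral => //.
  - by apply: integrableS (@integrable_normal_pdf R 0 1).
  - apply: (@measurable_bounded_integrable _ _ _ _ (cst (normal_peak 1))).
    + exact: measurable_itv.
    + exact: mab.
    + by [].
    exists (normal_peak 1); split; first by rewrite num_real.
    by move=> y /ltW py x _ /=; rewrite ger0_norm ?normal_peak_ge0.
  - by move=> x _; apply: normal_pdf_ub; rewrite oner_eq0.
by rewrite Rintegral_cst// [X in fine X]mE.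
Qed.

(** The error q of the trigonometric step is a quadratic polynomial, so its mean converges too and
    is small for a long period. *)
Lemma cdf_sandwich (b delta eps : R) : 0 < delta -> 0 < eps ->
  \forall n \near F,
   (esp (pr n) (fun s => (Y n s <= b - delta)%R%:R) <= gauss_cdf (b + delta) + eps) /\
   (gauss_cdf (b - delta) <= esp (pr n) (fun s => (Y n s <= b + delta)%R%:R) + eps).
Proof.
move=> d0 e0; pose c k := nth 0 [:: b ^+ 2; - 2 * b; 1] k.
have cE y : \sum_(k < 3) c k * y ^+ k = (y - b) ^+ 2.
  by rewrite !big_ord_recr big_ord0/= /c/=; ring.
have Icv := gauss_integrable_poly 3 c.
have hq := @poly_cvg _ _ FF _ _ _ momP 3 c.
set V := gauss_mean _ in hq.
have V0 : 0 <= V.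
  have <- : gauss_mean (fun=> 0 * 1 : R) = 0.
    by rewrite gauss_meanZ ?mul0r//; exact: gauss_integrable_cst.
  apply: gauss_mean_le => //; first exact: gauss_integrable_cst.
  by move=> x; rewrite cE mul0r sqr_ge0.
pose e := eps / 6; have e1 : 0 < e by rewrite divr_gt0.
(* Large enough for V / T^2 <= e, where V is the Gaussian mean of (y - b)^2; six errors of size e
   add up to eps. *)
pose T := delta + 1 + V / e.
have Ve : 0 <= V / e by rewrite divr_ge0// ltW.
have dT : delta <= T by rewrite /T -addrA lerDl addr_ge0.
have T1 : 1 <= T by rewrite /T; lra.
have VT : V / T ^+ 2 <= e.
  rewrite ler_pdivrMr ?exprn_gt0//; last by lra.
  apply: (@le_trans _ _ (e * T)).
    by rewrite -ler_pdivrMl// mulrC /T; lra.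
  by rewrite ler_pM2l// expr2; nra.
have [f [tf f01 flo fhi]] := trig_step b d0 dT e1.
have If := trig_gauss_integrable tf.
pose q y := e + \sum_(k < 3) (c k / T ^+ 2) * y ^+ k.
have qE y : q y = e + (y - b) ^+ 2 / T ^+ 2.
  by rewrite /q -cE mulr_suml; congr (_ + _); apply: eq_bigr => k _; rewrite mulrAC.
have Ipoly := gauss_integrable_poly 3 (fun k => c k / T ^+ 2).
have Iq : gauss_integrable q.
  by apply: gauss_integrableD => //; exact: gauss_integrable_cst.
have q0 y : 0 <= q y by rewrite qE addr_ge0 ?(ltW e1)// divr_ge0 ?sqr_ge0.
have lo y : (y <= b - delta)%R%:R <= f y + q y.
  case: (leP y (b - delta)) => [/flo|_]; first by rewrite qE.
  by have /andP[? _] := f01 y; rewrite addr_ge0.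
have hi y : f y <= (y <= b + delta)%R%:R + q y.
  have [yb|/ltW/fhi] := leP y (b + delta); last by rewrite qE add0r.
  by have /andP[_ ?] := f01 y; have := q0 y; rewrite /= => ?; lra.
have Gq : gauss_mean q = e + V / T ^+ 2.
  rewrite gauss_meanD//; last exact: gauss_integrable_cst.
  congr (_ + _).
    by rewrite -[in LHS](mulr1 e) gauss_meanZ ?gauss_mean1 ?mulr1//; exact: gauss_integrable_cst.
  rewrite mulrC -gauss_meanZ//; congr gauss_mean; apply/funext => y.
  by rewrite mulr_sumr; apply: eq_bigr => k _; rewrite mulrA (mulrC _^-1).
have hf := @trig_cvg _ _ FF _ _ _ prP momP f tf.
have hp := @poly_cvg _ _ FF _ _ _ momP 3 (fun k => c k / T ^+ 2).
have Gp : gauss_mean (fun x => \sum_(k < 3) c k / T ^+ 2 * x ^+ k) <= e.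
  apply: le_trans VT; move: Gq; rewrite /q gauss_meanD//; last exact: gauss_integrable_cst.
  rewrite (_ : gauss_mean (fun=> e) = e); first by move/addrI ->.
  by rewrite -[in LHS](mulr1 e) gauss_meanZ ?gauss_mean1 ?mulr1//; exact: gauss_integrable_cst.
have i1 : gauss_mean f <= gauss_cdf (b + delta) + gauss_mean q.
  rewrite -gauss_meanD//; last exact: gauss_integrable_le_indic.
  apply: gauss_mean_le => //; apply: gauss_integrableD => //.
  exact: gauss_integrable_le_indic.
have i2 : gauss_cdf (b - delta) <= gauss_mean f + gauss_mean q.
  rewrite -gauss_meanD//; apply: gauss_mean_le => //.
    exact: gauss_integrable_le_indic.
  exact: gauss_integrableD.
have nf : \forall n \near F, `|gauss_mean f - esp (pr n) (fun s => f (Y n s))| < e.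
  by move/cvgrPdist_lt : hf => /(_ _ e1).
have np : \forall n \near F,
    esp (pr n) (fun s => \sum_(k < 3) c k / T ^+ 2 * Y n s ^+ k) < 2 * e.
  by apply: (cvgr_lt _ hp); lra.
near=> n.
have k1 : `|gauss_mean f - esp (pr n) (fun s => f (Y n s))| < e by near: n.
have k2 : esp (pr n) (fun s => \sum_(k < 3) c k / T ^+ 2 * Y n s ^+ k) < 2 * e by near: n.
have Eq : esp (pr n) (fun s => q (Y n s)) < 3 * e.
  by rewrite espD esp_cst//; lra.
have j1 : esp (pr n) (fun s => (Y n s <= b - delta)%R%:R) <=
   esp (pr n) (fun s => f (Y n s)) + esp (pr n) (fun s => q (Y n s)).
  by rewrite -espD; apply: esp_le.
have j2 : esp (pr n) (fun s => f (Y n s)) <=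
   esp (pr n) (fun s => (Y n s <= b + delta)%R%:R) + esp (pr n) (fun s => q (Y n s)).
  by rewrite -espD; apply: esp_le.
have ee : eps = 6 * e by rewrite /e; field.
move: k1; rewrite ltr_norml => /andP[k1 k1'].
by rewrite ee; split; lra.
Unshelve. all: by end_near. Qed.

(** The sandwich is used at a + delta and a - delta; the resulting shifts by 2 delta cost at most 2
    delta times the maximum of the Gaussian density. *)
Theorem moment_method (a : R) :
  (fun n => esp (pr n) (fun s => (Y n s <= a)%R%:R)) @ F --> gauss_cdf a.
Proof.
apply/cvgrPdist_le => e e0.
have p0 : 0 < normal_peak (1 : R) by rewrite normal_peak_gt0// oner_eq0.
pose delta := e / 4 / normal_peak 1; have d0 : 0 < delta by rewrite !divr_gt0.
have pd : normal_peak 1 * delta = e / 4 by rewrite /delta mulrC divfK// gt_eqF.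
have e2 : 0 < e / 2 by rewrite divr_gt0.
have h1 := cdf_sandwich (a + delta) d0 e2.
have h2 := cdf_sandwich (a - delta) d0 e2.
near=> n.
have [k1 _] : (esp (pr n) (fun s => (Y n s <= (a + delta) - delta)%R%:R) <=
     gauss_cdf ((a + delta) + delta) + e / 2) /\
   (gauss_cdf ((a + delta) - delta) <=
     esp (pr n) (fun s => (Y n s <= (a + delta) + delta)%R%:R) + e / 2) by near: n.
have [_ k2] : (esp (pr n) (fun s => (Y n s <= (a - delta) - delta)%R%:R) <=
     gauss_cdf ((a - delta) + delta) + e / 2) /\
   (gauss_cdf ((a - delta) - delta) <=
     esp (pr n) (fun s => (Y n s <= (a - delta) + delta)%R%:R) + e / 2) by near: n.
rewrite addrK in k1; rewrite subrK in k2.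
have l1 : a <= a + delta + delta by lra.
have l2 : a - delta - delta <= a by lra.
have := gauss_cdf_lipschitz l1; have := gauss_cdf_lipschitz l2.
rewrite (_ : a + delta + delta - a = 2 * delta); last by ring.
rewrite (_ : a - (a - delta - delta) = 2 * delta); last by ring.
rewrite mulrCA pd => m1 m2.
by rewrite ler_norml; apply/andP; split; lra.
Unshelve. all: by end_near. Qed.

End cdf_convergence.

(** * Convergence along ultrafilters *)

(** If the preimage of a neighbourhood of l were not in F, then F restricted to its complement would
    extend to an ultrafilter along which f does not tend to l. *)
Lemma cvg_ultra (T : topologicalType) (I : Type) (F : set_system I)
    (FF : ProperFilter F) (f : I -> T) (l : T) :
  (forall U, UltraFilter U -> F `<=` U -> f @ U --> l) -> f @ F --> l.
Proof.
move=> H A /= Al; apply: contrapT => nFA.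
have WF : ProperFilter (within (~` (f @^-1` A)) F).
  apply: Build_ProperFilter_ex => B; rewrite /within /= => FB.
  apply: contrapT => nB; apply: nFA; apply: filterS FB => x /= hx.
  by apply: contrapT => nAx; apply: nB; exists x; exact: hx.
have [U [UU WU]] := ultraFilterLemma WF.
have FU : F `<=` U.
  by move=> B FB; apply: WU; rewrite /within /=; apply: filterS FB.
have UA : U (f @^-1` A) := H U UU FU A Al.
have UnA : U (~` (f @^-1` A)).
  by apply: WU; rewrite /within /=; apply: nearW.
have PU : ProperFilter U by exact: ultra_proper.
by have [x [Ax]] := filter_ex (filterI UA UnA); exact.
Qed.

(** Compactness of a segment. A single ultrafilter makes all the moments converge, in place of a
    diagonal extraction of subsequences. *)
Lemma ultra_bounded_cvg (R : realType) (I : Type) (U : set_system I) (f : I -> R)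
    (B : R) :
  UltraFilter U -> (\forall i \near U, `|f i| <= B) -> exists l : R, f @ U --> l.
Proof.
move=> UU fB; have cpt := @segment_compact R (- B) B.
have PU : ProperFilter U by exact: ultra_proper.
have UfU : UltraFilter (f @ U).
  split; first exact: fmap_proper_filter.
  move=> G PG UG; apply/seteqP; split => // A GA.
  have [//|nA] := in_ultra_setVsetC (f @^-1` A) UU.
  have : G (~` A) by apply: UG.
  move=> GnA; have PG' : ProperFilter G by [].
  by have [x [Ax]] := filter_ex (filterI GA GnA); exact.
move: cpt; rewrite compact_ultra => /(_ (f @ U) UfU) [].
  by apply: filterS fB => i /=; rewrite ler_norml in_itv.
by move=> l [_ fl]; exists l.
Qed.

(** * Vanishing high cumulants imply normality *)

Section clt.
Variables (R : realType) (S : nat -> finType).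
Variables (pr : forall n, S n -> R) (Y : forall n, S n -> R).
Arguments pr : clear implicits.
Arguments Y : clear implicits.
Hypothesis prP : forall n, fprob (pr n).

Definition nmom (S : finType) (pr Y : S -> R) (k : nat) : R :=
  esp pr (fun s => Y s ^+ k) / k`!%:R.

Lemma nmom0 (S' : finType) (pr' Y' : S' -> R) : fprob pr' -> nmom pr' Y' 0 = 1.
Proof.
move=> P; rewrite /nmom fact0 divr1.
by rewrite (_ : (fun s => _) = fun=> 1) ?esp_cst//; apply/funext => s; rewrite expr0.
Qed.

Lemma normX_le_add1 (x : R) j K : ~~ odd K -> (j <= K)%N -> `|x| ^+ j <= 1 + x ^+ K.
Proof.
move=> oK jK; have xK : x ^+ K = `|x| ^+ K.
  by rewrite -normrX ger0_norm// exprn_even_ge0.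
have [x1|x1] := leP `|x| 1.
  by apply: (@le_trans _ _ 1); [exact: exprn_ile1|rewrite lerDl xK exprn_ge0].
by rewrite xK; apply: (@le_trans _ _ (`|x| ^+ K)); [rewrite ler_weXn2l// ltW|rewrite lerDr].
Qed.

(** One even moment bounds all lower ones. The power (1 + B)^j, instead of the constant 1 + B, is
    the shape that [logd_lipschitz] requires. *)
Lemma norm_nmom_le (S' : finType) (pr' Y' : S' -> R) j K B : fprob pr' ->
  ~~ odd K -> (j <= K)%N -> esp pr' (fun s => Y' s ^+ K) <= B ->
  `|nmom pr' Y' j| <= (1 + B) ^+ j.
Proof.
move=> P oK jK EB.
have E0 : 0 <= esp pr' (fun s => Y' s ^+ K).
  by apply: esp_ge0 => // s; rewrite exprn_even_ge0.
have B0 : 0 <= B by exact: le_trans EB.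
case: j jK => [|j] jK; first by rewrite nmom0// normr1 expr0.
have h1 : `|esp pr' (fun s => Y' s ^+ j.+1)| <= 1 + B.
  apply: le_trans (norm_esp P _) _.
  apply: (@le_trans _ _ (esp pr' (fun s => 1 + Y' s ^+ K))).
    by apply: esp_le => // s; rewrite normrX; exact: normX_le_add1.
  by rewrite espD esp_cst// lerD2l.
rewrite /nmom normrM; apply: (@le_trans _ _ (1 + B)).
  apply: (le_trans _ h1); rewrite ler_piMr// normfV normr_nat invf_le1.
    by rewrite ler1n fact_gt0.
  by rewrite ltr0n fact_gt0.
by apply: ler_eXnr => //; rewrite lerDl.
Qed.

(* With Z = Y / R and R^K = E Y^K: if R were large then Z would have bounded
   moments and a small variance, contradicting E Z^K = 1. *)
Lemma high_moment_bounded K : ~~ odd K -> (2 <= K)%N -> exists B : R,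
  forall (S : finType) (pr Y : S -> R), fprob pr ->
  esp pr (fun s => Y s ^+ 2) = 1 ->
  (forall k, (K <= k.+1 < 2 * K)%N -> `|logd (nmom pr Y) k| <= 1) ->
  esp pr (fun s => Y s ^+ K) <= B.
Proof.
move=> oK K2.
have /choice[c Hc] : forall k : nat, exists c : R, 0 <= c /\ forall B eps p p',
  0 <= B -> 0 <= eps ->
  (forall j, (j <= k.+1)%N -> `|p j| <= B ^+ j) ->
  (forall j, (j <= k.+1)%N -> `|p' j| <= B ^+ j) ->
  (forall j, (j <= k.+1)%N -> `|p j - p' j| <= eps * B ^+ j) ->
  `|logd p k| <= c * B ^+ k.+1 /\
  `|logd p k - logd p' k| <= c * eps * B ^+ k.+1.
  by move=> k; have [c c0 H] := @logd_lipschitz R k; exists c.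
(* For the rescaled variable W below, cumulants of order less than K are bounded through its K-th
   moment, equal to 1, hence the powers of 1 + 1 = 2; the summand 1 covers the orders from K on. *)
pose b := 1 + \sum_(k < K) c k * 2 ^+ k.+1.
have c0 k : 0 <= c k by have [] := Hc k.
have b1 : 1 <= b by rewrite lerDl sumr_ge0// => k _; rewrite mulr_ge0// exprn_ge0.
have b0 : 0 <= b by exact: le_trans b1.
have [C C0 HC] := cumulants_bound_moments (2 * K - 2) b0.
pose D := C * (2 * K - 2)`!%:R.
have D0 : 0 <= D by rewrite mulr_ge0.
exists (1 + ((1 + D) / 2) ^+ K) => T q Z qP Z2 Hk.
set M := esp q _.
have [M1|M1] := leP M 1.
  by apply: le_trans M1 _; rewrite lerDl exprn_ge0// divr_ge0// addr_ge0.
have M0 : 0 < M by exact: lt_trans M1.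
pose r := M `^ (K%:R^-1).
have K0 : (0 < K)%N by exact: leq_trans K2.
have rK : r ^+ K = M.
  rewrite /r -powR_mulrn ?powR_ge0// -powRrM mulVf ?powRr1 ?(ltW M0)//.
  by rewrite pnatr_eq0 -lt0n.
have r0 : 0 < r by rewrite powR_gt0.
have r1 : 1 <= r.
  by rewrite leNgt; apply/negP => rl; move: M1; rewrite -rK ltNge exprn_ile1 ?ltW.
pose W s := r^-1 * Z s.
have WX j : (fun s => W s ^+ j) = (fun s => r^-1 ^+ j * Z s ^+ j).
  by apply/funext => s; rewrite exprMn.
have WK : esp q (fun s => W s ^+ K) = 1.
  by rewrite WX espZ -/M -rK exprVn mulVf// expf_eq0 negb_and gt_eqF ?orbT.
have nW : nmom q W = fun j => r^-1 ^+ j * nmom q Z j.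
  by apply/funext => j; rewrite /nmom WX espZ mulrA.
have lW k : (k < 2 * K - 2)%N -> `|logd (nmom q W) k| <= b.
  move=> kK; have [Kk|kK'] := leqP K k.+1.
    rewrite nW logd_scale normrM; apply: le_trans b1.
    rewrite mulr_ile1//; last by apply: Hk; rewrite Kk /=; lia.
    rewrite normrX ger0_norm ?invr_ge0 ?(ltW r0)//.
    by rewrite exprn_ile1 ?invr_ge0 ?(ltW r0)// invf_le1.
  have [_ /(_ 2 0 (nmom q W) (nmom q W)) H] := Hc k.
  have pj j : (j <= k.+1)%N -> `|nmom q W j| <= 2 ^+ j.
    move=> jk; rewrite -[2]/(1 + 1); apply: norm_nmom_le oK _ _ => //.
      by apply: leq_trans jk _; exact: ltnW.
    by rewrite WK.
  have [] := H _ _ pj pj => //.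
    by move=> j _; rewrite subrr normr0 mul0r.
  move=> h _; apply: le_trans h _; rewrite /b.
  rewrite (bigD1 (Ordinal (ltnW kK')))//= addrCA lerDl addr_ge0// sumr_ge0//.
  by move=> i _; rewrite mulr_ge0// exprn_ge0.
have W2K : esp q (fun s => W s ^+ (2 * K - 2)) <= D.
  have := HC _ (nmom0 W qP) lW.
  rewrite /nmom normrM normfV normr_nat ler_pdivrMr ?ltr0n ?fact_gt0//.
  by apply: le_trans; exact: ler_norm.
(* w^K = w w^(K-1) is at most (r w^2 + w^(2K-2) / r) / 2. As E W^2 = r^(-2) and E W^(2K-2) <= D,
   both terms are of order 1 / r, which bounds r. *)
have key : 1 <= (r * r ^- 2 + D / r) / 2.
  rewrite -[leLHS]WK.
  apply: (@le_trans _ _ (esp q (fun s => 2^-1 * (r * W s ^+ 2 + r^-1 * W s ^+ (2 * K - 2))))).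
    apply: esp_le => // s; set w := W s.
    have -> : w ^+ K = w * w ^+ K.-1 by rewrite -exprS prednK.
    have -> : w ^+ (2 * K - 2) = (w ^+ K.-1) ^+ 2.
      by rewrite -exprM; congr (_ ^+ _); lia.
    set v := w ^+ K.-1.
    have -> : 2^-1 * (r * w ^+ 2 + r^-1 * v ^+ 2) =
        w * v + 2^-1 * r * (w - v / r) ^+ 2.
      by field; rewrite gt_eqF.
    by rewrite lerDl mulr_ge0 ?sqr_ge0// mulr_ge0// ltW.
  rewrite espZ espD !espZ mulrC ler_pM2r ?invr_gt0//; apply: lerD.
    by rewrite WX espZ Z2 mulr1 exprVn.
  by rewrite mulrC ler_pM2r ?invr_gt0.
have : r <= (1 + D) / 2.
  rewrite -(ler_pM2l r0) mulr1 in key; apply: le_trans key _.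
  rewrite le_eqVlt; apply/orP; left; apply/eqP; field.
  by rewrite gt_eqF.
move=> rD; rewrite -rK; apply: (@le_trans _ _ (((1 + D) / 2) ^+ K)); last by rewrite lerDr.
by rewrite lerXn2r ?nnegrE ?(ltW r0)// divr_ge0// addr_ge0.
Qed.

Theorem clt_of_cumulants (K : nat) :
  (\forall n \near \oo, esp (pr n) (Y n) = 0 /\ esp (pr n) (fun s => Y n s ^+ 2) = 1) ->
  (forall k, (K <= k)%N -> (fun n => logd (nmom (pr n) (Y n)) k) @ \oo --> (0 : R)) ->
  forall a, (fun n => esp (pr n) (fun s => (Y n s <= a)%R%:R)) @ \oo --> gauss_cdf a.
Proof.
move=> H12 HK.
(* An even order, large enough for K' <= k + 1 to imply K <= k. *)
pose K' := (2 * K.+1)%N.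
have oK' : ~~ odd K' by rewrite /K' oddM.
have K2 : (2 <= K')%N by rewrite /K' leq_pmulr.
have KK' k : (K' <= k.+1)%N -> (K <= k)%N by rewrite /K'; lia.
have [B HB] := high_moment_bounded oK' K2.
have small k : (K <= k)%N -> \forall n \near \oo, `|logd (nmom (pr n) (Y n)) k| <= 1.
  move=> kK; have /cvgrPdist_le /(_ 1 ltr01) := HK k kK.
  by apply: filterS => n; rewrite distrC subr0.
have bigsmall : \forall n \near \oo, forall k : 'I_(2 * K'), (K <= k)%N ->
    `|logd (nmom (pr n) (Y n)) k| <= 1.
  apply: filter_forall => k; have [Kk|kK] := leqP K k.
    by apply: filterS (small k Kk).
  by apply: nearW.
have mB : \forall n \near \oo, esp (pr n) (fun s => Y n s ^+ K') <= B.
  near=> n; apply: HB => //.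
    by near: n; apply: filterS H12 => n [].
  move=> k /andP[K'k kK]; have k2 : (k < 2 * K')%N by exact: ltnW.
  move: (KK' k K'k); rewrite -[k]/(nat_of_ord (Ordinal k2)).
  by move: (Ordinal k2); near: n.
have lB k : exists b : R, \forall n \near \oo, `|logd (nmom (pr n) (Y n)) k| <= b.
  have [Kk|kK] := leqP K k; first by exists 1; exact: small.
  have [c c0 Hc] := @logd_lipschitz R k.
  exists (c * (1 + `|B|) ^+ k.+1); apply: filterS mB => n En.
  have pj j : (j <= k.+1)%N -> `|nmom (pr n) (Y n) j| <= (1 + `|B|) ^+ j.
    move=> jk; apply: norm_nmom_le oK' _ _ => //; first by rewrite /K'; lia.
    exact: le_trans En (ler_norm _).
  have [] := Hc (1 + `|B|) 0 (nmom (pr n) (Y n)) (nmom (pr n) (Y n)) _ _ pj pj => //.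
  by move=> j _; rewrite subrr normr0 mul0r.
have mbd k : exists b : R, \forall n \near \oo, `|nmom (pr n) (Y n) k| <= b.
  have /choice[b Hb] := lB.
  pose bb := \sum_(j < k) `|b j|.
  have bb0 : 0 <= bb by apply: sumr_ge0.
  have [c c0 Hc] := cumulants_bound_moments k bb0.
  have H : \forall n \near \oo, forall j : 'I_k, `|logd (nmom (pr n) (Y n)) j| <= b j.
    by apply: filter_forall => j.
  exists c; apply: filterS H => n Hn; apply: Hc; first exact: nmom0.
  move=> j jk; apply: le_trans (Hn (Ordinal jk)) _ => /=.
  rewrite /bb (bigD1 (Ordinal jk))//= (le_trans (ler_norm _))// lerDl.
  exact: sumr_ge0.
(* Limits of the moments along any ultrafilter satisfy the assumptions of [marcinkiewicz]: their
   late cumulants are the given limits 0, and their Hankel forms are limits of means of squares. *)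
have cumcv k : (2 <= k)%N -> (fun n => logd (nmom (pr n) (Y n)) k) @ \oo --> (0 : R).
  move=> k2; apply: cvg_ultra => U UU oU.
  have PU : ProperFilter U by exact: ultra_proper.
  have /choice[p pP] : forall j, exists l : R, (fun n => nmom (pr n) (Y n) j) @ U --> l.
    move=> j; have [b Hb] := mbd j.
    by apply: (@ultra_bounded_cvg _ _ _ _ b UU); exact: oU.
  have lp j : (fun n => logd (nmom (pr n) (Y n)) j) @ U --> logd p j.
    by apply: cvg_logd => // i _; exact: pP.
  suff -> : (0 : R) = logd p k by exact: lp.
  apply/esym; apply: (@marcinkiewicz _ p K) => //.
  - apply: (cvg_unique _ (pP 0)) => //; apply: cvg_near_cst; apply: nearW => n.
    exact: nmom0.
  - move=> j Kj; apply: (cvg_unique _ (lp j)) => //.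
    exact: cvg_trans (cvg_app _ oU) (HK j Kj).
  - move=> N a.
    have cv : (fun n => \sum_(i < N) \sum_(j < N) a i * a j *
       ((i + j)`!%:R * nmom (pr n) (Y n) (i + j)%N)) @ U -->
       \sum_(i < N) \sum_(j < N) a i * a j * ((i + j)`!%:R * p (i + j)%N).
      apply: cvg_sumr => i _; apply: cvg_sumr => j _; do 2 apply: cvgMr.
      exact: pP.
    rewrite -(cvg_lim _ cv)//; apply: limr_ge; first by apply: cvgP; exact: cv.
    apply: nearW => n.
    have -> : \sum_(i < N) \sum_(j < N) a i * a j *
       ((i + j)`!%:R * nmom (pr n) (Y n) (i + j)%N) =
       esp (pr n) (fun s => (\sum_(i < N) a i * Y n s ^+ i) ^+ 2).
      rewrite [X in _ = esp _ X](_ : _ = fun s => \sum_(i < N) \sum_(j < N)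
          a i * a j * Y n s ^+ (i + j)); last first.
        apply/funext => s; rewrite expr2 mulr_suml; apply: eq_bigr => i _.
        by rewrite mulr_sumr; apply: eq_bigr => j _; rewrite exprD mulrACA.
      rewrite esp_sum; apply: eq_bigr => i _; rewrite esp_sum; apply: eq_bigr => j _.
      rewrite espZ /nmom; congr (_ * _); rewrite mulrC divfK//.
    by apply: esp_ge0 => // s; rewrite sqr_ge0.
move=> a; apply: moment_method => // k.
pose q j := gauss_moment R j / j`!%:R : R.
have q0 : q 0 = 1.
  rewrite /q fact0 divr1 -[RHS]gauss_mean1; apply: eq_Rintegral => x _.
  by rewrite expr0.
have f0 : k`!%:R != 0 :> R by rewrite pnatr_eq0 -lt0n fact_gt0.
have -> : (fun n => esp (pr n) (fun s => Y n s ^+ k)) =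
    (fun n => nmom (pr n) (Y n) k * k`!%:R).
  by apply/funext => n; rewrite /nmom divfK.
rewrite -[X in _ --> X](divfK f0); apply: cvgMl.
apply: (@cvg_of_logd _ _ _ _ (fun n => nmom (pr n) (Y n)) q k) => //.
  by move=> n; exact: nmom0.
move=> j _; rewrite logd_gauss; case: j => [|[|j]]; last by apply: cumcv.
- apply: cvg_near_cst; apply: filterS H12 => n [E1 _].
  rewrite logd_rec big_ord0 subr0 /dser /nmom mul1r divr1 -[RHS]E1.
  by congr esp; apply/funext => s; rewrite expr1.
- apply: cvg_near_cst; apply: filterS H12 => n [E1 E2].
  have n1 : nmom (pr n) (Y n) 1 = 0.
    rewrite /nmom divr1 -[RHS]E1.
    by congr esp; apply/funext => s; rewrite expr1.
  rewrite logd_rec big_ord1 subn0 n1 mulr0 subr0 /dser /nmom E2.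
  by rewrite div1r divff.
Unshelve. all: by end_near. Qed.

End clt.

(** * Cumulants of sums of local functions of a random set *)

Section normalized_cumulants.
Variables (R : realType) (S : finType) (pr : S -> R).
Hypothesis prP : fprob pr.

Lemma nmomD_esp (f g : S -> R) k : nmom pr (fun s => f s + g s) k =
  \sum_(i < k.+1) esp pr (fun s => f s ^+ i * g s ^+ (k - i)) / (i`!%:R * (k - i)`!%:R).
Proof.
rewrite /nmom.
have -> : (fun s => (f s + g s) ^+ k) = (fun s => \sum_(i < k.+1)
    'C(k, i)%:R * (f s ^+ i * g s ^+ (k - i))).
  apply/funext => s; rewrite addrC exprDn; apply: eq_bigr => i _.
  by rewrite -mulr_natl; congr (_ * _); rewrite mulrC.
rewrite esp_sum mulr_suml; apply: eq_bigr => i _; rewrite espZ.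
have ik : (i <= k)%N by rewrite -ltnS.
have fn n : n`!%:R != 0 :> R by rewrite pnatr_eq0 -lt0n fact_gt0.
have -> : k`!%:R = 'C(k, i)%:R * (i`!%:R * (k - i)`!%:R) :> R.
  by rewrite -!natrM bin_fact.
have c0 : 'C(k, i)%:R != 0 :> R by rewrite pnatr_eq0 -lt0n bin_gt0.
move: (fn i) (fn (k - i)%N) c0.
move: (i`!%:R : R) ((k - i)`!%:R : R) ('C(k, i)%:R : R) => x y z x0 y0 z0.
by field; rewrite x0 y0 z0.
Qed.

Lemma nmom_cst (c : R) k : nmom pr (fun=> c) k = c ^+ k / k`!%:R.
Proof. by rewrite /nmom esp_cst. Qed.

(** Subtracting c multiplies the generating series by e^(-cz), whose logarithm is linear: only index
    0, the mean, is affected. *)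
Lemma cumulant_affine (f : S -> R) (t c : R) k : (0 < k)%N ->
  logd (nmom pr (fun s => t * (f s - c))) k = t ^+ k.+1 * logd (nmom pr f) k.
Proof.
move=> k0.
have -> : nmom pr (fun s => t * (f s - c)) =
    fun j => t ^+ j * nmom pr (fun s => f s - c) j.
  apply/funext => j; rewrite /nmom mulrA -espZ; congr (esp _ _ / _).
  by apply/funext => s; rewrite exprMn.
rewrite logd_scale; congr (_ * _).
have -> : nmom pr (fun s => f s - c) = conv (nmom pr f) (fun j => (- c) ^+ j / j`!%:R).
  apply/funext => j; rewrite nmomD_esp; apply: eq_bigr => i _.
  rewrite (_ : (fun s => _) = fun s => (- c) ^+ (j - i) * f s ^+ i).
    by rewrite espZ /nmom invfM; ring.
  by apply/funext => s; rewrite mulrC.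
rewrite logd_conv ?nmom0//; last by rewrite expr0 fact0 divr1.
by rewrite logd_exp gtn_eqF// addr0.
Qed.

Lemma nmom_bound (f : S -> R) (B : R) j : (forall s, `|f s| <= B) ->
  `|nmom pr f j| <= B ^+ j.
Proof.
move=> fB; rewrite /nmom normrM normfV normr_nat ler_pdivrMr ?ltr0n ?fact_gt0//.
have h : `|esp pr (fun s => f s ^+ j)| <= B ^+ j.
  apply: norm_esp_le => // s; rewrite normrX.
  by rewrite lerXn2r ?nnegrE ?(le_trans (normr_ge0 _) (fB s)).
apply: (le_trans h); rewrite ler_peMr ?ler1n ?fact_gt0//.
exact: le_trans (normr_ge0 _) h.
Qed.

End normalized_cumulants.

(** Under independence the normalized moments of f + g would be the convolution of those of f and g,
    on which cumulants are additive. The j-th coefficients differ by at most (j + 1) eps, and j + 1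
    <= 2^j is absorbed in the geometric bound (2B)^j. *)
Lemma cumulant_near_additive (R : realType) k : exists2 c : R, 0 <= c &
  forall (S : finType) (pr f g : S -> R) (B eps : R), fprob pr -> 1 <= B -> 0 <= eps ->
  (forall s, `|f s| <= B) -> (forall s, `|g s| <= B) ->
  (forall i j, (i + j <= k.+1)%N -> `|esp pr (fun s => f s ^+ i * g s ^+ j) -
     esp pr (fun s => f s ^+ i) * esp pr (fun s => g s ^+ j)| <= eps) ->
  `|logd (nmom pr (fun s => f s + g s)) k -
    (logd (nmom pr f) k + logd (nmom pr g) k)| <= c * eps * B ^+ k.+1.
Proof.
have [c c0 Hc] := @logd_lipschitz R k; exists (c * 2 ^+ k.+1).
  by rewrite mulr_ge0 ?exprn_ge0.
move=> S pr f g B eps prP B1 e0 fB gB H.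
have B0 : 0 <= B by exact: le_trans B1.
have BX j : 1 <= B ^+ j by rewrite exprn_ege1.
rewrite -logd_conv ?nmom0//.
have -> : c * 2 ^+ k.+1 * eps * B ^+ k.+1 = c * eps * (2 * B) ^+ k.+1.
  by rewrite exprMn; ring.
have n2 j : (j.+1)%:R <= 2 ^+ j :> R by rewrite -natrX ler_nat ltn_expl.
have fn n : 1 <= n`!%:R :> R by rewrite ler1n fact_gt0.
have inv1 i j : 0 <= (i`!%:R * j`!%:R : R)^-1 <= 1.
  have p0 : 1 <= i`!%:R * j`!%:R :> R by rewrite mulr_ege1.
  by rewrite invr_ge0 mulr_ge0//= invf_le1// (lt_le_trans ltr01 p0).
have [] := Hc (2 * B) eps (nmom pr (fun s => f s + g s)) (conv (nmom pr f) (nmom pr g)).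
- by rewrite mulr_ge0.
- by [].
- move=> j _; apply: nmom_bound => // s; apply: le_trans (ler_normD _ _) _.
  by rewrite mulr_natl mulr2n lerD.
- move=> j _; apply: le_trans (ler_norm_sum _ _ _) _.
  apply: (@le_trans _ _ (\sum_(i < j.+1) B ^+ j)).
    apply: ler_sum => i _; have ij : (i <= j)%N by rewrite -ltnS.
    have -> : B ^+ j = B ^+ i * B ^+ (j - i) by rewrite -exprD subnKC.
    by rewrite normrM; apply: ler_pM => //; apply: nmom_bound.
  rewrite sumr_const card_ord -[leLHS]mulr_natl exprMn ler_wpM2r//.
  by rewrite exprn_ge0.
- move=> j jk; rewrite nmomD_esp /conv -sumrB; apply: le_trans (ler_norm_sum _ _ _) _.
  apply: (@le_trans _ _ (\sum_(i < j.+1) eps)).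
    apply: ler_sum => i _; have ij : (i <= j)%N by rewrite -ltnS.
    rewrite /nmom mulrACA -invfM -mulrBl normrM.
    have /andP[v0 v1] := inv1 i (j - i)%N.
    rewrite [X in _ * X]ger0_norm// -[leRHS]mulr1; apply: ler_pM => //.
    by apply: H; rewrite subnKC.
  rewrite sumr_const card_ord -[leLHS]mulr_natr ler_wpM2l// exprMn.
  by apply: le_trans (n2 j) _; rewrite ler_peMr// exprn_ge0.
by [].
Qed.

(** * Moebius inversion and polynomials in site indicators *)

Section moebius.
Import mathcomp.boot.fintype mathcomp.boot.finset.
Variables (R : realType) (T : finType).
Implicit Types (A B C : {set T}) (g h : {set T} -> R).

Definition moeb g B : R := \sum_(C : {set T} | C \subset B) (-1) ^+ #|B :\: C| * g C.

Lemma moebD g h B : moeb (fun C => g C + h C) B = moeb g B + moeb h B.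
Proof. by rewrite /moeb -big_split; apply: eq_bigr => C _; rewrite mulrDr. Qed.

Lemma moebZ c g B : moeb (fun C => c * g C) B = c * moeb g B.
Proof. by rewrite /moeb mulr_sumr; apply: eq_bigr => C _; rewrite mulrCA. Qed.

(** The sets C and [x |: C] carry opposite signs and equal values of g, so they cancel in pairs. *)
Lemma moeb_toggle g B x : x \in B ->
  (forall C, x \notin C -> g (x |: C) = g C) -> moeb g B = 0.
Proof.
move=> xB gx; rewrite /moeb (bigID (fun C => x \in C))/=.
rewrite (reindex_onto (fun C => x |: C) (fun C => C :\ x))/=; last first.
  by move=> C /andP[_ xC]; rewrite setD1K.
rewrite (eq_bigl (fun C => (C \subset B) && (x \notin C))); last first.
  move=> C; rewrite setU11 andbT; apply/andP/andP.
    move=> [s /eqP e]; split.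
      by apply: subset_trans s; rewrite subsetUr.
    by rewrite -e !inE eqxx.
  move=> [CB xC]; split; first by rewrite subUset sub1set xB.
  by rewrite setU1K.
rewrite -big_split big1// => C /andP[CB xC]; rewrite /= gx//.
have -> : #|B :\: C| = #|B :\: (x |: C)|.+1.
  rewrite (cardsD1 x (B :\: C)) !inE xB xC add1n; congr (_.+1); congr #|pred_of_set _|.
  by apply/setP => y; rewrite !inE negb_or andbA.
by rewrite exprS mulN1r mulNr addrC addNr.
Qed.

Lemma moeb_indic A B : moeb (fun C => (A \subset C)%:R) B = (B == A)%:R.
Proof.
have [BA|] := boolP (B \subset A); last first.
  move=> /subsetPn[x xB xA]; rewrite (moeb_toggle xB); last first.
    move=> C xC; congr (nat_of_bool _)%:R; apply/idP/idP => AC.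
      apply/subsetP => y yA; have := subsetP AC y yA.
      by rewrite !inE => /predU1P[yx|//]; rewrite -yx yA in xA.
    by apply: subset_trans AC _; rewrite subsetUr.
  by case: eqP => // BA; rewrite -BA xB in xA.
have [->|BnA] := eqVneq B A.
  rewrite /moeb (bigD1 A)//= setDv cards0 subxx mulr1 expr0 big1 ?addr0//.
  move=> C /andP[CA nCA]; case: (boolP (A \subset C)) => AC; last by rewrite mulr0.
  by rewrite eqEsubset CA AC in nCA.
rewrite /moeb big1// => C CB; case: (boolP (A \subset C)) => AC; last by rewrite mulr0.
by rewrite eqEsubset BA (subset_trans AC CB) in BnA.
Qed.

Lemma moeb_inversion g A : g A = \sum_(B : {set T} | B \subset A) moeb g B.
Proof.
rewrite /moeb (exchange_big_dep (fun C : {set T} => C \subset A))/=; last first.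
  by move=> B C BA CB; exact: subset_trans BA.
have key C : C \subset A -> \sum_(B : {set T} | (B \subset A) && (C \subset B))
    (-1) ^+ #|B :\: C| * g C = (A == C)%:R * ((-1) ^+ #|A :\: C| * g C).
  move=> CA; rewrite -moeb_indic /moeb mulr_suml big_mkcondr/=.
  apply: eq_bigr => B BA; case: ifP => CB; last by rewrite mulr0 mul0r.
  rewrite mulr1 mulrA; congr (_ * _).
  have -> : #|A :\: C| = (#|A :\: B| + #|B :\: C|)%N.
    rewrite -[LHS](cardsID B) addnC; congr (_ + _)%N; congr #|pred_of_set _|.
      apply/setP => y; rewrite !inE; case: (boolP (y \in B)) => //= yB.
      by case: (boolP (y \in C)) => //= /(subsetP CB) yB'; rewrite yB' in yB.
    apply/setP => y; rewrite !inE; case: (boolP (y \in B)) => yB; rewrite ?andbF ?andbT//.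
    by rewrite (subsetP BA _ yB) andbT.
  by rewrite exprD mulrA -exprMn mulrNN mulr1 expr1n mul1r.
rewrite (eq_bigr _ key) (bigD1 A)//= eqxx setDv cards0 expr0 !mul1r big1 ?addr0//.
by move=> C /andP[_ CA]; rewrite eq_sym (negPf CA) mul0r.
Qed.

Lemma norm_moeb g B (M : R) : (forall C, C \subset B -> `|g C| <= M) ->
  `|moeb g B| <= 2 ^+ #|B| * M.
Proof.
move=> gM; apply: le_trans (ler_norm_sum _ _ _) _.
apply: (@le_trans _ _ (\sum_(C : {set T} | C \subset B) M)).
  by apply: ler_sum => C CB; rewrite normrM normrX normrN1 expr1n mul1r gM.
rewrite sumr_const -natrX mulr_natl le_eqVlt; apply/orP; left; apply/eqP; congr (_ *+ _).
by rewrite -card_powerset; apply: eq_card => C; rewrite inE.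
Qed.

(** Polynomials of degree at most k in the indicators of the sites: indicators are idempotent, so
    every monomial is the indicator that a set B is contained in A. *)
Inductive set_poly (k : nat) : ({set T} -> R) -> Prop :=
| set_poly_indic B : (#|B| <= k)%N -> set_poly k (fun A => (B \subset A)%:R)
| set_polyD g h : set_poly k g -> set_poly k h -> set_poly k (fun A => g A + h A)
| set_polyZ c g : set_poly k g -> set_poly k (fun A => c * g A).

Lemma set_poly_ext k g h : (forall A, g A = h A) -> set_poly k g -> set_poly k h.
Proof. by move=> /funext ->. Qed.

Lemma set_poly_cst k c : set_poly k (fun=> c).
Proof.
have h : set_poly k (fun A => (set0 \subset A)%:R) by apply: set_poly_indic; rewrite cards0.
by apply: set_poly_ext (set_polyZ c h) => A; rewrite sub0set mulr1.
Qed.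

Lemma set_poly_sum k I (r : seq I) (P : pred I) (F : I -> {set T} -> R) :
  (forall i, P i -> set_poly k (F i)) -> set_poly k (fun A => \sum_(i <- r | P i) F i A).
Proof.
move=> H; elim: r => [|i r IH].
  by apply: set_poly_ext (set_poly_cst k 0) => A; rewrite big_nil.
case: (boolP (P i)) => Pi.
  by apply: set_poly_ext (set_polyD (H i Pi) IH) => A; rewrite big_cons Pi.
by apply: set_poly_ext IH => A; rewrite big_cons (negPf Pi).
Qed.

Lemma set_polyM j k g h : set_poly j g -> set_poly k h ->
  set_poly (j + k) (fun A => g A * h A).
Proof.
move=> + Hh; elim=> {g} [B Bj|g g' _ IHg _ IHg'|c g _ IHg].
- elim: Hh => {h} [C Ck|h h' _ IHh _ IHh'|c h _ IHh].
  + have : set_poly (j + k) (fun A => (B :|: C \subset A)%:R).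
      by apply: set_poly_indic; rewrite (leq_trans (leq_card_setU _ _))// leq_add.
    by apply: set_poly_ext => A; rewrite subUset -mulnb natrM.
  + by apply: set_poly_ext (set_polyD IHh IHh') => A; rewrite mulrDr.
  + by apply: set_poly_ext (set_polyZ c IHh) => A; rewrite mulrCA.
- by apply: set_poly_ext (set_polyD IHg IHg') => A; rewrite mulrDl.
- by apply: set_poly_ext (set_polyZ c IHg) => A; rewrite mulrA.
Qed.

Lemma set_polyX k g : set_poly 1 g -> set_poly k (fun A => g A ^+ k).
Proof.
move=> Hg; elim: k => [|k IH].
  by apply: set_poly_ext (set_poly_cst 0 1) => A; rewrite expr0.
by rewrite -add1n; apply: set_poly_ext (set_polyM Hg IH) => A; rewrite exprS.
Qed.

Lemma moeb_set_poly k g B : set_poly k g -> (k < #|B|)%N -> moeb g B = 0.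
Proof.
move=> Hg kB; elim: Hg => {g} [A Ak|g h _ IHg _ IHh|c g _ IHg].
- by rewrite moeb_indic; case: eqP kB => // ->; rewrite ltnNge Ak.
- by rewrite moebD IHg IHh addr0.
- by rewrite moebZ IHg mulr0.
Qed.

(** Sets with more than k elements have coefficient 0, and so has the empty set since g vanishes
    there. Every other set is the image of a map from k points, and maps are easier to count than
    sets. *)
Lemma set_poly_le_sum k g : set_poly k g -> g set0 = 0 ->
  `|g [set: T]| <= \sum_(h : {ffun 'I_k -> T}) `|moeb g [set h i | i : 'I_k]|.
Proof.
move=> Hg g0; rewrite (moeb_inversion g) (bigID (fun B => (0 < #|B| <= k)%N))/=.
rewrite [X in _ + X]big1 ?addr0; last first.
  move=> B /andP[_]; rewrite negb_and -leqNgt leqn0 cards_eq0 -ltnNge.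
  case/orP => [/eqP ->|]; last exact: moeb_set_poly.
  rewrite /moeb (bigD1 set0)//= g0 mulr0 add0r big1// => C /andP[].
  by rewrite subset0 => ->.
apply: le_trans (ler_norm_sum _ _ _) _.
rewrite (partition_big (fun h : {ffun 'I_k -> T} => [set h i | i : 'I_k]) xpredT)//=.
rewrite [leRHS](bigID (fun B => (0 < #|B| <= k)%N))/= -[leLHS]addr0.
apply: lerD; last by apply: sumr_ge0 => B _; apply: sumr_ge0.
rewrite (eq_bigl (fun B => (0 < #|B| <= k)%N)); last by move=> B; rewrite subsetT.
apply: ler_sum => B /andP[B0 Bk].
have /card_gt0P[x0 x0B] := B0.
pose h := [ffun i : 'I_k => nth x0 (enum B) i].
have hB : [set h i | i : 'I_k] = B.
  apply/setP => x; apply/imsetP/idP => [[i _ ->]|xB].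
    rewrite ffunE; have [iB|Bi] := ltnP i (size (enum B)).
      by rewrite -mem_enum mem_nth.
    by rewrite nth_default.
  have xE : (index x (enum B) < #|B|)%N by rewrite cardE index_mem mem_enum.
  exists (Ordinal (leq_trans xE Bk)) => //.
  by rewrite ffunE/= nth_index// mem_enum.
by rewrite (bigD1 h) ?hB//= lerDl sumr_ge0.
Qed.

End moebius.

(** * Covariances of local functions of a random subset *)

Section random_subset.
Import mathcomp.boot.fintype mathcomp.boot.finset.
Variables (R : realType) (T : finType) (pr : {set T} -> R).
Hypothesis prP : fprob pr.
Implicit Types (A B C : {set T}) (F G : {set T} -> R).

Definition incl_prob C : R := esp pr (fun S => (C \subset S)%:R).

Lemma incl_prob0 : incl_prob finset.set0 = 1.
Proof.
rewrite /incl_prob (_ : (fun S => _) = fun=> 1) ?esp_cst//.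
by apply/funext => S; rewrite sub0set.
Qed.

Let local_expand A F S : (forall S, F S = F (S :&: A)) ->
  F S = \sum_(C : {set T} | C \subset A) moeb F C * (C \subset S)%:R.
Proof.
move=> FA; rewrite FA (moeb_inversion F (S :&: A)).
under eq_bigl do rewrite subsetI andbC.
rewrite big_mkcondr; apply: eq_bigr => C _.
by case: ifP => _; rewrite ?mulr1 ?mulr0.
Qed.

(** F and G expand over the subsets of A1 and A2, with coefficients at most 2^|A1| M1 and 2^|A2| M2.
    There are 2^|A1| and 2^|A2| subsets, so the correlation defects get total weight 4^(|A1| + |A2|)
    M1 M2. *)
Lemma cov_le A1 A2 F G (M1 M2 delta : R) :
  (forall S, F S = F (S :&: A1)) -> (forall S, `|F S| <= M1) ->
  (forall S, G S = G (S :&: A2)) -> (forall S, `|G S| <= M2) ->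
  (forall C1 C2, C1 \subset A1 -> C2 \subset A2 ->
     `|incl_prob (C1 :|: C2) - incl_prob C1 * incl_prob C2| <= delta) ->
  `|esp pr (fun S => F S * G S) - esp pr F * esp pr G|
    <= 4 ^+ (#|A1| + #|A2|) * (M1 * M2) * delta.
Proof.
move=> FA FM GA GM H.
have M10 : 0 <= M1 by apply: le_trans (FM A1).
have M20 : 0 <= M2 by apply: le_trans (GM A1).
have d0 : 0 <= delta by apply: le_trans (H set0 set0 (sub0set _) (sub0set _)).
have EF : esp pr F = \sum_(C : {set T} | C \subset A1) moeb F C * incl_prob C.
  transitivity (esp pr (fun S => \sum_(C : {set T} | C \subset A1) moeb F C * (C \subset S)%:R)).
    by congr esp; apply/funext => S; exact: local_expand.
  by rewrite esp_sum; apply: eq_bigr => C _; rewrite espZ.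
have EG : esp pr G = \sum_(C : {set T} | C \subset A2) moeb G C * incl_prob C.
  transitivity (esp pr (fun S => \sum_(C : {set T} | C \subset A2) moeb G C * (C \subset S)%:R)).
    by congr esp; apply/funext => S; exact: local_expand.
  by rewrite esp_sum; apply: eq_bigr => C _; rewrite espZ.
have EFG : esp pr (fun S => F S * G S) =
    \sum_(C : {set T} | C \subset A1) \sum_(C' : {set T} | C' \subset A2)
      moeb F C * moeb G C' * incl_prob (C :|: C').
  transitivity (esp pr (fun S => \sum_(C : {set T} | C \subset A1)
      \sum_(C' : {set T} | C' \subset A2) moeb F C * moeb G C' * (C :|: C' \subset S)%:R)).
    congr esp; apply/funext => S; rewrite {1}(local_expand S FA) {1}(local_expand S GA).
    rewrite mulr_suml; apply: eq_bigr => C _; rewrite mulr_sumr.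
    by apply: eq_bigr => C' _; rewrite mulrACA subUset -mulnb natrM.
  rewrite esp_sum; apply: eq_bigr => C _; rewrite esp_sum.
  by apply: eq_bigr => C' _; rewrite espZ.
rewrite EFG EF EG mulr_suml -sumrB; apply: le_trans (ler_norm_sum _ _ _) _.
have card2 A : #|[pred C : {set T} | C \subset A]|%:R = 2 ^+ #|A| :> R.
  rewrite -natrX -card_powerset; congr (_%:R); apply: eq_card => C.
  by rewrite !inE.
apply: (@le_trans _ _ (\sum_(C : {set T} | C \subset A1)
    \sum_(C' : {set T} | C' \subset A2) (2 ^+ #|A1| * M1) * (2 ^+ #|A2| * M2) * delta)).
  apply: ler_sum => C CA; rewrite mulr_sumr -sumrB.
  apply: le_trans (ler_norm_sum _ _ _) _; apply: ler_sum => C' CA'.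
  rewrite mulrACA -mulrBr !normrM; apply: ler_pM => //; last exact: H.
  apply: ler_pM => //.
    apply: le_trans (norm_moeb (fun D _ => FM D)) _; rewrite ler_wpM2r//.
    by rewrite ler_weXn2l ?ler1n// subset_leq_card.
  apply: le_trans (norm_moeb (fun D _ => GM D)) _; rewrite ler_wpM2r//.
  by rewrite ler_weXn2l ?ler1n// subset_leq_card.
rewrite !sumr_const -[X in X *+ _ <= _]mulr_natr -[leLHS]mulr_natr !card2.
rewrite exprD (_ : 4 = 2 * 2 :> R); last by rewrite -natrM.
by rewrite !exprMn le_eqVlt; apply/orP; left; apply/eqP; ring.
Qed.

End random_subset.

Section metric.
Import mathcomp.boot.fintype mathcomp.boot.finset.
Variables (T : finType) (dist : T -> T -> nat).

Definition dball x r : {set T} := [set y | (dist x y <= r)%N].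

(* k annuli around x cannot all meet the k points of B, one of which lies
   outside all of them. *)
Lemma empty_annulus (B : {set T}) x y k L : (#|B| <= k)%N -> y \in B ->
  (k * L < dist x y)%N -> exists2 i, (i < k)%N &
  forall z, z \in B -> (dist x z <= i * L)%N || (i.+1 * L < dist x z)%N.
Proof.
move=> Bk yB dxy; apply: contrapT => H.
have /choice[f fP] : forall i : 'I_k, exists z,
    z \in B /\ (i * L < dist x z <= i.+1 * L)%N.
  move=> i; apply: contrapT => Hi; apply: H; exists i => // z zB.
  apply: contrapT => Hz; apply: Hi; exists z; split => //.
  by move/negP: Hz; rewrite negb_or -ltnNge -leqNgt.
have lef (i j : 'I_k) : f i = f j -> (i <= j)%N.
  move=> fij; have [_ /andP[a _]] := fP i; have [_ /andP[_ b]] := fP j.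
  have := leq_ltn_trans (leqnn _) (leq_trans a _); rewrite fij => /(_ _ b).
  by rewrite ltn_mul2r ltnS => /andP[].
have finj : injective f.
  by move=> i j fij; apply/val_inj/eqP; rewrite eqn_leq !lef.
have sub : y |: (f @: [set: 'I_k]) \subset B.
  rewrite subUset sub1set yB; apply/subsetP => z /imsetP[i _ ->].
  by have [] := fP i.
have := subset_leq_card sub; rewrite cardsU1 card_imset// cardsT card_ord.
have -> : y \notin f @: [set: 'I_k].
  apply/imsetP => -[i _ yi]; have [_ /andP[_]] := fP i; rewrite -yi => b.
  have := leq_trans dxy b; rewrite ltn_mul2r => /andP[_].
  by rewrite ltnNge ltn_ord.
by rewrite add1n => /leq_trans /(_ Bk); rewrite ltnn.
Qed.

End metric.

(** * Cumulant bound for sums of local scores *)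

Section local_sums.
Import mathcomp.boot.fintype mathcomp.boot.finset.
Variable R : realType.

Definition local_sum (T : finType) (xi : T -> {set T} -> R) (C : {set T})
  (S : {set T}) : R := \sum_(x in C) xi x S.

Lemma set_poly_local_sum_cumulant (T : finType) (pr : {set T} -> R) xi k :
  set_poly k.+1 (fun C => logd (nmom pr (local_sum xi C)) k).
Proof.
have Hm j : set_poly j (fun C => nmom pr (local_sum xi C) j).
  have : set_poly j (fun C => \sum_S (j`!%:R^-1 * pr S) * local_sum xi C S ^+ j).
    apply: set_poly_sum => S _; apply: set_polyZ; apply: set_polyX.
    have : set_poly 1 (fun C : {set T} => \sum_x xi x S * ([set x] \subset C)%:R).
      apply: set_poly_sum => x _; apply: set_polyZ; apply: set_poly_indic.
      by rewrite cards1.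
    apply: set_poly_ext => C; rewrite /local_sum [RHS]big_mkcond/=.
    apply: eq_bigr => x _; rewrite sub1set.
    by case: ifP => _; rewrite ?mulr1 ?mulr0.
  apply: set_poly_ext => C; rewrite /nmom /esp mulr_suml.
  by apply: eq_bigr => S _; rewrite mulrC mulrA mulrC mulrA mulrAC.
elim/ltn_ind: k => k IH.
have Hs : set_poly k.+1 (fun C => \sum_(i < k)
    (logd (nmom pr (local_sum xi C)) i * nmom pr (local_sum xi C) (k - i)%N)).
  apply: set_poly_sum => i _; have := set_polyM (IH i (ltn_ord i)) (Hm (k - i)%N).
  by rewrite addSn subnKC// ltnW.
apply: set_poly_ext (set_polyD (set_polyZ k.+1%:R (Hm k.+1)) (set_polyZ (-1) Hs)) => C.
by rewrite [RHS]logd_rec mulN1r.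
Qed.

(** Moebius coefficients on at most k + 1 sites only involve sums of at most k + 1 scores, hence a
    bound in terms of (k + 1) A whatever the size of T. This crude bound is used for the sets inside
    a ball of radius (k + 1) L, counted by |T| V^(k+1). Any wider set is split by an empty annulus
    of width L, and its coefficient carries the factor delta. The shift by [l.*2] accounts for the
    sites on which the scores depend. *)
Lemma local_sum_cumulant_bound k : exists2 c : R, 0 <= c &
  forall (T : finType) (dist : T -> T -> nat) (pr : {set T} -> R)
    (xi : T -> {set T} -> R) (A delta : R) (l L v V : nat),
  (forall x, dist x x = 0%N) -> (forall x y, dist x y = dist y x) ->
  (forall x y z, dist x z <= dist x y + dist y z)%N ->
  fprob pr -> 1 <= A -> 0 <= delta ->
  (forall x S, `|xi x S| <= A) ->
  (forall x S, xi x S = xi x (S :&: dball dist x l)) ->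
  (forall x, #|dball dist x l| <= v)%N ->
  (forall x, #|dball dist x (k.+1 * L)| <= V)%N ->
  (forall C1 C2 : {set T}, (0 < #|C1|)%N -> (0 < #|C2|)%N ->
     (#|C1| + #|C2| <= k.+1 * v)%N ->
     (forall x y, x \in C1 -> y \in C2 -> (L < dist x y + l.*2)%N) ->
     `|incl_prob pr (C1 :|: C2) - incl_prob pr C1 * incl_prob pr C2| <= delta) ->
  `|logd (nmom pr (local_sum xi [set: T])) k| <=
     c * A ^+ (2 * k.+1) * (#|T|%:R * V%:R ^+ k.+1 +
       #|T|%:R ^+ k.+1 * 4 ^+ (k.+1 * v) * delta).
Proof.
have [c1 c10 H1] := @logd_lipschitz R k.
have [c2 c20 H2] := @cumulant_near_additive R k.
pose K : R := k.+1%:R.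
exists ((c1 + c2) * 2 ^+ k.+1 * K ^+ (2 * k.+1)).
  by rewrite !mulr_ge0 ?exprn_ge0 ?addr_ge0.
move=> T dist pr xi A delta l L v V dxx dC dtri prP A1 d0 xiA xil bv bV corr.
set g := fun C : {set T} => logd (nmom pr (local_sum xi C)) k.
have gT : set_poly k.+1 g := set_poly_local_sum_cumulant pr xi k.
have g0 : g set0 = 0.
  rewrite /g (_ : nmom pr _ = fun j => 0 ^+ j / j`!%:R); last first.
    apply/funext => j; rewrite -(nmom_cst prP) /nmom; congr (esp _ _ / _).
    by apply/funext => S; rewrite /local_sum big_set0.
  by rewrite logd_exp; case: eqP.
have K1 : 1 <= K by rewrite ler1n.
have A0 : 0 <= A by exact: le_trans A1.
pose B := K * A.
have B1 : 1 <= B by rewrite mulr_ege1.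
have B0 : 0 <= B by exact: le_trans B1.
have sumB (C S : {set T}) : (#|C| <= k.+1)%N -> `|local_sum xi C S| <= B.
  move=> Ck; apply: le_trans (ler_norm_sum _ _ _) _.
  apply: (@le_trans _ _ (\sum_(x in C) A)); first by apply: ler_sum.
  by rewrite sumr_const -[leLHS]mulr_natl ler_wpM2r// ler_nat.
have gB (C : {set T}) : (#|C| <= k.+1)%N -> `|g C| <= c1 * B ^+ k.+1.
  move=> Ck; have bd j : (j <= k.+1)%N -> `|nmom pr (local_sum xi C) j| <= B ^+ j.
    by move=> _; apply: nmom_bound => // S; exact: sumB.
  have [] := H1 B 0 (nmom pr (local_sum xi C)) (nmom pr (local_sum xi C)) B0 (lexx 0) bd bd.
    by move=> j _; rewrite subrr normr0 mul0r.
  by [].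
pose eps := 4 ^+ (k.+1 * v) * B ^+ k.+1 * delta.
have eps0 : 0 <= eps by rewrite !mulr_ge0 ?exprn_ge0.
have near_add (C1 C2 : {set T}) : (#|C1| + #|C2| <= k.+1)%N -> fintype.disjoint (mem C1) (mem C2) ->
   (forall x y, x \in C1 -> y \in C2 -> (L < dist x y)%N) ->
   `|g (C1 :|: C2) - (g C1 + g C2)| <= c2 * eps * B ^+ k.+1.
  move=> Ck dis far.
  have -> : g (C1 :|: C2) = logd (nmom pr (fun S => local_sum xi C1 S + local_sum xi C2 S)) k.
    congr (logd (nmom pr _) k); apply/funext => S.
    rewrite /local_sum (big_setID C1)/=; congr (_ + _).
      by apply: eq_bigl => x; rewrite !inE; case: (x \in C1); rewrite ?andbF.
    apply: eq_bigl => x; rewrite !inE; case: (boolP (x \in C1)) => //= xC1.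
    by rewrite (disjointFr dis xC1).
  rewrite /g; apply: H2 => //.
  - by move=> S; apply: sumB; apply: leq_trans Ck; exact: leq_addr.
  - by move=> S; apply: sumB; apply: leq_trans Ck; exact: leq_addl.
  move=> i j ij.
  pose N (C : {set T}) := \bigcup_(x in C) dball dist x l.
  have NP (C S : {set T}) n : local_sum xi C S ^+ n = local_sum xi C (S :&: N C) ^+ n.
    congr (_ ^+ n); apply: eq_bigr => x xC; rewrite xil [RHS]xil -setIA.
    congr (xi x (_ :&: _)); apply/esym/setIidPr; exact: bigcup_sup xC.
  have NC (C : {set T}) : (#|N C| <= #|C| * v)%N.
    rewrite -sum_nat_const /N; elim/big_ind2: _ => [|D m D' m' Dm D'm'|x _] //.
      by rewrite cards0.
    by apply: leq_trans (leq_card_setU _ _) _; exact: leq_add.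
  have bX (C : {set T}) n : (#|C| <= k.+1)%N -> forall S, `|local_sum xi C S ^+ n| <= B ^+ n.
    by move=> Cn S; rewrite normrX lerXn2r ?nnegrE// sumB.
  have N12 : (#|N C1| + #|N C2| <= k.+1 * v)%N.
    apply: leq_trans (leq_add (NC _) (NC _)) _.
    by rewrite -mulnDl leq_mul2r Ck orbT.
  have := @cov_le _ _ pr (N C1) (N C2) (fun S => local_sum xi C1 S ^+ i)
    (fun S => local_sum xi C2 S ^+ j) (B ^+ i) (B ^+ j) delta.
  move=> cov; apply: le_trans (cov _ _ _ _ _) _.
  - by move=> S; exact: NP.
  - by apply: bX; apply: leq_trans Ck; exact: leq_addr.
  - by move=> S; exact: NP.
  - by apply: bX; apply: leq_trans Ck; exact: leq_addl.
  - move=> D1 D2 s1 s2.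
    have [->|D10] := eqVneq D1 set0.
      by rewrite set0U incl_prob0// mul1r subrr normr0.
    have [->|D20] := eqVneq D2 set0.
      by rewrite setU0 incl_prob0// mulr1 subrr normr0.
    apply: corr; rewrite ?card_gt0//.
      by apply: leq_trans (leq_add (subset_leq_card s1) (subset_leq_card s2)) N12.
    move=> x y /(subsetP s1)/bigcupP[x' x'C]; rewrite inE => dx.
    move=> /(subsetP s2)/bigcupP[y' y'C]; rewrite inE => dy.
    have f := far x' y' x'C y'C.
    have t1 := dtri x' x y'; have t2 := dtri x y y'; rewrite (dC y y') in t2.
    by rewrite -addnn; clear -f dx dy t1 t2; lia.
  rewrite /eps ler_wpM2r//; apply: ler_pM.
  - by rewrite exprn_ge0.
  - by rewrite mulr_ge0// exprn_ge0.
  - by rewrite ler_weXn2l// ler1n.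
  - by rewrite -exprD ler_weXn2l.
have moebM (C : {set T}) : (#|C| <= k.+1)%N -> `|moeb g C| <= 2 ^+ k.+1 * (c1 * B ^+ k.+1).
  move=> Ck; apply: le_trans (norm_moeb (M := c1 * B ^+ k.+1) _) _.
    move=> D DC; apply: gB; exact: leq_trans (subset_leq_card DC) Ck.
  by rewrite ler_wpM2r ?mulr_ge0 ?exprn_ge0// ler_weXn2l// ler1n.
have moebe (C : {set T}) x y : (#|C| <= k.+1)%N -> x \in C -> y \in C ->
   (k.+1 * L < dist x y)%N -> `|moeb g C| <= 2 ^+ k.+1 * (c2 * eps * B ^+ k.+1).
  move=> Ck xC yC xy; have [i ik gap] := empty_annulus Ck yC xy.
  pose C1 := [set z in C | (dist x z <= i * L)%N].
  have xC1 : x \in C1 by rewrite inE xC dxx.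
  have yC1 : y \notin C1.
    rewrite inE yC /= -ltnNge; apply: leq_ltn_trans xy.
    by rewrite leq_mul2r ltnW ?orbT.
  have farC u w : u \in C1 -> w \in C :\: C1 -> (L < dist u w)%N.
    rewrite !inE => /andP[uC du] /andP[]; move=> + wC; rewrite wC /= => nw.
    have := gap w wC; rewrite (negPf nw) /= mulSn => dw.
    by have tr := dtri x u w; clear -tr dw du; lia.
  (* The cumulants over D intersected with C1 and over D minus C1 ignore y and x respectively, so
     their coefficients on C vanish and g may be replaced by its defect of additivity across the
     annulus. *)
  have -> : moeb g C = moeb (fun D => g D - (g (D :&: C1) + g (D :\: C1))) C.
    have z1 : moeb (fun D => g (D :&: C1)) C = 0.
      apply: (moeb_toggle yC) => D _; congr g; apply/setP => z.
      by rewrite !in_setI in_setU1; case: eqP => // ->; rewrite (negPf yC1) !andbF.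
    have z2 : moeb (fun D => g (D :\: C1)) C = 0.
      apply: (moeb_toggle xC) => D _; congr g; apply/setP => z.
      by rewrite !in_setD in_setU1; case: eqP => // ->; rewrite xC1.
    rewrite [RHS](_ : _ = moeb (fun D => g D + -1 * (g (D :&: C1) + g (D :\: C1))) C).
      by rewrite moebD moebZ moebD z1 z2 addr0 mulr0 addr0.
    by congr moeb; apply/funext => D; rewrite mulN1r.
  apply: le_trans (norm_moeb (M := c2 * eps * B ^+ k.+1) _) _; last first.
    by rewrite ler_wpM2r ?mulr_ge0 ?exprn_ge0// ler_weXn2l// ler1n.
  move=> D DC; rewrite -{1}(setID D C1); apply: near_add.
  - by rewrite cardsID (leq_trans (subset_leq_card DC)).
  - by rewrite disjoints_subset; apply/subsetP => z; rewrite !inE => /andP[_ /andP[-> ->]].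
  - move=> u w /setIP[_ uC1] /setDP[wD wC1]; apply: farC => //.
    by rewrite inE wC1 (subsetP DC).
pose M := 2 ^+ k.+1 * (c1 * B ^+ k.+1).
pose E := 2 ^+ k.+1 * (c2 * eps * B ^+ k.+1).
have M0 : 0 <= M by rewrite !mulr_ge0 ?exprn_ge0.
have E0 : 0 <= E by rewrite !mulr_ge0 ?exprn_ge0.
have step : `|g [set: T]| <= #|T|%:R * V%:R ^+ k.+1 * M + #|T|%:R ^+ k.+1 * E.
  apply: le_trans (set_poly_le_sum gT g0) _.
  (* A map with values in the ball around its value at 0 is charged M at that centre, any other map
     is charged E; summing over all centres only enlarges the bound. *)
  apply: (@le_trans _ _ (\sum_(h : {ffun 'I_k.+1 -> T})
     (\sum_x (h \in ffun_on (mem (dball dist x (k.+1 * L))))%:R * M + E))).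
    apply: ler_sum => h _.
    have hk : (#|[set h i | i : 'I_k.+1]| <= k.+1)%N.
      by apply: leq_trans (leq_imset_card _ _) _; rewrite card_ord.
    have hin i : h i \in [set h i | i : 'I_k.+1] by apply: imset_f.
    have S0 : 0 <= \sum_(x : T | x != h ord0) (h \in ffun_on (mem (dball dist x (k.+1 * L))))%:R * M.
      by apply: sumr_ge0 => x _; rewrite mulr_ge0.
    rewrite (bigD1 (h ord0))//=.
    have [hb|] := boolP (h \in ffun_on _).
      rewrite mul1r -addrA; apply: le_trans (moebM _ hk) _.
      by rewrite lerDl addr_ge0.
    move=> /ffun_onP hb; rewrite mul0r add0r.
    have [i hi] : exists i, (k.+1 * L < dist (h ord0) (h i))%N.
      apply: contrapT => H; apply: hb => i; rewrite inE leqNgt.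
      by apply/negP => hi; apply: H; exists i.
    apply: le_trans (moebe _ _ _ hk (hin ord0) (hin i) hi) _.
    by rewrite lerDr.
  rewrite big_split/=; apply: lerD; last first.
    rewrite sumr_const -[leLHS]mulr_natl ler_wpM2r//.
    by rewrite card_ffun card_ord natrX.
  rewrite exchange_big/=.
  apply: (@le_trans _ _ (\sum_(x : T) V%:R ^+ k.+1 * M)); last first.
    by rewrite sumr_const -[leLHS]mulr_natl mulrA cardE.
  apply: ler_sum => x _; rewrite -mulr_suml ler_wpM2r//.
  rewrite -natr_sum -natrX ler_nat.
  rewrite (_ : (\sum_(h : {ffun 'I_k.+1 -> T}) _)%N =
     #|ffun_on (mem (dball dist x (k.+1 * L))) : pred {ffun 'I_k.+1 -> T}|); last first.
    by rewrite -sum1_card [RHS]big_mkcond/=; apply: eq_bigr => h _; case: (h \in _).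
  rewrite card_ffun_on card_ord leq_exp2r//; exact: bV.
apply: le_trans step _.
have EE : E = 2 ^+ k.+1 * c2 * K ^+ (2 * k.+1) * (A ^+ (2 * k.+1) * (4 ^+ (k.+1 * v) * delta)).
  by rewrite /E /eps /B mul2n -addnn !exprD !exprMn; ring.
have ME : M <= 2 ^+ k.+1 * c1 * K ^+ (2 * k.+1) * A ^+ (2 * k.+1).
  rewrite /M mulrA -[leRHS]mulrA -exprMn ler_wpM2l ?mulr_ge0 ?exprn_ge0//.
  by rewrite ler_weXn2l// mul2n -addnn leq_addl.
set a := _ * A ^+ _; set b := _ * _ ^+ k.+1; set b' := _ ^+ k.+1.
have b0 : 0 <= b by rewrite mulr_ge0 ?exprn_ge0.
have b'0 : 0 <= b' by rewrite exprn_ge0.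
have AK0 : 0 <= K ^+ (2 * k.+1) * A ^+ (2 * k.+1) by rewrite mulr_ge0 ?exprn_ge0// (le_trans _ K1).
have two0 : 0 <= 2 ^+ k.+1 :> R by rewrite exprn_ge0.
apply: (@le_trans _ _ (b * (2 ^+ k.+1 * c1 * K ^+ (2 * k.+1) * A ^+ (2 * k.+1)) + b' * E)).
  by rewrite lerD2r ler_wpM2l.
rewrite EE mulrDr; apply: lerD.
  rewrite /a.
  have -> : (c1 + c2) * 2 ^+ k.+1 * K ^+ (2 * k.+1) * A ^+ (2 * k.+1) * b =
    b * (2 ^+ k.+1 * c1 * K ^+ (2 * k.+1) * A ^+ (2 * k.+1)) +
    c2 * (2 ^+ k.+1 * (K ^+ (2 * k.+1) * A ^+ (2 * k.+1)) * b) by ring.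
  by rewrite lerDl mulr_ge0// mulr_ge0// mulr_ge0.
rewrite /a.
have -> : (c1 + c2) * 2 ^+ k.+1 * K ^+ (2 * k.+1) * A ^+ (2 * k.+1) *
   (b' * 4 ^+ (k.+1 * v) * delta) =
   b' * (2 ^+ k.+1 * c2 * K ^+ (2 * k.+1) * (A ^+ (2 * k.+1) * (4 ^+ (k.+1 * v) * delta))) +
   c1 * (2 ^+ k.+1 * (K ^+ (2 * k.+1) * A ^+ (2 * k.+1)) * (b' * (4 ^+ (k.+1 * v) * delta))).
  by ring.
rewrite lerDl mulr_ge0// mulr_ge0//; first by rewrite mulr_ge0.
by rewrite mulr_ge0// mulr_ge0// exprn_ge0.
Qed.

End local_sums.

(** * Windows of the lattice and nearest neighbours *)

Section lattice.
Import mathcomp.boot.fintype mathcomp.boot.finset.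
Variable d : nat.
Local Notation pt := 'rV[int]_d.
Implicit Types (x y z : pt).

Lemma l1norm0 : l1norm (0 : pt) = 0%N.
Proof. by rewrite /l1norm big1// => i _; rewrite mxE. Qed.

Lemma l1normN x : l1norm (- x) = l1norm x.
Proof. by apply: eq_bigr => i _; rewrite mxE abszN. Qed.

Lemma l1normD x y : (l1norm (x + y) <= l1norm x + l1norm y)%N.
Proof.
rewrite /l1norm -big_split/=; apply: leq_sum => i _; rewrite mxE.
move: (x ord0 i) (y ord0 i) => a b. lia.
Qed.

Lemma le_l1norm x i : (`|x ord0 i| <= l1norm x)%N.
Proof. by rewrite /l1norm (bigD1 i)//= leq_addr. Qed.

Definition ldist x y : nat := l1norm (x - y).

Lemma ldistxx x : ldist x x = 0%N.
Proof. by rewrite /ldist subrr l1norm0. Qed.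

Lemma ldistC x y : ldist x y = ldist y x.
Proof. by rewrite /ldist -l1normN opprB. Qed.

Lemma ldist_triangle x y z : (ldist x z <= ldist x y + ldist y z)%N.
Proof.
rewrite /ldist; have -> : x - z = (x - y) + (y - z) by rewrite addrA subrK.
exact: l1normD.
Qed.

(** Coordinates relative to x, shifted by r, embed the ball into a cube with 2r + 1 values per
    coordinate. *)
Lemma card_l1ball (T : finType) (f : T -> pt) (x : pt) r (A : {set T}) :
  injective f -> (forall t, t \in A -> (ldist x (f t) <= r)%N) ->
  (#|A| <= r.*2.+1 ^ d)%N.
Proof.
move=> finj Ar.
pose g (t : T) : {ffun 'I_d -> 'I_r.*2.+1} :=
  [ffun i => inord (absz ((f t - x) ord0 i + r%:Z))].
have ginj : {in A &, injective g}.
  move=> s t sA tA gst; apply: finj.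
  suff : f s - x = f t - x by move/addIr.
  apply/rowP => i; have := congr1 (fun h : {ffun 'I_d -> 'I_r.*2.+1} => nat_of_ord (h i)) gst.
  have bd u : u \in A -> (absz ((f u - x)%R ord0 i) <= r)%N.
    move=> uA; apply: leq_trans (Ar u uA); rewrite ldistC; exact: le_l1norm.
  move: (bd s sA) (bd t tA); rewrite !ffunE.
  move: ((f s - x) ord0 i) ((f t - x) ord0 i) => a b ha hb.
  rewrite !inordK ?ltnS; lia.
rewrite -(card_in_imset ginj); apply: leq_trans (max_card _) _.
by rewrite card_ffun !card_ord.
Qed.

Lemma finite_window n : finite_set (window d n).
Proof.
pose f (g : {ffun 'I_d -> 'I_n.*2.+1}) : pt := \row_i ((g i)%:Z - n%:Z).
apply: (@sub_finite_set _ _ (f @` [set: {ffun 'I_d -> 'I_n.*2.+1}]%classic)); last first.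
  by apply: finite_image; exact: finite_finset.
move=> x; rewrite /window /l1ball /= sub0r l1normN => xn.
exists [ffun i => inord (absz (x ord0 i + n%:Z))] => //.
apply/rowP => i; rewrite mxE ffunE.
have := leq_trans (le_l1norm x i) xn; move: (x ord0 i) => a an.
rewrite inordK ?ltnS; lia.
Qed.

Definition site n : finType := fset_sub_type (fset_set (window d n)).

Definition site_pt n (t : site n) : pt := fsval t.

Lemma site_pt_inj n : injective (@site_pt n).
Proof. exact: val_inj. Qed.

Lemma site_ptP n (t : site n) : (l1norm (site_pt t) <= n)%N.
Proof.
have := fsvalP t; rewrite in_fset_set; last exact: finite_window.
by rewrite classical_sets.inE /window /l1ball /= sub0r l1normN.
Qed.

Lemma site_of n x : (l1norm x <= n)%N -> exists t : site n, site_pt t = x.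
Proof.
move=> xn; have xw : x \in fset_set (window d n).
  rewrite in_fset_set; last exact: finite_window.
  by rewrite classical_sets.inE /window /l1ball /= sub0r l1normN.
by exists [` xw]%fset.
Qed.

Lemma window_cardE n : window_card d n = #|site n|.
Proof. by rewrite /window_card cardfE. Qed.

Lemma card_site_le n : (#|site n| <= n.*2.+1 ^ d)%N.
Proof.
rewrite -cardsT; apply: (@card_l1ball _ (@site_pt n) 0) => [|t _].
  exact: site_pt_inj.
by rewrite ldistC /ldist subr0 site_ptP.
Qed.

Definition unit_pt (i : 'I_d) (s : int) : pt := \row_j (if j == i then s else 0).

Lemma l1norm_unit_pt i s : l1norm (unit_pt i s) = absz s.
Proof.
rewrite /l1norm (bigD1 i)//= mxE eqxx big1 ?addn0// => j ji.
by rewrite mxE (negPf ji).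
Qed.

Lemma window_card_ge n : (0 < d)%N -> (n <= window_card d n)%N.
Proof.
move=> d0; rewrite window_cardE.
have /choice[f fP] : forall j : 'I_n, exists t : site n,
    site_pt t = unit_pt (Ordinal d0) j%:Z.
  by move=> j; apply: site_of; rewrite l1norm_unit_pt /= ltnW.
have finj : injective f.
  move=> j k fjk; have := congr1 (@site_pt n) fjk; rewrite !fP.
  move=> /(congr1 (fun v : pt => v ord0 (Ordinal d0))); rewrite !mxE eqxx.
  by case=> /val_inj.
by rewrite -[leqLHS]card_ord -(card_imset _ finj) max_card.
Qed.

(* Near the boundary of the window one may move towards the coordinate
   hyperplane of a coordinate which is not small. *)
Lemma inward_direction n l x : (0 < d)%N -> (d.+1 * l <= n)%N ->
  (l1norm x <= n)%N -> exists (i : 'I_d) (e : int), absz e = 1%N /\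
  forall t : nat, (t <= l)%N -> (l1norm (x + unit_pt i (e * t%:Z))%R <= n)%N.
Proof.
move=> d0 ln xn; have [xl|xl] := leqP (l1norm x) (n - l).
  exists (Ordinal d0), 1; split => // t tl.
  apply: leq_trans (l1normD _ _) _; rewrite l1norm_unit_pt mul1r /=.
  by rewrite mulSn in ln; lia.
(* If all coordinates were smaller than l, the norm would be at most d l <= n - l. *)
have [i xi] : exists i, (l <= absz (x ord0 i))%N.
  apply: contrapT => H.
  have xi i : (absz (x ord0 i) <= l)%N.
    by rewrite leqNgt; apply/negP => h; apply: H; exists i; exact: ltnW.
  have : (l1norm x <= d * l)%N.
    rewrite -[X in (_ <= X * _)%N]card_ord -sum_nat_const; apply: leq_sum => i _.
    exact: xi.
  by rewrite mulSn in ln; lia.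
exists i, (if (0 <= x ord0 i)%R then -1 else 1); split; first by case: ifP.
move=> t tl; apply: leq_trans xn; rewrite /l1norm [leqLHS](bigD1 i)//= [leqRHS](bigD1 i)//=.
apply: leq_add; last first.
  by apply: leq_sum => j ji; rewrite !mxE (negPf ji) addr0.
rewrite !mxE eqxx; move: (x ord0 i) xi => a; case: ifP => a0 al.
  by lia.
by lia.
Qed.

End lattice.

(** * Scores and truncated scores on a finite set of sites *)

Section scores.
Import mathcomp.boot.fintype mathcomp.boot.finset.
Variables (R : realType) (T : finType) (dist : T -> T -> nat).
Implicit Types (S : {set T}) (x y z : T).

Definition nne S x y := [&& x \in S, y \in S &
  [forall z, (z \in S) && (z != x) ==> (dist x y <= dist x z)%N]].

Definition score x S : R := \sum_(y | nne S x y) (dist x y)%:R.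

Definition tscore l x S : R := \sum_(y | nne S x y && (dist x y <= l)%N) (dist x y)%:R.

Definition isolated l x S :=
  (x \in S) && [forall z, (z \in S) && (z != x) ==> (l < dist x z)%N].

Lemma tscore_ge0 l x S : 0 <= tscore l x S.
Proof. by apply: sumr_ge0. Qed.

Lemma tscore_le l x S : tscore l x S <= (#|dball dist x l| * l)%:R.
Proof.
rewrite /tscore -natr_sum ler_nat -sum_nat_const.
rewrite [leqRHS](eq_bigl (fun y => (dist x y <= l)%N)); last by move=> y; rewrite inE.
rewrite [leqLHS]big_mkcond [leqRHS]big_mkcond/=; apply: leq_sum => y _.
by case: (nne S x y) => //=; case: ifP.
Qed.

Lemma score_le D x S : (forall y z, dist y z <= D)%N -> `|score x S| <= (#|T| * D)%:R.
Proof.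
move=> H; rewrite ger0_norm; last by apply: sumr_ge0.
rewrite /score -natr_sum ler_nat -sum_nat_const.
by rewrite [leqLHS]big_mkcond/=; apply: leq_sum => y _; case: ifP.
Qed.

(** Whether a point at distance at most l is a nearest neighbour is decided inside the ball of
    radius l, points outside being farther away. *)
Lemma tscore_local l x S : dist x x = 0%N ->
  tscore l x S = tscore l x (S :&: dball dist x l).
Proof.
move=> xx; apply: eq_bigl => y; rewrite /nne !inE xx leq0n andbT.
case: (boolP (x \in S)) => //= xS; case: (boolP (dist x y <= l)%N) => yl; last first.
  by rewrite !andbF.
rewrite !andbT; congr (_ && _); apply/forallP/forallP => H z; apply/implyP.
  rewrite !inE => /andP[/andP[zS _] zx].
  by have := H z; rewrite zS zx.
move=> /andP[zS zx]; have := H z; rewrite !inE zS zx /= andbT.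
by case: (leqP (dist x z) l) => //= lz _; apply: leq_trans yl (ltnW lz).
Qed.

Lemma score_tscore l x S : ~~ isolated l x S -> score x S = tscore l x S.
Proof.
rewrite /isolated negb_and negb_forall => /orP[xS|/existsP[z]].
  by rewrite /score /tscore !big_pred0// => y; rewrite /nne (negPf xS).
rewrite negb_imply -leqNgt => /andP[zS zl]; apply: eq_bigl => y.
case: (boolP (nne S x y)) => //= /and3P[_ _ /forallP/(_ z)].
by rewrite zS /= => /leq_trans ->.
Qed.

End scores.

(** * Probability that many separated sites are empty *)

Section void_probability.
Import mathcomp.boot.fintype mathcomp.boot.finset.
Variables (R : realType) (T : finType) (pr : {set T} -> R).
Hypothesis prP : fprob pr.

(** The sites are emptied one after the other: each multiplies the probability by 1 - p, up to a
    covariance of functions of at most m sites in all, bounded by [cov_le]. *)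
Lemma void_probability_le (y : nat -> T) (m : nat) (p delta : R) :
  0 <= p <= 1 -> 0 <= delta ->
  (forall i, (i < m)%N -> incl_prob pr [set y i] = p) ->
  (forall j (C1 C2 : {set T}), (j < m)%N -> C1 \subset [set y (val i) | i : 'I_j] ->
     C2 \subset [set y j] ->
     `|incl_prob pr (C1 :|: C2) - incl_prob pr C1 * incl_prob pr C2| <= delta) ->
  esp pr (fun S => [forall i : 'I_m, y i \notin S]%:R) <=
    (1 - p) ^+ m + m%:R * (4 ^+ m * delta).
Proof.
move=> /andP[p0 p1] d0 yp H.
pose F j (S : {set T}) : R := [forall i : 'I_j, y i \notin S]%:R.
pose G j (S : {set T}) : R := (y j \in S)%:R.
suff: forall j, (j <= m)%N -> esp pr (F j) <= (1 - p) ^+ j + j%:R * (4 ^+ m * delta).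
  exact.
have q0 : 0 <= 1 - p by rewrite subr_ge0.
have e0 : 0 <= 4 ^+ m * delta by rewrite mulr_ge0 ?exprn_ge0.
elim=> [_|j IH jm].
  rewrite expr0 mul0r addr0 (_ : F 0%N = fun=> 1) ?esp_cst//.
  by apply/funext => S; rewrite /F (_ : [forall i, _] = true)//; apply/forallP => -[].
have FS : F j.+1 = fun S => F j S - F j S * G j S.
  apply/funext => S; rewrite /F /G.
  have -> : [forall i : 'I_j.+1, y i \notin S] = [forall i : 'I_j, y i \notin S] && (y j \notin S).
    apply/forallP/andP => [h|[/forallP h hj] i].
      split; last exact: (h ord_max).
      by apply/forallP => i; exact: (h (widen_ord (leqnSn j) i)).
    have [ij|ji] := ltnP i j; first exact: (h (Ordinal ij)).
    by have -> : nat_of_ord i = j by apply/eqP; rewrite eqn_leq ji -ltnS ltn_ord.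
  case: [forall i, _] => /=; rewrite ?mul0r ?subr0// mul1r.
  by case: (y j \in S) => /=; rewrite ?subrr ?subr0.
have EG : esp pr (G j) = p.
  rewrite -(yp j jm); congr esp; apply/funext => S; rewrite /G.
  by rewrite sub1set.
pose Yj := [set y (val i) | i : 'I_j].
have cov : `|esp pr (fun S => F j S * G j S) - esp pr (F j) * esp pr (G j)|
    <= 4 ^+ (#|Yj| + #|[set y j]|) * (1 * 1) * delta.
  apply: cov_le.
  - move=> S; rewrite /F; congr (nat_of_bool _)%:R; apply: eq_forallb => i.
    by rewrite inE (_ : y i \in Yj) ?andbT//; apply/imsetP; exists i.
  - by move=> S; rewrite normr_nat lern1 leq_b1.
  - by move=> S; rewrite /G !inE eqxx andbT.
  - by move=> S; rewrite normr_nat lern1 leq_b1.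
  - by move=> C1 C2; exact: H.
have {}cov : `|esp pr (fun S => F j S * G j S) - esp pr (F j) * p| <= 4 ^+ m * delta.
  rewrite -EG; apply: le_trans cov _; rewrite !mulr1 ler_wpM2r// ler_weXn2l ?ler1n//.
  rewrite cards1 addn1; apply: leq_ltn_trans jm.
  by apply: leq_trans (leq_imset_card _ _) _; rewrite card_ord.
have h := IH (ltnW jm).
rewrite FS espB.
move: cov; rewrite ler_norml => /andP[cov _].
have : esp pr (F j) * (1 - p) <= ((1 - p) ^+ j + j%:R * (4 ^+ m * delta)) * (1 - p).
  by rewrite ler_wpM2r.
have : j%:R * (4 ^+ m * delta) * (1 - p) <= j%:R * (4 ^+ m * delta).
  by rewrite ler_piMr ?mulr_ge0//; lra.
rewrite exprSr -[j.+1%:R]natr1.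
move: cov; move: (esp pr (F j)) (esp pr (fun S => F j S * G j S)).
move: ((1 - p) ^+ j) (4 ^+ m * delta) (j%:R : R) => q e J a b; lra.
Qed.

End void_probability.

(** * Identification with the scores on the lattice *)

Section nearest_neighbours.
Import mathcomp.boot.fintype mathcomp.boot.finset.
Variables (R : realType) (d n : nat).
Local Notation T := (site d n).

Definition sdist (s t : T) : nat := ldist (site_pt s) (site_pt t).

Definition conf (S : {set T}) : set 'rV[int]_d := [set site_pt t | t in [set t | t \in S]%classic]%classic.

Lemma confE (S : {set T}) t : conf S (site_pt t) = (t \in S) :> Prop.
Proof.
apply/propext; split => [[s sS /site_pt_inj <-]|tS]//.
by exists t.
Qed.

Lemma is_NNE_conf (S : {set T}) (x y : T) :
  is_NNE (conf S) (site_pt x) (site_pt y) <-> nne sdist S x y.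
Proof.
rewrite /is_NNE !confE; split.
  move=> [xS yS H]; apply/and3P; split => //; apply/forallP => z.
  apply/implyP => /andP[zS zx]; rewrite leqNgt; apply/negP => lt.
  have := H _ lt; rewrite seteqP => -[/(_ (site_pt z)) + _].
  rewrite /l1ball /= confE => /(_ (conj zS (leqnn _))) /site_pt_inj zx'.
  by rewrite zx' eqxx in zx.
move=> /and3P[xS yS /forallP H]; split => // r rxy; apply/seteqP; split => z /=.
  rewrite /l1ball /= => -[[t tS <-] rt].
  have [->//|tx] := eqVneq t x; have := H t; rewrite tS tx /= => h.
  by have := leq_trans h rt; rewrite leqNgt rxy.
by move=> ->; rewrite confE; split => //; rewrite /l1ball /= subrr l1norm0.
Qed.

Let fsum_sites (P : pred T) (A : set 'rV[int]_d) (F : 'rV[int]_d -> R) :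
  (forall z, A z <-> exists2 t, P t & site_pt t = z) ->
  (\sum_(z \in A) F z = \sum_(t | P t) F (site_pt t))%R.
Proof.
move=> AP; rewrite -[RHS]big_filter -(big_map (@site_pt d n) xpredT F).
rewrite [RHS]fsbig_seq; last first.
  by rewrite map_inj_uniq ?filter_uniq ?index_enum_uniq//; exact: site_pt_inj.
apply: eq_fsbigl; apply/seteqP; split => z /=.
  move=> /AP[t Pt <-]; apply: map_f; rewrite mem_filter Pt.
  exact: mem_index_enum.
by move=> /mapP[t]; rewrite mem_filter => /andP[Pt _] ->; apply/AP; exists t.
Qed.

Lemma xi_NN_conf (S : {set T}) (x : T) :
  xi_NN R (site_pt x) (conf S) = score R sdist x S.
Proof.
rewrite /xi_NN (@fsum_sites (fun y => nne sdist S x y)) /score//.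
move=> z /=; split; last by move=> [y xy <-]; exact/is_NNE_conf.
move=> xz; have [_ [y yS yz] _] := xz; rewrite -yz in xz *.
by exists y => //; exact/is_NNE_conf.
Qed.

Lemma sum_xi_NN_conf (S : {set T}) :
  (\sum_(x \in conf S) xi_NN R x (conf S))%R = local_sum (score R sdist) [set: T] S.
Proof.
rewrite (@fsum_sites (fun x => x \in S)); last first.
  by move=> z; split => [[t tS <-]|[t tS <-]]; exists t.
rewrite /local_sum [LHS]big_mkcond/=; apply: eq_big => [x|x _]; first by rewrite inE.
case: ifP => xS; first exact: xi_NN_conf.
by rewrite /score big_pred0// => y; rewrite /nne xS.
Qed.

End nearest_neighbours.

(** * The spin model in a window *)

Section trace.
Variables (R : realType) (disp : measure_display) (Om : measurableType disp).
Variables (Pr : probability Om R) (d : nat) (X : {RV Pr >-> configuration d}).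

Lemma measurable_point (x : 'rV[int]_d) : measurable [set w | (X w : set 'rV[int]_d) x].
Proof.
have mX : measurable_fun setT X by [].
have := mX measurableT [set mu | (mu : set 'rV[int]_d) x]; rewrite setTI; apply.
by apply: sub_sigma_algebra; exists x.
Qed.

Variable n : nat.

Definition trace (w : Om) : {set site d n} := [set t | `[< (X w : set 'rV[int]_d) (site_pt t) >]]%SET.

Lemma traceE w t : (t \in trace w) = `[< (X w : set 'rV[int]_d) (site_pt t) >].
Proof. by rewrite finset.inE. Qed.

Lemma measurable_trace S : measurable [set w | trace w = S].
Proof.
have -> : [set w | trace w = S] = \bigcap_(t in [set: site d n])
    [set w | (t \in trace w) = (t \in S)].
  apply/seteqP; split => [w /= wS t _ /=|w H]; first by rewrite wS.
  by apply/setP => t; exact: (H t).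
apply: fin_bigcap_measurable => [|t _]; first exact: finite_finset.
case: (t \in S).
  rewrite (_ : mkset _ = [set w | (X w : set 'rV[int]_d) (site_pt t)]).
    exact: measurable_point.
  by apply/seteqP; split => w /=; rewrite traceE => /asboolP.
rewrite (_ : mkset _ = ~` [set w | (X w : set 'rV[int]_d) (site_pt t)]).
  by apply: measurableC; exact: measurable_point.
apply/seteqP; split => w /=; rewrite traceE; first by move=> /negbT/asboolPn.
by move=> /asboolPn/negbTE.
Qed.

Definition trace_prob (S : {set site d n}) : R := fine (Pr [set w | trace w = S]).

Let trace_probE S : (trace_prob S)%:E = Pr [set w | trace w = S].
Proof. by rewrite /trace_prob fineK// fin_num_measure//; exact: measurable_trace. Qed.

Lemma expectation_trace (F : {set site d n} -> R) :
  ('E_Pr[fun w => F (trace w)] = (esp trace_prob F)%:E)%E.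
Proof.
rewrite unlock.
have H (r : seq {set site d n}) :
    Pr.-integrable setT (EFin \o (fun w => \sum_(S <- r) F S * \1_[set w | trace w = S] w)) /\
    (\int[Pr]_w (\sum_(S <- r) F S * \1_[set w | trace w = S] w)%:E =
     (\sum_(S <- r) F S * trace_prob S)%:E)%E.
  elim: r => [|S r [Ir IE]].
    split.
      rewrite (_ : _ \o _ = cst 0%E); first exact: integrable0.
      by apply/funext => w /=; rewrite big_nil.
    under eq_integral do rewrite big_nil.
    by rewrite integral0 big_nil.
  have mS := measurable_trace S.
  have I1 : Pr.-integrable setT (EFin \o \1_[set w | trace w = S]).
    exact: integrable_indic.
  have IS : Pr.-integrable setT (EFin \o (fun w => F S * \1_[set w | trace w = S] w)).
    rewrite (_ : _ \o _ = fun w => ((F S)%:E * (\1_[set w | trace w = S] w)%:E)%E).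
      exact: integrableZl.
    by apply/funext => w /=; rewrite EFinM.
  split.
    rewrite (_ : _ \o _ = (EFin \o (fun w => F S * \1_[set w | trace w = S] w)%R) \+
       (EFin \o (fun w => \sum_(S <- r) F S * \1_[set w | trace w = S] w)%R))%E.
      exact: integrableD.
    by apply/funext => w /=; rewrite big_cons EFinD.
  under eq_integral do rewrite big_cons EFinD.
  rewrite integralD_EFin// IE big_cons EFinD; congr (_ + _)%E.
  under eq_integral do rewrite /= EFinM.
  by rewrite integralZl// integral_indic// setIT EFinM trace_probE.
have [_ HE] := H (index_enum {set site d n}).
rewrite /esp; under [in RHS]eq_bigr do rewrite mulrC.
rewrite -HE; apply: eq_integral => w _; congr EFin.
rewrite (bigD1 (trace w))//= indicE mem_set// mulr1 big1 ?addr0// => S Sw.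
rewrite indicE memNset ?mulr0//= => e; by rewrite e eqxx in Sw.
Qed.

Lemma fprob_trace : fprob trace_prob.
Proof.
split; first by move=> S; rewrite /trace_prob fine_ge0.
have := expectation_trace (fun=> 1); rewrite expectation_cst /esp => -[].
by under eq_bigr do rewrite mulr1; move=> <-.
Qed.

Lemma prob_trace (P : pred {set site d n}) :
  Pr [set w | P (trace w)] = (esp trace_prob (fun S => (P S)%:R))%:E.
Proof.
have mP : measurable [set w | P (trace w)].
  have -> : [set w | P (trace w)] = \bigcup_(S in [set S | P S]) [set w | trace w = S].
    apply/seteqP; split => [w /= Pw|w [S /= PS] ->//].
    by exists (trace w).
  by apply: fin_bigcup_measurable => [|S _]; [exact: finite_finset|exact: measurable_trace].
rewrite -expectation_trace -expectation_indic//; congr expectation.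
apply/funext => w; rewrite indicE; congr (nat_of_bool _)%:R.
by apply/idP/idP; rewrite inE.
Qed.

Lemma variance_trace (F : {set site d n} -> R) :
  'V_Pr[fun w => F (trace w)] =
  (esp trace_prob (fun S => (F S - esp trace_prob F) ^+ 2))%:E.
Proof.
rewrite /variance unlock expectation_trace /= -expectation_trace.
by congr expectation; apply/funext => w.
Qed.

Definition NN_sum (S : {set site d n}) : R := local_sum (score R (@sdist d n)) [set: site d n]%SET S.

Lemma H_NN_trace : H_NN X n = fun w => NN_sum (trace w).
Proof.
apply/funext => w; rewrite /H_NN /NN_sum -sum_xi_NN_conf.
suff -> : (X w : set 'rV[int]_d) `&` window d n = conf (trace w) by [].
apply/seteqP; split => z /=.
  move=> [Xz wz]; have [t tz] : exists t : site d n, site_pt t = z.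
    by apply: site_of; move: wz; rewrite /window /l1ball /= sub0r l1normN.
  by rewrite -tz confE traceE; apply/asboolP; rewrite tz.
move=> [t tw <-]; split; first by move: tw => /=; rewrite traceE => /asboolP.
by rewrite /window /l1ball /= sub0r l1normN site_ptP.
Qed.

Lemma incl_prob_trace (C : {set site d n}) :
  (incl_prob trace_prob C)%:E =
  Pr [set w | forall t, t \in C -> (X w : set 'rV[int]_d) (site_pt t)].
Proof.
rewrite /incl_prob -prob_trace; congr (Pr _); apply/seteqP; split => w /=.
  by move=> /fintype.subsetP H t /H; rewrite traceE => /asboolP.
by move=> H; apply/fintype.subsetP => t /H Xt; rewrite traceE; apply/asboolP.
Qed.

Lemma incl_prob1 (t : site d n) : stationary X ->
  incl_prob trace_prob [set t]%SET = fine (Pr [set w | (X w : set 'rV[int]_d) 0]).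
Proof.
move=> st.
have := st (site_pt t) [set mu | (mu : set 'rV[int]_d) (site_pt t)].
have mt : measurable [set mu : configuration d | (mu : set 'rV[int]_d) (site_pt t)].
  by apply: sub_sigma_algebra; exists (site_pt t).
move=> /(_ mt); rewrite /pushforward /= => e.
have -> : [set w | (X w : set 'rV[int]_d) 0] =
    (translate (site_pt t) \o X) @^-1` [set mu | (mu : set 'rV[int]_d) (site_pt t)].
  apply/seteqP; split => w /=; rewrite /translate /=.
    by move=> X0; exists 0 => //; rewrite add0r.
  by move=> [x Xx /eqP]; rewrite -subr_eq0 addrK => /eqP <-.
rewrite e; have := incl_prob_trace [set t]%SET => h.
have -> : X @^-1` [set mu | (mu : set 'rV[int]_d) (site_pt t)] =
   [set w | forall t0, t0 \in [set t]%SET -> (X w : set 'rV[int]_d) (site_pt t0)].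
  apply/seteqP; split => w /= H; first by move=> t0; rewrite finset.inE => /eqP ->.
  by apply: H; rewrite finset.inE.
by rewrite -h.
Qed.

(** A positive separation keeps the two families of points disjoint, so that their concatenation is
    injective. As phi decreases, the separation and c may be replaced by their lower bounds. *)
Lemma incl_prob_corr (C : nat -> R) (c : nat -> R) (phi : R -> R) (c0 : R) s
    (C1 C2 : {set site d n}) :
  clustering_bound X C c phi ->
  (forall k l, (k <= l)%N -> C k <= C l) -> (forall k, 0 < C k) ->
  0 < c0 -> (forall k, c0 <= c k) ->
  (forall s : R, 0 <= s -> 0 <= phi s <= 1) ->
  (forall s t : R, 0 <= s -> s <= t -> phi t <= phi s) ->
  (0 < s)%N -> (0 < #|C1|)%N -> (0 < #|C2|)%N ->
  (forall x y, x \in C1 -> y \in C2 -> (s <= sdist x y)%N) ->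
  `|incl_prob trace_prob (C1 :|: C2)%SET - incl_prob trace_prob C1 * incl_prob trace_prob C2|
    <= C (#|C1| + #|C2|)%N * phi (c0 * s%:R).
Proof.
move=> HX Cm C0 c00 cc phi01 phim s0 n1 n2 sep.
pose x1 (i : 'I_#|C1|) := site_pt (enum_val i).
pose x2 (i : 'I_#|C2|) := site_pt (enum_val i).
pose x (i : 'I_(#|C1| + #|C2|)) := match fintype.split i with inl j => x1 j | inr j => x2 j end.
have xl j : x (lshift _ j) = x1 j by rewrite /x (unsplitK (inl j)).
have xr j : x (rshift _ j) = x2 j by rewrite /x (unsplitK (inr j)).
have xinj : injective x.
  move=> i j; rewrite -(splitK i) -(splitK j).
  case: (fintype.split i) => a; case: (fintype.split j) => b /=; rewrite ?xl ?xr.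
  - by move=> /site_pt_inj/enum_val_inj ->.
  - move=> /site_pt_inj e; have := sep _ _ (enum_valP a) (enum_valP b).
    by rewrite e /sdist ldistxx leqNgt s0.
  - move=> /site_pt_inj e; have := sep _ _ (enum_valP b) (enum_valP a).
    by rewrite e /sdist ldistxx leqNgt s0.
  - by move=> /site_pt_inj/enum_val_inj ->.
have := HX _ _ x n1 n2 xinj.
have ev (D : {set site d n}) : (incl_prob trace_prob D)%:E =
    Pr (contains_event X (fun i : 'I_#|D| => site_pt (enum_val i))).
  rewrite incl_prob_trace; congr (Pr _); apply/seteqP; split => w /= H.
    by move=> i; apply: H; exact: enum_valP.
  by move=> t tD; have := H (enum_rank_in tD t); rewrite enum_rankK_in.
have -> : contains_event X x = [set w | forall t, t \in (C1 :|: C2)%SET ->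
    (X w : set 'rV[int]_d) (site_pt t)].
  apply/seteqP; split => w /= H.
    move=> t; rewrite finset.inE => /orP[tC|tC].
      have := H (lshift _ (enum_rank_in tC t)); rewrite xl /x1 enum_rankK_in//.
    have := H (rshift _ (enum_rank_in tC t)); rewrite xr /x2 enum_rankK_in//.
  move=> i; rewrite -(splitK i); case: (fintype.split i) => j /=; rewrite ?xl ?xr; apply: H.
    by rewrite finset.inE enum_valP.
  by rewrite finset.inE enum_valP orbT.
rewrite -incl_prob_trace.
rewrite (_ : (fun i => x (lshift _ i)) = x1); last by apply/funext => i; rewrite xl.
rewrite (_ : (fun i => x (rshift _ i)) = x2); last by apply/funext => i; rewrite xr.
rewrite -(ev C1) -(ev C2) -EFinM -EFinB /= lee_fin => /le_trans; apply.
rewrite ler_wpM2l ?(ltW (C0 _))//; apply: phim; first by rewrite mulr_ge0// ltW.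
have sepx : s%:R <= separation R x.
  apply: lb_le_inf.
    exists (l1norm (x (lshift _ (Ordinal n1)) - x (rshift _ (Ordinal n2))))%:R.
    by exists (Ordinal n1), (Ordinal n2).
  move=> r [i [j ->]]; rewrite ler_nat xl xr.
  by apply: sep; exact: enum_valP.
by apply: ler_pM => //; exact: ltW.
Qed.

End trace.
Arguments trace_prob {R disp Om Pr d} X n S.
Arguments trace {R disp Om Pr d} X n w.
Arguments NN_sum R {d} n S.

(** * Elementary asymptotic estimates *)

Section asymptotics.
Variable R : realType.

(** The negative upper limit gives the decay beyond some t0; up to t0, phi <= 1 suffices once B =
    exp(g t0^b). *)
Lemma stretched_exponential (phi : R -> R) (b : R) : 0 < b ->
  (forall s, 0 <= s -> 0 <= phi s <= 1) ->
  (limf_esup (fun t : R => lne (phi t)%:E / (t `^ b)%:E)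
                      (+oo%R : set_system R) < 0)%E ->
  exists B gamma : R, [/\ 0 < B, 0 < gamma &
    forall t, 0 <= t -> phi t <= B * expR (- (gamma * t `^ b))].
Proof.
move=> b0 phi01; rewrite /limf_esup => /ereal_inf_lt[_ [A FA <-] supA].
have [g g0 Ag] : exists2 g : R, 0 < g & forall t, A t ->
   (lne (phi t)%:E / (t `^ b)%:E <= (- g)%:E)%E.
  have [r sr r0] : exists2 r : R, (ereal_sup [set (lne (phi t)%:E / (t `^ b)%:E)%E | t in A] <= r%:E)%E & r < 0.
    move: supA; case: (ereal_sup _) => [r||]//.
      by rewrite lte_fin => r0; exists r.
    by move=> _; exists (-1) => //; rewrite leNye.
  exists (- r); first by rewrite oppr_gt0.
  by move=> t At; rewrite opprK; apply: le_trans sr; apply: ereal_sup_ubound; exists t.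
have [M [Mr HM]] := FA.
pose t0 := `|M| + 1.
have t00 : 0 < t0 by rewrite ltr_wpDl.
exists (expR (g * t0 `^ b)), g; split => //; first exact: expR_gt0.
move=> t tge0; rewrite -expRD.
have [tt0|t0t] := leP t t0.
  have /andP[_ p1] := phi01 t tge0; apply: le_trans p1 _.
  rewrite -expR0 ler_expR subr_ge0 ler_wpM2l ?(ltW g0)//.
  by apply: ge0_ler_powR; rewrite ?nnegrE// ltW.
have t_gt0 : 0 < t by exact: lt_trans t0t.
have At : A t.
  apply: HM; apply: le_lt_trans (ler_norm M) _; apply: lt_trans t0t.
  by rewrite ltrDl.
apply: (@le_trans _ _ (expR (- (g * t `^ b)))); last first.
  by rewrite ler_expR lerDr mulr_ge0 ?powR_ge0// ltW.
have tb0 : 0 < t `^ b by rewrite powR_gt0.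
have /andP[p0 _] := phi01 t tge0.
move: p0; rewrite le_eqVlt => /predU1P[<-|p0]; first exact: expR_ge0.
have := Ag t At; rewrite lne_EFin ?gt_eqF// inver gt_eqF// -EFinM lee_fin.
rewrite ler_pdivrMr// mulNr => h.
by rewrite -[phi t]lnK ?posrE// ler_expR.
Qed.

(** From k^(ak) <= k^k and k <= e^k. Monotonicity of C covers the first indices. *)
Lemma bigO_expR_sqr (C : nat -> R) (a : R) : 0 <= a < 1 ->
  {homo C : k l / (k <= l)%N >-> k <= l} ->
  C =O_\oo (fun k : nat => k%:R `^ (a * k%:R)) ->
  exists2 A : R, 0 < A & forall k, C k <= A * expR (k%:R ^+ 2).
Proof.
move=> /andP[a0 a1] Cm /eqO_exP[M M0 [N _ HN]].
exists (M + `|C N|); first by rewrite ltr_pwDl.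
have e1 k : 1 <= expR (k%:R ^+ 2 : R) by rewrite -expR0 ler_expR sqr_ge0.
move=> k; rewrite mulrDl; have [kN|Nk] := leqP k N.
  rewrite -[leLHS]add0r; apply: lerD; first by rewrite mulr_ge0 ?expR_ge0// ltW.
  apply: le_trans (Cm _ _ kN) _; apply: le_trans (ler_norm _) _.
  by rewrite ler_peMr.
rewrite -[leLHS]addr0; apply: lerD; last by rewrite mulr_ge0 ?expR_ge0.
apply: le_trans (ler_norm _) _; apply: le_trans (HN k (ltnW Nk)) _.
rewrite ler_wpM2l ?(ltW M0)//.
have k1 : 1 <= k%:R :> R by rewrite ler1n (leq_trans _ Nk).
rewrite ger0_norm ?powR_ge0// (@le_trans _ _ (k%:R `^ k%:R))//.
  by apply: ler_powR => //; rewrite ler_piMl// ltW.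
rewrite powR_mulrn// expr2 expRM_natl lerXn2r ?nnegrE ?expR_ge0//.
by apply: le_trans (expR_ge1Dx _); rewrite lerDr.
Qed.

(** Once gamma u >= 2c, the exponent is at most - gamma u / 2, and one term of the exponential
    series beats u^q. *)
Lemma exp_decay (K c gamma : R) (q W : nat) : 0 <= K -> 0 <= c -> 0 < gamma ->
  \forall u \near \oo,
    K * u%:R ^+ q * expR (c * u%:R ^+ W - gamma * u%:R ^+ W.+1) <= 1.
Proof.
move=> K0 c0 g0.
pose D := K * (q.+1`!%:R / (gamma / 2) ^+ q.+1).
have g2 : 0 < gamma / 2 by rewrite divr_gt0.
have f0 : 0 < q.+1`!%:R :> R by rewrite ltr0n fact_gt0.
have D0 : 0 <= D by rewrite mulr_ge0// divr_ge0 ?exprn_ge0// ltW.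
exists (maxn 1 (maxn (Num.truncn (2 * c / gamma)).+1 (Num.truncn D).+1)) => // u /=.
rewrite !geq_max => /and3P[u1 uc uD].
have u1' : 1 <= u%:R :> R by rewrite ler1n.
have u0 : 0 < u%:R :> R by rewrite ltr0n.
have cu : 2 * c <= gamma * u%:R.
  rewrite [leRHS]mulrC -ler_pdivrMr//; apply: ltW; apply: lt_le_trans (truncnS_gt _) _.
  by rewrite ler_nat.
have Du : D <= u%:R.
  by apply: ltW; apply: lt_le_trans (truncnS_gt _) _; rewrite ler_nat.
have uW : 1 <= u%:R ^+ W :> R by rewrite exprn_ege1.
apply: (@le_trans _ _ (K * u%:R ^+ q * expR (- (gamma / 2 * u%:R)))).
  rewrite ler_wpM2l ?mulr_ge0 ?exprn_ge0// ler_expR exprS.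
  have -> : c * u%:R ^+ W - gamma * (u%:R * u%:R ^+ W) =
     - ((gamma * u%:R - c) * u%:R ^+ W) by ring.
  rewrite lerN2; apply: (@le_trans _ _ (gamma * u%:R - c)); first by lra.
  by rewrite ler_peMr//; have := mulr_gt0 g0 u0; lra.
rewrite expRN ler_pdivrMr ?expR_gt0// mul1r.
have y0 : 0 <= gamma / 2 * u%:R by rewrite mulr_ge0// ltW.
apply: le_trans (_ : _ <= (gamma / 2 * u%:R) ^+ q.+1 / q.+1`!%:R) _; last first.
  by apply: le_trans (expR_ge1Dxn q y0); rewrite lerDr.
rewrite ler_pdivlMr// exprMn [in leRHS]exprS -[in leRHS]exprS.
have -> : K * u%:R ^+ q * q.+1`!%:R = D * (gamma / 2) ^+ q.+1 * u%:R ^+ q.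
  rewrite /D; field.
  by rewrite ?expf_eq0 /= ?gt_eqF//.
rewrite [u%:R ^+ q.+1]exprS mulrA ler_wpM2r ?exprn_ge0//.
by rewrite mulrC ler_wpM2l// exprn_ge0// ltW.
Qed.

Lemma nat_root (Q n : nat) : (0 < n)%N -> (0 < Q)%N ->
  exists u, [/\ (0 < u)%N, (u ^ Q <= n)%N & (n < u.+1 ^ Q)%N].
Proof.
move=> n0 Q0.
have ex : exists u, (u ^ Q <= n)%N by exists 1%N; rewrite exp1n.
have ub u : (u ^ Q <= n)%N -> (u <= n)%N.
  move=> un; case: u un => // u un; apply: leq_trans un.
  by rewrite -[leqLHS]expn1 leq_pexp2l.
case: (ex_maxnP ex ub) => u un umax; exists u; split => //.
  by apply: umax; rewrite exp1n.
by rewrite ltnNge; apply/negP => /umax; rewrite ltnn.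
Qed.

End asymptotics.

(** * Decorrelation, truncation and growth of the cumulants *)

Section spin_model.
Import mathcomp.boot.fintype mathcomp.boot.finset.
Variables (R : realType) (disp : measure_display) (Om : measurableType disp).
Variables (Pr : probability Om R) (d : nat) (X : {RV Pr >-> configuration d}).

(* At separation u^M, with M chosen large in terms of W, the fast decay of phi
   is stronger than exp(- gamma u^W); for [a] points, the constant of the clustering
   bound is at most a multiple of exp(a^2). *)
Definition decorrelated (A0 : R) := forall W : nat, exists (M : nat) (gamma : R),
  0 < gamma /\ forall n u (C1 C2 : {set site d n}) a, (0 < u)%N ->
  (#|C1| + #|C2| <= a)%N ->
  (forall x y, x \in C1 -> y \in C2 -> (u ^ M <= sdist x y)%N) ->
  `|incl_prob (trace_prob X n) (C1 :|: C2) -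
    incl_prob (trace_prob X n) C1 * incl_prob (trace_prob X n) C2| <=
  A0 * expR (a%:R ^+ 2 - gamma * u%:R ^+ W).

Lemma exponentially_clustering_decorrelated : exponentially_clustering X ->
  exists p A0 : R, [/\ 0 < p <= 1, 0 < A0,
    forall n t, incl_prob (trace_prob X n) [set t] = p & decorrelated A0].
Proof.
move=> [st [/andP[nd1 nd2] [C [c [phi [[[C0 Cm] [c0 cm] [phi01 phim _] Hcl] []]]]]]].
move=> [c1 c10 c1c] [a a01 CO] [b b0 Hphi].
have [B [g [B0 g0 HB]]] := stretched_exponential b0 phi01 Hphi.
have [A A0 HA] := bigO_expR_sqr a01 Cm CO.
exists (fine (Pr [set w | (X w : set 'rV[int]_d) 0%R]%classic)), (A * B); split.
- have pf : (Pr [set w | (X w : set 'rV[int]_d) 0%R]%classic \is a fin_num)%E.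
    by rewrite fin_num_measure//; exact: measurable_point.
  apply/andP; split; rewrite -?lte_fin -?lee_fin fineK//.
  exact: ltW.
- exact: mulr_gt0.
- by move=> n t; exact: incl_prob1.
(* This gives M b >= W, so phi at distances of order u^M is at most exp(- gamma u^W) up to a
   factor. *)
move=> W; pose M := (Num.truncn (W%:R / b)).+1.
have WM : W%:R <= M%:R * b by rewrite -ler_pdivrMr// ltW// truncnS_gt.
exists M, (g * c1 `^ b); split; first by rewrite mulr_gt0 ?powR_gt0.
move=> n u C1 C2 k u0 Ck far.
have R0 : 0 <= A * B * expR (k%:R ^+ 2 - g * c1 `^ b * u%:R ^+ W).
  by rewrite mulr_ge0 ?expR_ge0// mulr_ge0// ltW.
have [->|D10] := eqVneq C1 set0.
  by rewrite set0U incl_prob0 ?mul1r ?subrr ?normr0//; exact: fprob_trace.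
have [->|D20] := eqVneq C2 set0.
  by rewrite setU0 incl_prob0 ?mulr1 ?subrr ?normr0//; exact: fprob_trace.
have uM : (0 < u ^ M)%N by rewrite expn_gt0 u0.
rewrite -card_gt0 in D10; rewrite -card_gt0 in D20.
apply: le_trans (incl_prob_corr Hcl Cm C0 c10 c1c phi01 phim uM D10 D20 far) _.
have t0 : 0 <= c1 * (u ^ M)%:R by rewrite mulr_ge0// ltW.
have /andP[ph0 _] := phi01 _ t0.
rewrite expRD mulrACA; apply: ler_pM => //; first exact: ltW.
  apply: le_trans (HA _) _; rewrite ler_wpM2l ?(ltW A0)// ler_expR.
  by rewrite lerXn2r ?nnegrE// ler_nat.
apply: le_trans (HB _ t0) _; rewrite ler_wpM2l ?(ltW B0)// ler_expR lerN2.
rewrite -mulrA ler_wpM2l ?(ltW g0)// powRM ?(ltW c10)// ler_wpM2l ?powR_ge0//.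
rewrite natrX -powR_mulrn// -[in leRHS]powR_mulrn// -powRrM.
by rewrite ler_powR// ler1n.
Qed.

Variables (p A0 : R).
Hypothesis p01 : 0 < p <= 1.
Hypothesis A00 : 0 < A0.
Hypothesis incl1 : forall n t, incl_prob (trace_prob X n) [set t] = p.
Hypothesis dec : decorrelated A0.
Hypothesis d0 : (0 < d)%N.

(** The void bound for u sites; the power 3 of u in the decay exceeds the power 2 from the
    clustering constant. *)
Definition void_bound (gamma : R) (u : nat) : R :=
  (1 - p) ^+ u + u%:R * (4 ^+ u * (A0 * expR (u%:R ^+ 2 - gamma * u%:R ^+ 3))).

(** An inward direction provides u sites of the window at distances u^M, 2 u^M, ..., u^(M+1) from x,
    pairwise at least u^M apart. If x is isolated at scale u^(M+1), all of them are empty. *)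
Lemma isolated_probability : exists (M : nat) (gamma : R), 0 < gamma /\
  forall n u (x : site d n), (0 < u)%N -> (d.+1 * u ^ M.+1 <= n)%N ->
  esp (trace_prob X n) (fun S => (isolated (@sdist d n) (u ^ M.+1) x S)%:R)
    <= void_bound gamma u.
Proof.
have [M [g [g0 H]]] := dec 3; exists M, g; split => // n u x u0 un.
have [i [e [e1 He]]] := inward_direction d0 un (site_ptP x).
have /choice[y yP] : forall j, exists t : site d n, (j < u)%N ->
    site_pt t = site_pt x + unit_pt i (e * (j.+1 * u ^ M)%N%:Z).
  move=> j; have [ju|uj] := ltnP j u; last by exists x.
  have [|t ht] := @site_of d n (site_pt x + unit_pt i (e * (j.+1 * u ^ M)%N%:Z)).
    by apply: He; rewrite expnS leq_mul2r ju orbT.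
  by exists t.
have unitD s t : unit_pt i s - unit_pt i t = unit_pt i (s - t).
  by apply/rowP => j; rewrite !mxE; case: ifP => _; rewrite ?subr0.
have yd j k : (j < u)%N -> (k < u)%N -> sdist (y j) (y k) = (`|j%:Z - k%:Z| * u ^ M)%N.
  move=> ju ku; rewrite /sdist /ldist (yP j ju) (yP k ku) opprD addrACA subrr add0r.
  rewrite unitD l1norm_unit_pt -mulrBr abszM e1 mul1n.
  have -> : (j.+1 * u ^ M)%N%:Z - (k.+1 * u ^ M)%N%:Z = (j%:Z - k%:Z) * (u ^ M)%N%:Z.
    rewrite !PoszM -mulrBl; congr (_ * _); lia.
  by rewrite abszM.
have xd j : (j < u)%N -> sdist x (y j) = (j.+1 * u ^ M)%N.
  move=> ju; rewrite /sdist /ldist (yP j ju) opprD addrA subrr add0r l1normN.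
  by rewrite l1norm_unit_pt abszM e1 mul1n.
have uM : (0 < u ^ M)%N by rewrite expn_gt0 u0.
apply: (@le_trans _ _ (esp (trace_prob X n)
   (fun S => [forall j : 'I_u, y j \notin S]%:R))).
  apply: esp_le; first exact: fprob_trace.
  move=> S; rewrite ler_nat; case: (boolP (isolated _ _ _ _)) => // /andP[xS /forallP iso].
  rewrite (_ : [forall j, _] = true)//; apply/forallP => j; apply/negP => yS.
  have := iso (y j); rewrite yS /= xd// expnS.
  have -> : y j != x.
    apply/eqP => yx; have := xd j (ltn_ord j); rewrite yx /sdist ldistxx.
    by move/eqP; rewrite eq_sym muln_eq0 /= => /eqP uM0; rewrite uM0 in uM.
  by rewrite /= ltn_mul2r uM /= ltnNge ltn_ord.
apply: void_probability_le.
- exact: fprob_trace.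
- by have /andP[/ltW ->] := p01.
- by rewrite mulr_ge0 ?expR_ge0// ltW.
- by move=> j _; exact: incl1.
move=> j C1 C2 ju s1 s2; apply: H => //.
  apply: leq_trans (leq_add (subset_leq_card s1) (subset_leq_card s2)) _.
  rewrite cards1 addn1; apply: leq_ltn_trans ju.
  by apply: leq_trans (leq_imset_card _ _) _; rewrite card_ord.
move=> v w /(subsetP s1)/imsetP[k _ ->] /(subsetP s2); rewrite inE => /eqP ->.
have kj : (val k < j)%N := ltn_ord k.
rewrite (yd _ _ (ltn_trans kj ju) ju) -[leqLHS]mul1n leq_mul2r; apply/orP; right.
by move: (val k) kj => k' kj; lia.
Qed.

Definition NN_trunc n l (S : {set site d n}) : R :=
  local_sum (tscore R (@sdist d n) l) [set: site d n] S.

Lemma sdistxx n (x : site d n) : sdist x x = 0%N.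
Proof. exact: ldistxx. Qed.

Lemma sdist_le n (x y : site d n) : (sdist x y <= n.*2)%N.
Proof.
apply: leq_trans (ldist_triangle _ 0 _) _; rewrite -addnn leq_add//.
  by rewrite /ldist subr0 site_ptP.
by rewrite ldistC /ldist subr0 site_ptP.
Qed.

Lemma card_dball n (x : site d n) r : (#|dball (@sdist d n) x r| <= r.*2.+1 ^ d)%N.
Proof.
apply: (@card_l1ball _ _ (@site_pt d n) (site_pt x)); first exact: site_pt_inj.
by move=> t; rewrite inE.
Qed.

Lemma NN_sum_le n (S : {set site d n}) : `|NN_sum R n S| <= (#|site d n| * (#|site d n| * n.*2))%:R.
Proof.
apply: le_trans (ler_norm_sum _ _ _) _.
apply: (@le_trans _ _ (\sum_(x in [set: site d n]) (#|site d n| * n.*2)%:R)).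
  by apply: ler_sum => x _; apply: score_le; exact: sdist_le.
by rewrite sumr_const cardsT -[leLHS]mulr_natl -natrM.
Qed.

Lemma NN_trunc_le n l (S : {set site d n}) : (l <= n.*2)%N ->
  `|NN_trunc l S| <= (#|site d n| * (#|site d n| * n.*2))%:R.
Proof.
move=> ln; apply: le_trans (ler_norm_sum _ _ _) _.
apply: (@le_trans _ _ (\sum_(x in [set: site d n]) (#|site d n| * n.*2)%:R)).
  apply: ler_sum => x _; rewrite ger0_norm ?tscore_ge0//.
  by apply: le_trans (tscore_le _ _ _ _ _) _; rewrite ler_nat leq_mul ?max_card.
by rewrite sumr_const cardsT -[leLHS]mulr_natl -natrM.
Qed.

(** The two sums agree unless some site is isolated, and both have a crude deterministic bound: a
    union bound compares their moments, then [logd_lipschitz] their cumulants. *)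
Lemma truncation_error k : exists2 c : R, 0 <= c & forall n l (P : R),
  (l <= n.*2)%N -> 0 <= P ->
  (forall x, esp (trace_prob X n) (fun S => (isolated (@sdist d n) l x S)%:R) <= P) ->
  `|logd (nmom (trace_prob X n) (NN_sum R n)) k -
    logd (nmom (trace_prob X n) (@NN_trunc n l)) k| <=
  c * (2 * (#|site d n|%:R * P)) * (#|site d n| * (#|site d n| * n.*2))%:R ^+ k.+1.
Proof.
have [c c0 Hc] := @logd_lipschitz R k; exists c => // n l P ln P0 HP.
set B : R := (_ * (_ * _))%:R; have B0 : 0 <= B by [].
have pP := @fprob_trace _ _ _ _ _ X n.
have bd1 j : (j <= k.+1)%N -> `|nmom (trace_prob X n) (NN_sum R n) j| <= B ^+ j.
  by move=> _; apply: nmom_bound => // S; exact: NN_sum_le.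
have bd2 j : (j <= k.+1)%N -> `|nmom (trace_prob X n) (@NN_trunc n l) j| <= B ^+ j.
  by move=> _; apply: nmom_bound => // S; exact: NN_trunc_le.
have NP0 : 0 <= 2 * (#|site d n|%:R * P) by rewrite !mulr_ge0.
have [] := Hc B (2 * (#|site d n|%:R * P)) _ _ B0 NP0 bd1 bd2 _ => //.
move=> j _; rewrite /nmom -mulrBl -espB normrM normfV normr_nat.
rewrite ler_pdivrMr ?ltr0n ?fact_gt0//.
apply: (@le_trans _ _ (2 * (#|site d n|%:R * P) * B ^+ j)); last first.
  by rewrite ler_peMr ?ler1n ?fact_gt0// mulr_ge0// exprn_ge0.
apply: le_trans (norm_esp pP _) _.
apply: (@le_trans _ _ (esp (trace_prob X n) (fun S =>
   \sum_x (2 * B ^+ j) * (isolated (@sdist d n) l x S)%:R))); last first.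
  rewrite esp_sum -mulrA mulrCA -[leRHS]mulrA -[X in _ <= X * _]mulr1n.
  apply: (@le_trans _ _ (\sum_(x : site d n) 2 * B ^+ j * P)).
    by apply: ler_sum => x _; rewrite espZ ler_wpM2l// mulr_ge0// exprn_ge0.
  by rewrite sumr_const -[leLHS]mulr_natl cardE mulr1n le_eqVlt; apply/orP; left; apply/eqP; ring.
apply: esp_le => // S.
have [/existsP[x xS]|] := boolP [exists x, isolated (@sdist d n) l x S].
  rewrite (bigD1 x)//= xS mulr1; apply: ler_wpDr.
    by apply: sumr_ge0 => y _; rewrite !mulr_ge0// exprn_ge0.
  apply: le_trans (ler_normB _ _) _; rewrite mulrDl mul1r !normrX.
  by apply: lerD; rewrite lerXn2r ?nnegrE ?NN_sum_le ?NN_trunc_le.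
rewrite negb_exists => /forallP H.
rewrite (_ : NN_sum R n S = NN_trunc l S); last first.
  by apply: eq_bigr => x _; apply: score_tscore.
by rewrite subrr normr0; apply: sumr_ge0 => x _; rewrite !mulr_ge0// exprn_ge0.
Qed.

(** A ball of radius u^a1 has at most (3 u^a1)^d sites, so the logarithms of all losses are of order
    at most u^(2 a1 d); decorrelation is invoked with one more power of u. *)
Lemma truncated_cumulant_bound k a1 : exists (c gamma : R) (a2 : nat),
  [/\ 0 <= c, 0 < gamma & forall n u, (0 < u)%N ->
  `|logd (nmom (trace_prob X n) (@NN_trunc n (u ^ a1))) k| <=
   c * ((3 * u ^ a1) ^ d * u ^ a1)%:R ^+ (2 * k.+1) *
   (#|site d n|%:R * ((7 * k.+1 * u ^ a2) ^ d)%:R ^+ k.+1 +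
    #|site d n|%:R ^+ k.+1 * 4 ^+ (k.+1 * (3 * u ^ a1) ^ d) *
    (A0 * expR ((k.+1 * (3 * u ^ a1) ^ d)%:R ^+ 2 -
                gamma * u%:R ^+ (2 * (a1 * d)).+1)))].
Proof.
have [c c0 Hc] := @local_sum_cumulant_bound R k.
have [M [g [g0 H]]] := dec (2 * (a1 * d)).+1.
exists c, g, (M + a1)%N; split => // n u u0.
have l0 e : (0 < u ^ e)%N by rewrite expn_gt0 u0.
(* L is the decorrelation distance plus twice the range of the scores, so L <= 3 u^a2. The factors 3
   and 7 bound [r.*2.+1] for the radii u^a1 and (k + 1) L. *)
apply: (Hc _ (@sdist d n) _ _ _ _ (u ^ a1)%N (u ^ M + (u ^ a1).*2)%N).
- exact: sdistxx.
- by move=> x y; exact: ldistC.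
- by move=> x y z; exact: ldist_triangle.
- exact: fprob_trace.
- by rewrite ler1n muln_gt0 expn_gt0 muln_gt0 l0.
- by rewrite mulr_ge0 ?expR_ge0// ltW.
- move=> x S; rewrite ger0_norm ?tscore_ge0//.
  apply: le_trans (tscore_le _ _ _ _ _) _; rewrite ler_nat leq_mul2r; apply/orP; right.
  apply: leq_trans (card_dball _ _) _; rewrite leq_exp2r//.
  by have := l0 a1; lia.
- by move=> x S; apply: tscore_local; exact: sdistxx.
- move=> x; apply: leq_trans (card_dball _ _) _; rewrite leq_exp2r//.
  by have := l0 a1; lia.
- move=> x; apply: leq_trans (card_dball _ _) _; rewrite leq_exp2r//.
  have h1 : (u ^ M <= u ^ (M + a1))%N by rewrite leq_pexp2l// leq_addr.
  have h2 : (u ^ a1 <= u ^ (M + a1))%N by rewrite leq_pexp2l// leq_addl.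
  have h3 := l0 (M + a1)%N.
  have h4 : (u ^ M + (u ^ a1).*2 <= 3 * u ^ (M + a1))%N by lia.
  have h5 : (k.+1 * (u ^ M + (u ^ a1).*2) <= k.+1 * (3 * u ^ (M + a1)))%N.
    by rewrite leq_mul2l h4 orbT.
  have h6 : (1 <= k.+1 * u ^ (M + a1))%N by rewrite muln_gt0.
  by lia.
- move=> C1 C2 _ _ Ck far; apply: H => // x y xC yC.
  by have := far x y xC yC; lia.
Qed.

Lemma leq_pow2r (m n k : nat) : (m <= n)%N -> (m ^ k <= n ^ k)%N.
Proof. by case: k => [//|k] h; rewrite leq_exp2r. Qed.

Lemma four_pow_le_expR (m : nat) : 4 ^+ m <= expR ((2 * m)%:R : R).
Proof.
have e2 : 4 <= expR (2 : R).
  have h : 2 <= expR (1 : R) by apply: le_trans (expR_ge1Dx _); lra.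
  by rewrite (_ : 2 = 1 + 1 :> R)// expRD (_ : 4 = 2 * 2 :> R) ?ler_pM// -natrM.
by rewrite natrM mulrC expRM_natl lerXn2r ?nnegrE ?expR_ge0.
Qed.

Lemma cumulant_growth k : exists C : R, \forall n \near \oo,
  `|logd (nmom (trace_prob X n) (NN_sum R n)) k| <= C * n%:R ^+ d.+1.
Proof.
have [M1 [g1 [g10 Hiso]]] := isolated_probability.
pose a1 := M1.+1.
have [c [g2 [a2 [c0 g20 Hcum]]]] := truncated_cumulant_bound k a1.
have [c' c'0 Herr] := truncation_error k.
pose K := k.+1.
(* q collects the powers of u in the main term besides the number of sites. As Q > q, they cost at
   most u^Q <= n, whence n^(d+1); as Q > a1, also (d + 1) u^a1 <= n for large u. *)
pose q := ((a1 * d + a1) * (2 * K) + a2 * d * K)%N.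
pose Q := (q + a1).+1.
pose c3 : R := (3 ^+ d) ^+ (2 * K) * ((7 * K)%:R ^+ d) ^+ K.
pose cn : R := 2 ^+ Q.
pose cN : R := (3 * cn) ^+ d.
pose W := (2 * (a1 * d))%N.
(* The coefficient of u^W in 3 v^2, for v the number of sites involved: 2 v^2 bounds the logarithm
   of 4^v, and v^2 comes from the clustering constant. *)
pose c4 : R := 3 * (K%:R * 3 ^+ d) ^+ 2.
pose K2 : R := c * c3 * cN ^+ K * A0.
pose q2 := (q + Q * d * K)%N.
pose K3 : R := c' * (2 * cN) * (2 * cN ^+ 2 * cn) ^+ K.
pose q3 := (Q * d + (2 * (Q * d) + Q) * K)%N.
have c30 : 0 <= c3 by rewrite mulr_ge0 ?exprn_ge0.
have cn0 : 0 <= cn by rewrite exprn_ge0.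
have cN0 : 0 <= cN by rewrite exprn_ge0// mulr_ge0.
have c40 : 0 <= c4 by rewrite mulr_ge0// sqr_ge0.
have A0' := ltW A00.
have K20 : 0 <= K2 by rewrite !mulr_ge0// exprn_ge0.
have K30 : 0 <= K3 by rewrite !mulr_ge0 ?exprn_ge0// ?mulr_ge0// ?exprn_ge0.
have K3A0 : 0 <= K3 * A0 by rewrite mulr_ge0.
have /andP[p0 p1] := p01.
have [U1 _ HU1] := exp_decay q2 W K20 c40 g20.
have [U2 _ HU2] := exp_decay q3 0 K30 (lexx 0) p0.
have [U3 _ HU3] := exp_decay q3.+1 2 K3A0 (ler0n R 3) g10.
pose U0 := maxn d.+1 (maxn U1 (maxn U2 U3)).
(* The additive 3 is 1 for the correlation error and 2 for the truncation. *)
exists (c * c3 * 3 ^+ d + 3); exists (U0 ^ Q).+1 => // n /= Un.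
have n0 : (0 < n)%N by exact: leq_trans Un.
(* n is comparable to u^Q, and the truncation and separation scales are the
   smaller powers u^a1 and u^a2. *)
have [u [u0 uQ nu]] := nat_root n0 (ltn0Sn _ : (0 < Q)%N).
have U0u : (U0 <= u)%N.
  rewrite leqNgt; apply/negP => uU; have : (u.+1 ^ Q <= U0 ^ Q)%N by rewrite leq_exp2r.
  move=> h; have := leq_trans nu h; rewrite ltnNge; move/negP; apply.
  exact: ltnW.
have [du u1 u2 u3] : [/\ (d.+1 <= u)%N, (U1 <= u)%N, (U2 <= u)%N & (U3 <= u)%N].
  by move: U0u; rewrite !geq_max => /and4P.
have {HU1}E1 := HU1 u u1; have {HU2}E2 := HU2 u u2; have {HU3}E3 := HU3 u u3.
rewrite /= in E1 E2 E3.
set U : R := u%:R in E1 E2 E3.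
have Uge1 : 1 <= U by rewrite ler1n.
have Uge0 : 0 <= U by [].
have nge1 : 1 <= n%:R :> R by rewrite ler1n.
have UQn : U ^+ Q <= n%:R by rewrite -natrX ler_nat.
have nU : n%:R <= cn * U ^+ Q.
  rewrite -exprMn -natrM -natrX ler_nat; apply: leq_trans (ltnW nu) _.
  by apply: leq_pow2r; clear -u0; lia.
pose N : R := #|site d n|%:R.
have N0 : 0 <= N by [].
have N1 : N <= 3 ^+ d * n%:R ^+ d.
  rewrite -exprMn -natrM -natrX ler_nat; apply: leq_trans (card_site_le _ _) _.
  by apply: leq_pow2r; clear -n0; lia.
have N2 : N <= cN * U ^+ (Q * d).
  apply: le_trans N1 _; rewrite -exprMn /cN exprM -exprMn -mulrA.
  by rewrite lerXn2r ?nnegrE ?mulr_ge0 ?exprn_ge0// ler_wpM2l.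
have ln : (d.+1 * u ^ a1 <= n)%N.
  apply: leq_trans uQ; apply: (@leq_trans (u * u ^ a1)).
    by rewrite leq_mul2r du orbT.
  by rewrite -expnS leq_pexp2l// /Q ltnS leq_addl.
have ln2 : (u ^ a1 <= n.*2)%N.
  apply: (@leq_trans n); last by rewrite -addnn leq_addr.
  by apply: leq_trans ln; rewrite leq_pmull.
have AV : ((3 * u ^ a1) ^ d * u ^ a1)%:R ^+ (2 * K) *
    ((7 * K * u ^ a2) ^ d)%:R ^+ K = c3 * U ^+ q :> R.
  rewrite !(natrM, natrX) -/U.
  have -> : (3 * U ^+ a1) ^+ d * U ^+ a1 = 3 ^+ d * U ^+ (a1 * d + a1).
    by rewrite exprMn -exprM exprD mulrA.
  have -> : (7 * K%:R * U ^+ a2) ^+ d = (7 * K)%:R ^+ d * U ^+ (a2 * d).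
    by rewrite exprMn -exprM natrM.
  rewrite (exprMn (2 * K)) (exprMn K (_ ^+ d)) -!(exprM U) /q exprD /c3.
  by rewrite mulrACA.
have V1 : 1 <= ((7 * K * u ^ a2) ^ d)%:R ^+ K :> R.
  by rewrite exprn_ege1// ler1n expn_gt0 muln_gt0 /= expn_gt0 u0.
have A2 : ((3 * u ^ a1) ^ d * u ^ a1)%:R ^+ (2 * K) <= c3 * U ^+ q.
  by rewrite -AV ler_peMr// exprn_ge0.
have T1 : c * ((3 * u ^ a1) ^ d * u ^ a1)%:R ^+ (2 * K) *
   (N * ((7 * K * u ^ a2) ^ d)%:R ^+ K) <= c * c3 * 3 ^+ d * n%:R ^+ d.+1.
  rewrite mulrCA -[X in N * X]mulrA AV.
  have -> : c * c3 * 3 ^+ d * n%:R ^+ d.+1 = (3 ^+ d * n%:R ^+ d) * (c * (c3 * n%:R)).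
    by rewrite exprS; ring.
  apply: ler_pM => //.
    by rewrite !mulr_ge0// exprn_ge0.
  rewrite ler_wpM2l// ler_wpM2l//; apply: le_trans UQn.
  by rewrite ler_weXn2l// /Q -addnS leq_addr.
pose v := (K * (3 * u ^ a1) ^ d)%N.
have vE : v%:R ^+ 2 = (K%:R * 3 ^+ d) ^+ 2 * U ^+ W :> R.
  by rewrite /v /W !(natrM, natrX) -/U !exprMn -!exprM mulrA [(2 * _)%N]mulnC mulnA.
have T2 : c * ((3 * u ^ a1) ^ d * u ^ a1)%:R ^+ (2 * K) *
   (N ^+ K * 4 ^+ v * (A0 * expR (v%:R ^+ 2 - g2 * U ^+ W.+1))) <= 1.
  apply: le_trans E1.
  have v4 : 4 ^+ v <= expR (2 * v%:R ^+ 2 : R).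
    apply: le_trans (four_pow_le_expR v) _; rewrite ler_expR natrM ler_wpM2l//.
    by rewrite -natrX ler_nat; case: (v) => // v'; rewrite leq_pmulr.
  have -> : expR (c4 * U ^+ W - g2 * U ^+ W.+1) =
      expR (2 * v%:R ^+ 2) * expR (v%:R ^+ 2 - g2 * U ^+ W.+1).
    by rewrite -expRD; congr expR; rewrite /c4 vE; ring.
  have NK : N ^+ K <= cN ^+ K * U ^+ (Q * d * K).
    rewrite [in leRHS]exprM -exprMn lerXn2r ?nnegrE//.
    by rewrite mulr_ge0// exprn_ge0.
  set e := expR (v%:R ^+ 2 - _); have e0 : 0 <= e by exact: expR_ge0.
  have -> : K2 * U ^+ q2 * (expR (2 * v%:R ^+ 2) * e) =
    c * (c3 * U ^+ q) * ((cN ^+ K * U ^+ (Q * d * K)) * expR (2 * v%:R ^+ 2) * (A0 * e)).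
    by rewrite /K2 /q2 exprD; ring.
  apply: ler_pM.
  - by rewrite mulr_ge0// exprn_ge0.
  - by rewrite !mulr_ge0// exprn_ge0.
  - by rewrite ler_wpM2l.
  apply: ler_wpM2r; first by rewrite mulr_ge0.
  by apply: ler_pM => //; rewrite exprn_ge0.
have P0 : 0 <= void_bound g1 u.
  rewrite addr_ge0 ?mulr_ge0 ?exprn_ge0 ?expR_ge0//.
  by rewrite subr_ge0.
have Pv : void_bound g1 u <= expR (0 * U ^+ 0 - p * U ^+ 1) +
    A0 * U * expR (3 * U ^+ 2 - g1 * U ^+ 3).
  apply: lerD.
    rewrite mul0r sub0r expr1 -mulNr expRM_natr lerXn2r ?nnegrE ?subr_ge0 ?expR_ge0//.
    exact: expR_ge1Dx.
  rewrite -/U; set e := expR (U ^+ 2 - _).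
  have -> : U * (4 ^+ u * (A0 * e)) = A0 * U * (4 ^+ u * e) by ring.
  apply: ler_wpM2l; first exact: mulr_ge0.
  rewrite {}/e.
  have -> : 3 * U ^+ 2 - g1 * U ^+ 3 = 2 * U ^+ 2 + (U ^+ 2 - g1 * U ^+ 3) by ring.
  rewrite [leRHS]expRD ler_wpM2r ?expR_ge0//.
  apply: le_trans (four_pow_le_expR u) _; rewrite ler_expR natrM ler_wpM2l//.
  by rewrite -/U expr2 ler_peMr.
have BU : (#|site d n| * (#|site d n| * n.*2))%:R <=
   (2 * cN ^+ 2 * cn) * U ^+ (2 * (Q * d) + Q) :> R.
  rewrite !natrM -/N.
  have -> : 2 * cN ^+ 2 * cn * U ^+ (2 * (Q * d) + Q) =
    (cN * U ^+ (Q * d)) * ((cN * U ^+ (Q * d)) * (2 * (cn * U ^+ Q))).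
    by rewrite exprD mul2n -addnn exprD; ring.
  have D0 : 0 <= n.*2%:R :> R by [].
  apply: ler_pM => //; first exact: mulr_ge0.
  by apply: ler_pM => //; rewrite -mul2n natrM ler_wpM2l.
have T3 : c' * (2 * (N * void_bound g1 u)) *
    (#|site d n| * (#|site d n| * n.*2))%:R ^+ K <= 2.
  have h : c' * (2 * (N * void_bound g1 u)) *
      (#|site d n| * (#|site d n| * n.*2))%:R ^+ K <= (K3 * U ^+ q3) * void_bound g1 u.
    have -> : K3 * U ^+ q3 * void_bound g1 u = c' * (2 * ((cN * U ^+ (Q * d)) * void_bound g1 u)) *
        ((2 * cN ^+ 2 * cn) * U ^+ (2 * (Q * d) + Q)) ^+ K.
      rewrite /K3 /q3 [in LHS]exprD (exprM U _ K) [in RHS]exprMn.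
      set D := (2 * cN ^+ 2 * cn) ^+ K; set E := (U ^+ (2 * (Q * d) + Q)) ^+ K.
      by ring.
    apply: ler_pM.
    - by rewrite !mulr_ge0.
    - by rewrite exprn_ge0.
    - by rewrite ler_wpM2l// ler_wpM2l// ler_wpM2r.
    - rewrite lerXn2r ?nnegrE//.
      by apply: mulr_ge0 (exprn_ge0 _ Uge0); do 2 (apply: mulr_ge0 => //); exact: sqr_ge0.
  apply: le_trans h _; apply: (@le_trans _ _ (K3 * U ^+ q3 * (expR (0 * U ^+ 0 - p * U ^+ 1) +
      A0 * U * expR (3 * U ^+ 2 - g1 * U ^+ 3)))).
    by rewrite ler_wpM2l// mulr_ge0// exprn_ge0.
  rewrite mulrDr (_ : 2 = 1 + 1 :> R)//; apply: lerD; first exact: E2.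
  by apply: le_trans E3; rewrite (exprSr U q3) le_eqVlt; apply/orP; left; apply/eqP; rewrite /K3; ring.
have F1 : `|logd (nmom (trace_prob X n) (@NN_trunc n (u ^ a1))) k| <=
    c * c3 * 3 ^+ d * n%:R ^+ d.+1 + 1.
  apply: le_trans (Hcum n u u0) _; rewrite mulrDr; apply: lerD; first exact: T1.
  exact: T2.
have F2 := Herr n (u ^ a1)%N _ ln2 P0 (fun x => Hiso n u x u0 ln).
have F3 := le_trans F2 T3.
set x1 := logd _ k in F1 F3; set x2 := logd _ k in F3 *.
have -> : x2 = (x2 - x1) + x1 by rewrite subrK.
apply: le_trans (ler_normD _ _) _.
rewrite mulrDl; have nd : 1 <= n%:R ^+ d.+1 :> R by rewrite exprn_ege1.
clear -F1 F3 nd; lra.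
Qed.

End spin_model.

(** * Standardization and conclusion *)

Lemma normal_prob_gauss_cdf (R : realType) (a : R) :
  normal_prob 0 1 `]-oo, a]%classic = (gauss_cdf a)%:E.
Proof.
have I := gauss_integrable_le_indic a; rewrite /gauss_integrable in I.
rewrite /gauss_cdf /gauss_mean /Rintegral fineK; last exact: integrable_fin_num I.
rewrite /normal_prob [LHS]integral_mkcond; apply: eq_integral => x _ /=.
rewrite patchE; have -> : (x \in `]-oo, a]%classic) = (x <= a).
  by apply/idP/idP; rewrite classical_sets.inE /= in_itv.
by case: (x <= a); rewrite ?mul1r ?mul0r.
Qed.

Lemma standardization_decay (R : realType) (c nu s : R) (n m k : nat) :
  0 < c -> (0 < n)%N -> m%:R <= nu / 2 * k%:R -> c * n%:R `^ nu <= s ->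
  (s `^ (- (1 / 2))) ^+ k <= (c `^ (1 / 2) ^+ k * n%:R ^+ m)^-1.
Proof.
move=> c0 n0 mk cs.
have n1 : 1 <= n%:R :> R by rewrite ler1n.
have m0 : 0 < c * n%:R `^ nu by rewrite mulr_gt0// powR_gt0// ltr0n.
have s0 : 0 < s by exact: lt_le_trans cs.
have P0 : 0 < c `^ (1 / 2) by rewrite powR_gt0.
rewrite powRN exprVn lef_pV2; last 2 first.
- by rewrite posrE exprn_gt0// powR_gt0.
- by rewrite posrE mulr_gt0 ?exprn_gt0// ltr0n.
apply: (@le_trans _ _ ((c * n%:R `^ nu) `^ (1 / 2) ^+ k)).
  rewrite powRM ?powR_ge0 ?(ltW c0)// exprMn ler_wpM2l ?exprn_ge0 ?powR_ge0//.
  rewrite -powRrM -!powR_mulrn ?powR_ge0// -powRrM ler_powR//.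
  by apply: le_trans mk _; rewrite div1r.
rewrite lerXn2r ?nnegrE ?powR_ge0// ge0_ler_powR ?nnegrE ?(ltW m0) ?(ltW s0)//.
Qed.

Lemma variance_zero_dim (R : realType) (disp : measure_display)
    (Om : measurableType disp) (Pr : probability Om R)
    (X : {RV Pr >-> configuration 0}) n : 'V_Pr[H_NN X n] = 0%E.
Proof.
have -> : H_NN X n = cst 0.
  apply/funext => w; rewrite /H_NN fsbig1// => x _.
  by rewrite /xi_NN fsbig1// => y _; rewrite /l1norm big_ord0.
exact: variance_cst.
Qed.

Section standardized.
Variables (R : realType) (disp : measure_display) (Om : measurableType disp).
Variables (Pr : probability Om R) (d : nat) (X : {RV Pr >-> configuration d}).

Definition NN_var n := fine 'V_Pr[H_NN X n].

Definition NN_std n (S : {set site d n}) : R :=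
  NN_var n `^ (- (1 / 2)) * (@NN_sum R d n S - fine 'E_Pr[H_NN X n]).

Lemma mean_NN_sum n : fine 'E_Pr[H_NN X n] = esp (trace_prob X n) (@NN_sum R d n).
Proof. by rewrite H_NN_trace expectation_trace. Qed.

Lemma variance_NN_sum n : 'V_Pr[H_NN X n] = (NN_var n)%:E.
Proof. by rewrite /NN_var H_NN_trace variance_trace. Qed.

Lemma NN_std_mean n : esp (trace_prob X n) (@NN_std n) = 0.
Proof.
rewrite espZ espB esp_cst; last exact: fprob_trace.
by rewrite mean_NN_sum subrr mulr0.
Qed.

Lemma NN_std_sqr n : 0 < NN_var n ->
  esp (trace_prob X n) (fun S => @NN_std n S ^+ 2) = 1.
Proof.
move=> V0; rewrite /NN_std.
under [X in esp _ X]eq_fun do rewrite exprMn.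
rewrite espZ mean_NN_sum.
rewrite (_ : esp _ _ = NN_var n); last by rewrite /NN_var H_NN_trace variance_trace.
rewrite -powR_mulrn ?powR_ge0// -powRrM (_ : - (1 / 2) * 2 = -1); last by field.
by rewrite powR_inv1 ?ltW// mulVf// gt_eqF.
Qed.

Lemma prob_NN_std n a :
  Pr [set w | NN_var n `^ (- (1 / 2)) * (H_NN X n w - fine 'E_Pr[H_NN X n]) <= a] =
  (esp (trace_prob X n) (fun S => (@NN_std n S <= a)%R%:R))%:E.
Proof.
rewrite -(prob_trace X (fun S => @NN_std n S <= a)) /NN_std.
have E w : H_NN X n w = @NN_sum R d n (trace X n w) by rewrite H_NN_trace.
by congr (Pr _); apply/seteqP; split => w /=; rewrite E.
Qed.

End standardized.

Theorem theorem2p8 (R : realType) (disp : measure_display)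
    (T : measurableType disp) (Pr : probability T R) (d : nat)
    (X : {RV Pr >-> configuration d})
    (hX : exponentially_clustering X)
    (nu : R) (hnu : 0 < nu)
    (hvar : exists2 c : R, 0 < c &
       \forall n \near \oo,
         ((c * (window_card d n)%:R `^ nu)%:E <= 'V_Pr[H_NN X n])%E) :
  cvg_in_distribution Pr
    (fun (n : nat) (w : T) =>
       fine 'V_Pr[H_NN X n] `^ (- (1 / 2))
       * (H_NN X n w - fine 'E_Pr[H_NN X n]))
    (normal_prob 0 1).
Proof.
move=> a _; rewrite normal_prob_gauss_cdf.
under eq_cvg do rewrite (prob_NN_std X).
apply: cvg_EFin; first exact: nearW.
have [c c0 V] := hvar.
(* In dimension 0 all distances, hence the variance, vanish, against the lower bound on a nonempty
   window. *)
have [d0|d0] := posnP d.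
  exfalso; move: X V {hX hvar}; rewrite d0 => X [N _ /(_ N (leqnn N))].
  rewrite variance_zero_dim lee_fin leNgt mulr_gt0// powR_gt0// ltr0n window_cardE.
  have [t _] : exists t : site 0 N, site_pt t = 0 by apply: site_of; rewrite /l1norm big_ord0.
  by apply/card_gt0P; exists t.
have [p [A0 [p01 A00 incl1 dec]]] := exponentially_clustering_decorrelated hX.
have Vn : \forall n \near \oo, (0 < n)%N /\ c * n%:R `^ nu <= NN_var X n.
  near=> n; have n0 : (0 < n)%N by near: n; exact: nbhs_infty_gt.
  split=> //; rewrite -lee_fin -variance_NN_sum.
  apply: (@le_trans _ _ (c * (window_card d n)%:R `^ nu)%:E); last by near: n.
  rewrite lee_fin ler_wpM2l ?(ltW c0)// ge0_ler_powR ?nnegrE ?(ltW hnu)//.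
  by rewrite ler_nat window_card_ge.
have V0 : \forall n \near \oo, 0 < NN_var X n.
  apply: filterS Vn => n [n0]; apply: lt_le_trans.
  by rewrite mulr_gt0// powR_gt0// ltr0n.
(* Standardizing divides the cumulant of order k + 1 by the power (k + 1) / 2 of the variance. For k
   >= K this is at least a constant times n^(d+2), one power of n more than the growth of the
   cumulant. *)
pose K := (Num.truncn (d.+2%:R / (nu / 2))).+1.
apply: (@clt_of_cumulants _ _ _ (@NN_std _ _ _ _ _ X) _ K) => [n||].
- exact: fprob_trace.
- by apply: filterS V0 => n Vn0; split; [exact: NN_std_mean|exact: NN_std_sqr].
move=> k Kk; have k0 : (0 < k)%N by exact: leq_trans Kk.
have dk : d.+2%:R <= nu / 2 * k.+1%:R.
  rewrite mulrC -ler_pdivrMr ?divr_gt0//.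
  apply: (@le_trans _ _ K%:R); first by rewrite ltW// truncnS_gt.
  by rewrite ler_nat; exact: leq_trans Kk _.
have [C HC] := cumulant_growth p01 A00 incl1 dec d0 k.
pose B := C / (c `^ (1 / 2)) ^+ k.+1.
apply/cvgr0Pnorm_le => e e0; near=> n.
have [n0 nV] : (0 < n)%N /\ c * n%:R `^ nu <= NN_var X n by near: n.
have nR : 0 < n%:R :> R by rewrite ltr0n.
rewrite cumulant_affine//; last exact: fprob_trace.
have t0 : 0 <= NN_var X n `^ (- (1 / 2)) by exact: powR_ge0.
rewrite normrM ger0_norm ?exprn_ge0//.
apply: (@le_trans _ _ (B / n%:R)).
  apply: (@le_trans _ _ ((c `^ (1 / 2) ^+ k.+1 * n%:R ^+ d.+2)^-1 * (C * n%:R ^+ d.+1))).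
    apply: ler_pM => //; first by rewrite exprn_ge0.
      exact: standardization_decay c0 n0 dk nV.
    by near: n.
  have r0 : (c `^ (1 / 2)) ^+ k.+1 != 0 by rewrite expf_neq0// gt_eqF// powR_gt0.
  have x0 : n%:R ^+ d.+1 != 0 :> R by rewrite expf_neq0// gt_eqF.
  rewrite /B (exprS _ d.+1); move: (_ ^+ k.+1) (_ ^+ d.+1) r0 x0 => r x r0 x0.
  rewrite le_eqVlt; apply/orP; left; apply/eqP; field.
  by rewrite r0 x0 gt_eqF.
rewrite ler_pdivrMr// mulrC -ler_pdivrMr//.
by near: n; exact: nbhs_infty_ger.
Unshelve. all: by end_near.
Qed.
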